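(* Let $\mathcal T=[0,\tau]$ with $\tau>0$, let $\vartheta_0\in\Theta$ be the true value, and suppose that conditions $\mathcal L_1$, $\mathcal L_2$, $\mathcal L_3$ listed in the context hold with $k=2$, that $a_2>0$, that $\psi_1>0$, and that for some constant $b>0$ $$\inf_{a_2 b|v|>1}\int_0^\tau\sin^2\bigl(v\,g(t)\bigr)\,\lambda(\vartheta_0,t)\,dt>0 .$$ Then for every $y\in\mathbb R$, as $n\to\infty$ (with $\varepsilon=n^{-1/2}$), $$\mathbf P_{\vartheta_0}\left(\frac{\sqrt n\,(\check\vartheta_n-\vartheta_0)}{\psi_1\sqrt{a_2}}<y\right)=F(y)+\frac{a_3-\bigl(a_3+6a_2^{3/2}b_2\bigr)y^2}{6a_2^{3/2}}\,f(y)\,\varepsilon+o(\varepsilon).$$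
   Context: Let $\Theta=(\alpha,\beta)$ be a bounded open interval of $\mathbb R$ and let $\mathcal T=[0,\tau]$. For each $\vartheta\in\Theta$ let $\lambda(\vartheta,\cdot):\mathcal T\to[0,\infty)$ be an intensity function. One observes $n$ independent inhomogeneous Poisson (counting) processes $X^{(n)}=(X_1,\dots,X_n)$, $X_j=\{X_j(t),\,t\in\mathcal T\}$, all with the same intensity function $\lambda(\vartheta_0,\cdot)$, where $\vartheta_0\in\Theta$ is the true value; $\mathbf P_{\vartheta_0}$ denotes the corresponding probability. Let $g:\mathcal T\to\mathbb R$ be a given measurable function and put $$m(\vartheta)=\int_{\mathcal T}g(t)\lambda(\vartheta,t)\,dt,\qquad \bar m_n=\frac1n\sum_{j=1}^n\int_{\mathcal T}g(t)\,dX_j(t).$$ Conditions $\mathcal L$ (for a given integer $k\ge1$): $\mathcal L_1$: the function $m(\vartheta)$, $\vartheta\in\Theta$, has $k+2$ continuous bounded derivatives. $\mathcal L_2$: the function $m(\vartheta)$, $\vartheta\in\Theta$, is monotone and $\inf_{\vartheta\in\Theta}|\dot m(\vartheta)|>0$, where $\dot m$ is the derivative of $m$ with respect to $\vartheta$. $\mathcal L_3$: for every $q>0$, $\ \sup_{\vartheta\in\Theta}\int_{\mathcal T}|g(t)|^{q}\lambda(\vartheta,t)\,dt<\infty$. Under these conditions $m$ is regarded as a continuous function on $[\alpha,\beta]$ (extended by its limits at the endpoints), and $G$ denotes the inverse function of $m$, so that $G(m(\vartheta))=\vartheta$; $G^{(l)}$ is its $l$-th derivative. The method of moments estimator (MME)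 $\check\vartheta_n$ is the value of $\vartheta\in[\alpha,\beta]$ minimizing $(m(\vartheta)-\bar m_n)^2$. Thus, when $m$ is increasing, $\check\vartheta_n=\alpha$ if $\bar m_n\le m(\alpha)$, $\check\vartheta_n=G(\bar m_n)$ if $m(\alpha)<\bar m_n<m(\beta)$, and $\check\vartheta_n=\beta$ if $\bar m_n\ge m(\beta)$. Notation: $\psi_l=\psi_l(\vartheta_0)=\dfrac{G^{(l)}(m(\vartheta_0))}{l!}$ for $l=1,2$; $a_q=\int_0^\tau g(t)^q\lambda(\vartheta_0,t)\,dt$ for $q=2,3$; $b_2=\dfrac{\psi_2\sqrt{a_2}}{\psi_1}$; $F(y)=\int_{-\infty}^y f(x)\,dx$ with $f(x)=\frac1{\sqrt{2\pi}}e^{-x^2/2}$ the standard Gaussian distribution function and density. *)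

(* Defs.v *)
From HB Require Import structures.
From mathcomp Require Import all_boot all_order all_algebra.
From mathcomp Require Import all_classical all_reals all_analysis.

Set Implicit Arguments.
Unset Strict Implicit.
Unset Printing Implicit Defensive.

Import Order.TTheory GRing.Theory Num.Theory.
Import numFieldNormedType.Exports.

Local Open Scope classical_set_scope.
Local Open Scope ring_scope.

(* Product rule over every subfamily; this is mutual independence because it is
   only applied to sigma-algebras. *)
Definition independent_systems (R : realType) (d : measure_display)
    (Omega : measurableType d) (P : probability Omega R) (I : finType)
    (F : I -> set_system Omega) : Prop :=
  forall (J : {set I}) (A : I -> set Omega),
    (forall i, i \in J -> F i (A i)) ->
    P (\bigcap_(i in [set` J]) A i) = (\prod_(i in J) P (A i))%E.

Section CountingProcess.
Context (R : realType) (d : measure_display) (Omega : measurableType d).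
Implicit Types (P : probability Omega R) (tau : R) (lambda g : R -> R).

(* The paths of a process {X(t), 0 <= t <= tau} are elements of [cumulative R R],
   i.e. nondecreasing right-continuous functions, so that the library's
   Lebesgue-Stieltjes measure applies to them.  They are defined on the whole
   line, but their values outside [0, tau] are never used. *)
Implicit Types X : Omega -> cumulative R R.

Definition poisson_mean lambda (s t : R) : R :=
  \int[lebesgue_measure]_(u in `[s, t]) lambda u.

(* [poisson_prob r 0 [set k]] is the mass at [k] of the Poisson law of mean [r]
   (the Dirac mass at 0 if r = 0); the second argument of [poisson_prob] is not
   used by the library. *)
Definition is_poisson_process P tau lambda X : Prop :=
  [/\ lebesgue_measure.-integrable `[0, tau] (EFin \o lambda),
      forall t, t \in `[0, tau] -> measurable_fun setT (fun w => X w t),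
      forall w, X w 0 = 0 /\
        forall t, t \in `[0, tau] -> X w t \is a Num.nat,
      forall s t, 0 <= s -> s <= t -> t <= tau -> forall k : nat,
        P [set w | X w t - X w s = k%:R] =
        poisson_prob (poisson_mean lambda s t) 0 [set k]
    & forall (k : nat) (t : nat -> R),
        (forall i, (i <= k)%N -> t i \in `[0, tau]) ->
        (forall i, (i < k)%N -> t i <= t i.+1) ->
        independent_systems P (fun i : 'I_k =>
          g_sigma_algebra_preimage (fun w => X w (t i.+1) - X w (t i)))].

Definition process_sigma_algebra tau X : set_system Omega :=
  <<s \bigcup_(t in `[0, tau]) g_sigma_algebra_preimage (fun w => X w t) >>.

Definition independent_processes P tau (n : nat)
    (X : 'I_n -> Omega -> cumulative R R) : Prop :=
  independent_systems P (fun j => process_sigma_algebra tau (X j)).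

(* The integral of [g] over [0, tau] with respect to dX; since X(0) = 0 there is
   no jump at 0, whence the half-open interval. *)
Definition stochastic_integral tau g X (w : Omega) : R :=
  \int[lebesgue_stieltjes_measure (X w)]_(t in `]0, tau]) g t.

Definition empirical_moment tau g (n : nat)
    (X : 'I_n -> Omega -> cumulative R R) (w : Omega) : R :=
  n%:R^-1 * \sum_(j < n) stochastic_integral tau g (X j) w.

End CountingProcess.

Section MomentFunction.
Context (R : realType).
Implicit Types (alpha beta tau : R) (lambda : R -> R -> R) (g m : R -> R).

Definition intensity_family alpha beta tau lambda : Prop :=
  forall theta, theta \in `]alpha, beta[ ->
    measurable_fun `[0, tau] (lambda theta) /\
    forall t, t \in `[0, tau] -> 0 <= lambda theta t.

Definition moment tau g lambda (theta : R) : R :=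
  \int[lebesgue_measure]_(t in `[0, tau]) (g t * lambda theta t).

Definition condL1 (k : nat) alpha beta m : Prop :=
  (forall l theta, (l < k + 2)%N -> theta \in `]alpha, beta[ ->
     derivable m^`(l)%classic theta 1) /\
  (forall l, (1 <= l <= k + 2)%N ->
     {in `]alpha, beta[, continuous m^`(l)%classic} /\
     exists M : R, forall theta, theta \in `]alpha, beta[ ->
       `|m^`(l)%classic theta| <= M).

Definition condL2 alpha beta m : Prop :=
  ({in `]alpha, beta[ &, {homo m : x y / x <= y}} \/
   {in `]alpha, beta[ &, {homo m : x y /~ x <= y}}) /\
  0 < inf [set `|m^`()%classic theta| | theta in `]alpha, beta[].

Definition condL3 alpha beta tau lambda g : Prop :=
  forall q : R, 0 < q ->
    (ereal_sup [set \int[lebesgue_measure]_(t in `[0%R, tau])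
                      (`|g t| `^ q * lambda theta t)%:E
               | theta in `]alpha, beta[] < +oo)%E.

(* [m] extended to the closed interval by its limits at the endpoints. *)
Definition closed_ext alpha beta m (theta : R) : R :=
  if theta <= alpha then lim (m x @[x --> alpha^'+])
  else if beta <= theta then lim (m x @[x --> beta^'-])
  else m theta.

Definition is_inverse_on alpha beta m (G : R -> R) : Prop :=
  forall theta, theta \in `[alpha, beta] ->
    G (closed_ext alpha beta m theta) = theta.

(* [th] is the method of moments estimate when the empirical moment is [mbar]. *)
Definition is_mme alpha beta m (mbar th : R) : Prop :=
  th \in `[alpha, beta] /\
  forall theta, theta \in `[alpha, beta] ->
    (closed_ext alpha beta m th - mbar) ^+ 2 <=
    (closed_ext alpha beta m theta - mbar) ^+ 2.

Definition psi m (G : R -> R) (theta0 : R) (l : nat) : R :=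
  G^`(l)%classic (m theta0) / l`!%:R.

Definition g_moment tau lambda g (theta0 : R) (q : nat) : R :=
  \int[lebesgue_measure]_(t in `[0, tau]) (g t ^+ q * lambda theta0 t).

Definition gauss_pdf (y : R) : R := normal_pdf 0 1 y.
Definition gauss_cdf (y : R) : R :=
  \int[lebesgue_measure]_(x in `]-oo, y]) gauss_pdf x.

End MomentFunction.

(* Main.v *)
Require Import Defs.
From HB Require Import structures.
From mathcomp Require Import all_boot all_order all_algebra.
From mathcomp Require Import all_classical all_reals all_analysis.
From mathcomp Require Import measurable_realfun ring lra.

Set Implicit Arguments.
Unset Strict Implicit.
Unset Printing Implicit Defensive.

Import Order.TTheory GRing.Theory Num.Theory.
Import numFieldNormedType.Exports.

Local Open Scope classical_set_scope.
Local Open Scope ring_scope.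

(** The estimator is below [c] exactly when the empirical moment is below [m c]
    ([mme_lt]), because [m] is increasing: it is monotone, it has the left
    inverse [G], and [G] has a positive derivative at [m theta0]. So the
    probability in question is that of the event [Z < x], where [Z] is the
    standardized sum of the [n] stochastic integrals of [g] and
    [x = sqrt n * (m c - m theta0) / sqrt a2] with
    [c = theta0 + psi1 * sqrt a2 * y / sqrt n]. The second-order Taylor
    expansion of [m], with [psi1 = 1 / m'] and [psi2 = - m'' / (2 * m' ^ 3)],
    gives [x = y - b2 * y ^ 2 * eps + o(eps)] ([moment_threshold]). This
    displacement contributes [- b2 * y ^ 2 * gauss_pdf y * eps]; the other
    term, [a3 / (6 * a2 ^ (3 / 2)) * (1 - y ^ 2) * gauss_pdf y * eps], is the
    Edgeworth correction of the distribution function of [Z]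
    ([edgeworth_perturbation]).

    The characteristic function of a stochastic integral is, in real form,
    [expR (- A)] times the cosine and the sine of [B], where [A] and [B] are
    the integrals of [(1 - cos (v * g)) * lambda] and of
    [sin (v * g) * lambda] ([poisson_integral_cos], [poisson_integral_sin]).
    For a step function this expresses that the increments of the process are
    independent Poisson variables. The general case follows by density of step
    functions in L1 for the intensity ([grid_approximable_integrable]), since
    Campbell's formula ([campbell]) bounds the mean distance of two stochastic
    integrals by the distance of the integrands.

    The Edgeworth expansion is obtained without truncating the frequencies.
    One adds to [Z] an independent normal variable of variance [s = n ^ -4].
    The inversion formula for the distribution function of the perturbed
    variable ([smoothed_cdf]) converges absolutely thanks to the factor
    [expR (- s * u ^ 2 / 2)], and its integrand can be compared with that of the
    expansion on the whole line ([expansion_kernel_error],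
    [edgeworth_smoothed]). The comparison uses the Taylor expansion of the
    exponent, whose error is controlled by the fourth moment of [g], and the
    bound [A >= c * min (v ^ 2, 1)] ([exponent_lower_bound]). The latter is
    where the condition on [sin ^ 2] enters: it says that the modulus of
    the characteristic function stays away from 1 at large frequencies, and
    [`|sin (k * z)| <= k * `|sin z|] carries this over to small ones. The
    [n]-th power of this modulus is then at most
    [expR (- c * u ^ 2) + expR (- c * n)]; the second term is multiplied by a
    power of [n] coming from the range [`|u| <= n ^ 2] allowed by the
    smoothing, and remains negligible. Finally, the monotonicity of
    distribution functions removes the perturbation at the cost of moving [x]
    by [1 / n] ([smoothing_lower], [smoothing_upper],
    [standardized_sum_cdf_bounds]). *)

(** * Differentiation rules and Taylor bounds *)

Section deriv_rules.
Context {R : realType}.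
Implicit Types (f g : R -> R) (x a b : R).

Lemma is_derive_addf f g x a b : is_derive x 1 f a -> is_derive x 1 g b ->
  is_derive x 1 (fun t => f t + g t) (a + b).
Proof. by move=> fa gb; exact: is_deriveD. Qed.

Lemma is_derive_oppf f x a : is_derive x 1 f a ->
  is_derive x 1 (fun t => - f t) (- a).
Proof. by move=> fa; exact: is_deriveN. Qed.

Lemma is_derive_mulf f g x a b : is_derive x 1 f a -> is_derive x 1 g b ->
  is_derive x 1 (fun t => f t * g t) (a * g x + f x * b).
Proof.
move=> fa gb; have -> : (fun t => f t * g t) = f * g by [].
by apply: (is_derive_eq (is_deriveM fa gb)); rewrite /GRing.scale/=; ring.
Qed.

Lemma is_derive_expf f n x a : is_derive x 1 f a ->
  is_derive x 1 (fun t => f t ^+ n) (n%:R * f x ^+ n.-1 * a).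
Proof.
move=> fa; have -> : (fun t => f t ^+ n) = f ^+ n by apply/funext => t; rewrite fctE.
exact: (is_derive_eq (is_deriveX n fa)).
Qed.

Lemma is_derive_sinf f x a : is_derive x 1 f a ->
  is_derive x 1 (fun t => sin (f t)) (cos (f x) * a).
Proof. by move=> fa; exact: is_derive1_comp. Qed.

Lemma is_derive_cosf f x a : is_derive x 1 f a ->
  is_derive x 1 (fun t => cos (f t)) (- sin (f x) * a).
Proof. by move=> fa; exact: (@is_derive1_comp _ cos). Qed.

Lemma is_derive_expRf f x a : is_derive x 1 f a ->
  is_derive x 1 (fun t => expR (f t)) (expR (f x) * a).
Proof. by move=> fa; exact: is_derive1_comp. Qed.

Lemma is_derive_idf x : is_derive x 1 (fun t : R => t) 1.
Proof. exact: is_derive_id. Qed.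

Lemma is_derive_cstf (c x : R) : is_derive x 1 (fun _ : R => (c : R)) 0.
Proof. exact: is_derive_cst. Qed.

End deriv_rules.

(** Differentiates a function given syntactically by sums, products, powers,
    [sin], [cos] and [expR]; anything else must be settled by a hypothesis or
    be constant. *)
Ltac derive_rules :=
  lazymatch goal with
  | |- is_derive _ _ (fun t => t) _ => eapply is_derive_idf
  | |- is_derive _ _ (fun t => @?f t + @?g t) _ =>
      eapply (@is_derive_addf _ f g); derive_rules
  | |- is_derive _ _ (fun t => - @?f t) _ =>
      eapply (@is_derive_oppf _ f); derive_rules
  | |- is_derive _ _ (fun t => @?f t * @?g t) _ =>
      eapply (@is_derive_mulf _ f g); derive_rules
  | |- is_derive _ _ (fun t => @?f t ^+ ?n) _ =>
      eapply (@is_derive_expf _ f n); derive_rules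
  | |- is_derive _ _ (fun t => sin (@?f t)) _ =>
      eapply (@is_derive_sinf _ f); derive_rules
  | |- is_derive _ _ (fun t => cos (@?f t)) _ =>
      eapply (@is_derive_cosf _ f); derive_rules
  | |- is_derive _ _ (fun t => expR (@?f t)) _ =>
      eapply (@is_derive_expRf _ f); derive_rules
  | |- _ =>
      first [eassumption
            | match goal with H : forall _, is_derive _ _ _ _ |- _ => eapply H end
            | eapply is_derive_cstf]
  end.
Lemma is_derive_congr {R : realType} (f : R -> R) (x a b : R) :
  is_derive x 1 f a -> a = b -> is_derive x 1 f b.
Proof. by move=> + <-. Qed.

(** Leaves the comparison of the computed derivative with the expected one. *)
Ltac derive_by := eapply is_derive_congr; [derive_rules | ].

Lemma continuous_of_is_derive {R : realType} (f : R -> R) (x a : R) :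
  is_derive x 1 f a -> {for x, continuous f}.
Proof. by move=> fa; apply/differentiable_continuous/derivable1_diffP; case: fa. Qed.

(** Raises the order of a bound at the origin by one. Iterated from [`|sin z|
    <= 1] and [`|cos z| <= 1], it yields all the Taylor bounds below,
    uniformly on the line and with constant 1. *)
Lemma MVT_bound {R : realType} (F f : R -> R) (C : R) (k : nat) :
  F 0 = 0 -> (forall z : R, is_derive z 1 F (f z)) ->
  (forall z, `|f z| <= C * `|z| ^+ k) ->
  forall z, `|F z| <= C * `|z| ^+ k.+1.
Proof.
move=> F0 dF fC z.
have C0 : 0 <= C by have := fC 1; rewrite normr1 expr1n mulr1; apply: le_trans.
have cF (A : set R) : {within A, continuous F}.
  by apply/continuous_subspaceT => x; exact: continuous_of_is_derive (dF x).
have key c : `|c| <= `|z| -> `|f c * z| <= C * `|z| ^+ k.+1.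
  move=> cz; rewrite normrM exprSr mulrA ler_wpM2r//.
  by rewrite (le_trans (fC c))// ler_wpM2l// lerXn2r// nnegrE.
have [z0|z0|->] := ltgtP z 0; last by rewrite F0 normr0 exprS mul0r mulr0.
  have [c /[!in_itv]/= /andP[zc c0]] := MVT z0 (fun x _ => dF x) (cF _).
  rewrite F0 !sub0r mulrN => /eqP; rewrite eqr_opp => /eqP ->.
  by rewrite key// !ltr0_norm// lerN2 ltW.
have [c /[!in_itv]/= /andP[zc c0]] := MVT z0 (fun x _ => dF x) (cF _).
rewrite F0 !subr0 => ->.
by rewrite key// !gtr0_norm// ltW.
Qed.

Section trig_bounds.
Context {R : realType}.
Implicit Types z : R.

Lemma sin_norm_le z : `|sin z| <= `|z|.
Proof.
have := @MVT_bound R sin cos 1 0 (sin0 _) (fun z => is_derive_sin z).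
rewrite -[`|z|]mul1r -[X in 1 * X]expr1; apply => {}z.
by rewrite expr0 mulr1 ler_norml cos_geN1 cos_le1.
Qed.

Lemma cos_sub1_le1 z : `|1 - cos z| <= `|z|.
Proof.
have := @MVT_bound R (fun z => 1 - cos z) sin 1 0.
rewrite -[`|z|]mul1r -[X in 1 * X]expr1; apply => [|{}z|{}z].
- by rewrite cos0 subrr.
- by derive_by; rewrite add0r mulr1 opprK.
- by rewrite expr0 mulr1 ler_norml sin_geN1 sin_le1.
Qed.

Lemma cos_sub1_le2 z : `|1 - cos z| <= `|z| ^+ 2.
Proof.
have := @MVT_bound R (fun z => 1 - cos z) sin 1 1.
rewrite -[_ ^+ _]mul1r; apply => [|{}z|{}z].
- by rewrite cos0 subrr.
- by derive_by; rewrite add0r mulr1 opprK.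
- by rewrite mul1r sin_norm_le.
Qed.

Let dsinB z : is_derive z 1 (fun z => z - sin z) (1 - cos z).
Proof. by derive_by; rewrite mulr1. Qed.

Lemma sin_subid_le2 z : `|z - sin z| <= `|z| ^+ 2.
Proof.
rewrite -[_ ^+ _]mul1r; apply: (@MVT_bound _ _ _ _ _ _ dsinB) => [|{}z].
  by rewrite sin0 subrr.
by rewrite mul1r cos_sub1_le1.
Qed.

Lemma sin_subid_le3 z : `|z - sin z| <= `|z| ^+ 3.
Proof.
rewrite -[_ ^+ _]mul1r; apply: (@MVT_bound _ _ _ _ _ _ dsinB) => [|{}z].
  by rewrite sin0 subrr.
by rewrite mul1r cos_sub1_le2.
Qed.

Let dcosB z : is_derive z 1 (fun z => cos z - 1 + z ^+ 2 / 2) (z - sin z).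
Proof. by derive_by; rewrite /=; field. Qed.

Lemma cos_taylor2_le3 z : `|cos z - 1 + z ^+ 2 / 2| <= `|z| ^+ 3.
Proof.
rewrite -[_ ^+ 3]mul1r; apply: (@MVT_bound _ _ _ _ _ _ dcosB) => [|{}z].
  by rewrite cos0 subrr expr0n/= mul0r addr0.
by rewrite mul1r sin_subid_le2.
Qed.

Lemma cos_taylor2_le4 z : `|cos z - 1 + z ^+ 2 / 2| <= `|z| ^+ 4.
Proof.
rewrite -[_ ^+ 4]mul1r; apply: (@MVT_bound _ _ _ _ _ _ dcosB) => [|{}z].
  by rewrite cos0 subrr expr0n/= mul0r addr0.
by rewrite mul1r sin_subid_le3.
Qed.

Lemma sin_taylor3_le4 z : `|sin z - z + z ^+ 3 / 6| <= `|z| ^+ 4.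
Proof.
rewrite -[_ ^+ 4]mul1r.
apply: (@MVT_bound _ (fun z => sin z - z + z ^+ 3 / 6)
  (fun z => cos z - 1 + z ^+ 2 / 2)) => [|{}z|{}z].
- by rewrite sin0 subrr expr0n/= mul0r addr0.
- by derive_by; rewrite /=; field.
- by rewrite mul1r cos_taylor2_le3.
Qed.

(** This is what makes the value of [sin] at one large frequency control its
    value at small ones; see [exponent_lower_bound]. *)
Lemma norm_sin_muln_le (k : nat) z : `|sin (k%:R * z)| <= k%:R * `|sin z|.
Proof.
elim: k => [|k IH]; first by rewrite !mul0r sin0 normr0.
rewrite -natr1 mulrDl mul1r sinD mulrDl mul1r.
rewrite (le_trans (ler_normD _ _))// lerD//.
  rewrite normrM (le_trans _ IH)// ler_piMr//.
  by rewrite ler_norml cos_geN1 cos_le1.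
rewrite normrM ler_piMl//.
by rewrite ler_norml cos_geN1 cos_le1.
Qed.

Lemma expR_sub_le (a b : R) : `|expR (- a) - expR (- b)| <=
  `|a - b| * (expR (- a) + expR (- b)).
Proof.
wlog ab : a b / a <= b => [H|].
  have [|/ltW ba] := leP a b; first exact: H.
  by rewrite distrC (distrC a) (addrC (expR (- a))); exact: H.
have eab : expR (- b) <= expR (- a) by rewrite ler_expR lerN2.
rewrite ger0_norm ?subr_ge0// distrC ger0_norm ?subr_ge0//.
apply: (@le_trans _ _ ((b - a) * expR (- a))); last first.
  by rewrite ler_wpM2l ?subr_ge0// lerDl expR_ge0.
have -> : expR (- b) = expR (- (b - a)) * expR (- a).
  by rewrite -expRD; congr expR; ring.
rewrite -{1}[expR (- a)]mul1r -mulrBl ler_wpM2r ?expR_ge0//.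
by have := expR_ge1Dx (- (b - a)); lra.
Qed.

Lemma sin_sub_taylor (x b : R) :
  `|sin (x - b) - sin x + b * cos x| <= 2 * b ^+ 2.
Proof.
have -> : sin (x - b) - sin x + b * cos x =
  sin x * - (1 - cos b) + cos x * (b - sin b) by rewrite sinB; ring.
have h1 := cos_sub1_le2 b; have h2 := sin_subid_le2 b.
have -> : 2 * b ^+ 2 = `|b| ^+ 2 + `|b| ^+ 2 by rewrite real_normK ?num_real//; ring.
rewrite (le_trans (ler_normD _ _))// lerD// normrM ?normrN.
  by rewrite (le_trans _ h1)// ler_piMl// ler_norml sin_geN1 sin_le1.
by rewrite (le_trans _ h2)// ler_piMl// ler_norml cos_geN1 cos_le1.
Qed.

End trig_bounds.

(** * Real-valued integrable functions *)

Section real_integrable.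
Context d (T : measurableType d) (R : realType).
Variables (mu : {measure set T -> \bar R}) (D : set T).
Hypothesis mD : measurable D.
Implicit Types (f g : T -> R).

Lemma le_Rintegrable f g : measurable_fun D f -> mu.-integrable D (EFin \o g) ->
  (forall x, D x -> `|f x| <= g x) -> mu.-integrable D (EFin \o f).
Proof.
move=> mf ig fg; apply: le_integrable ig => //; first exact/measurable_EFinP.
move=> x Dx; rewrite /= lee_fin (le_trans (fg x Dx))//; exact: ler_norm.
Qed.

Lemma RintegrableD f g : mu.-integrable D (EFin \o f) ->
  mu.-integrable D (EFin \o g) -> mu.-integrable D (EFin \o (fun x => f x + g x)).
Proof. by move=> fi gi; exact: (integrableD mD fi gi). Qed.

Lemma RintegrableB f g : mu.-integrable D (EFin \o f) ->
  mu.-integrable D (EFin \o g) -> mu.-integrable D (EFin \o (fun x => f x - g x)).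
Proof. by move=> fi gi; exact: (integrableB mD fi gi). Qed.

Lemma RintegrableZ (k : R) f : mu.-integrable D (EFin \o f) ->
  mu.-integrable D (EFin \o (fun x => k * f x)).
Proof. by move=> fi; exact: (integrableZl mD k fi). Qed.

Lemma RintegrableNorm f : mu.-integrable D (EFin \o f) ->
  mu.-integrable D (EFin \o (fun x => `|f x|)).
Proof. by move=> fi; exact: integrable_norm. Qed.

Lemma Rintegrable_measurable f : mu.-integrable D (EFin \o f) -> measurable_fun D f.
Proof. by move=> /(measurable_int _)/measurable_EFinP. Qed.

Lemma norm_Rintegral_le f g : mu.-integrable D (EFin \o f) ->
  mu.-integrable D (EFin \o g) -> (forall x, D x -> `|f x| <= g x) ->
  `|\int[mu]_(x in D) f x| <= \int[mu]_(x in D) g x.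
Proof.
move=> fi gi fg; apply: (le_trans (le_normr_Rintegral mD fi)).
by apply: le_Rintegral => //; exact: RintegrableNorm.
Qed.

End real_integrable.

Lemma Rintegral_sum_ord d (T : measurableType d) (R : realType)
    (mu : {measure set T -> \bar R}) (D : set T) n (f : 'I_n -> T -> R) :
  measurable D -> (forall i, mu.-integrable D (EFin \o f i)) ->
  mu.-integrable D (EFin \o (fun w => \sum_(i < n) f i w)) /\
  \int[mu]_(w in D) (\sum_(i < n) f i w) = \sum_(i < n) \int[mu]_(w in D) f i w.
Proof.
move=> mD; elim: n f => [|n IHn] f fi.
  under [X in EFin \o X]eq_fun do rewrite big_ord0.
  rewrite big_ord0; under eq_Rintegral do rewrite big_ord0.
  by split; [exact: integrable0 | rewrite /Rintegral integral0].
have [h1 h2] := IHn (fun i => f (widen_ord (leqnSn n) i)) (fun i => fi _).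
under [X in EFin \o X]eq_fun do rewrite big_ord_recr /=.
rewrite big_ord_recr /=; under eq_Rintegral do rewrite big_ord_recr /=.
by split; [exact: RintegrableD | rewrite (RintegralD mD h1 (fi _)) h2].
Qed.

(** * Gaussian weights and their Fourier integrals *)

Section gauss_weight.
Context {R : realType}.
Local Notation mu := (@lebesgue_measure R).
Implicit Types s t u x : R.

(** The characteristic function at [u] of the centred normal law of variance
    [s]. *)
Definition gauss_weight s u : R := expR (- (s * u ^+ 2 / 2)).

Lemma gauss_weight_ge0 s u : 0 <= gauss_weight s u.
Proof. exact: expR_ge0. Qed.

Lemma gauss_weight_le1 s u : 0 <= s -> gauss_weight s u <= 1.
Proof.
move=> s0; rewrite -expR0 ler_expR oppr_le0.
by rewrite divr_ge0// mulr_ge0// sqr_ge0.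
Qed.

Lemma is_derive_gauss_weight s u :
  is_derive u 1 (gauss_weight s) (- (s * u * gauss_weight s u)).
Proof. by rewrite /gauss_weight; derive_by => /=; field. Qed.

Lemma measurable_gauss_weight s : measurable_fun setT (gauss_weight s).
Proof.
apply: continuous_measurable_fun => u.
exact: continuous_of_is_derive (is_derive_gauss_weight s u).
Qed.

Lemma gauss_weightE s u : 0 < s ->
  gauss_weight s u = Num.sqrt (2 * pi / s) * normal_pdf 0 (Num.sqrt s)^-1 u.
Proof.
move=> s0; have ss : Num.sqrt s ^+ 2 = s by rewrite sqr_sqrtr// ltW.
rewrite normal_pdfE ?invr_neq0 ?gt_eqF ?sqrtr_gt0// /normal_peak.
rewrite /normal_fun exprVn ss mulrA.
have -> : s^-1 * pi *+ 2 = 2 * pi / s :> R by ring.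
rewrite divff ?mul1r; last first.
  by rewrite gt_eqF// sqrtr_gt0 divr_gt0// mulr_gt0// pi_gt0.
by rewrite /gauss_weight; congr expR; field; rewrite gt_eqF.
Qed.

Lemma integrable_gauss_weight s : 0 < s ->
  mu.-integrable setT (EFin \o gauss_weight s).
Proof.
move=> s0; rewrite (_ : gauss_weight s = fun u => Num.sqrt (2 * pi / s) *
    normal_pdf 0 (Num.sqrt s)^-1 u); last first.
  by apply/funext => u; rewrite gauss_weightE.
by apply: RintegrableZ => //; exact: integrable_normal_pdf.
Qed.

Lemma integral_gauss_weight s : 0 < s ->
  \int[mu]_u gauss_weight s u = Num.sqrt (2 * pi / s).
Proof.
move=> s0; under eq_Rintegral do rewrite gauss_weightE//.
rewrite RintegralZl//; last exact: integrable_normal_pdf.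
by rewrite /Rintegral integral_normal_pdf mulr1.
Qed.

(** Half of the exponent absorbs [u ^ 6], by the cubic term of the exponential
    series. The degree 6 is that of the square of the cubic Edgeworth term. *)
Lemma pow6_gauss_weight_le s u : 0 < s ->
  u ^+ 6 * gauss_weight s u <= 6 * (4 / s) ^+ 3 * gauss_weight (s / 2) u.
Proof.
move=> s0; have h : 0 <= s * u ^+ 2 / 4 by rewrite divr_ge0// mulr_ge0 ?sqr_ge0// ltW.
have := expR_ge1Dxn 2 h => /(le_trans _) e.
have {e} : (s * u ^+ 2 / 4) ^+ 3 / 6 <= expR (s * u ^+ 2 / 4).
  by apply: e; rewrite /= lerDr ler01.
rewrite -(ler_pM2r (expR_gt0 (- (s * u ^+ 2 / 2)))) -expRD.
have -> : s * u ^+ 2 / 4 - s * u ^+ 2 / 2 = - (s / 2 * u ^+ 2 / 2) by field.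
rewrite -/(gauss_weight s u) -/(gauss_weight (s / 2) u) => e.
have k0 : 0 <= 6 * (4 / s) ^+ 3 :> R by rewrite mulr_ge0// exprn_ge0// divr_ge0// ltW.
apply: le_trans (ler_wpM2l k0 e); rewrite le_eqVlt; apply/orP; left; apply/eqP.
by field; rewrite gt_eqF.
Qed.

Lemma norm_exp_le6 k u : (k <= 6)%N -> `|u| ^+ k <= 1 + u ^+ 6.
Proof.
move=> k6; have u6 : u ^+ 6 = `|u| ^+ 6.
  by rewrite -normrX ger0_norm// exprn_even_ge0.
rewrite u6; have [u1|/ltW u1] := leP `|u| 1.
  by rewrite (le_trans (exprn_ile1 _ _ _))// lerDl exprn_ge0.
by rewrite (le_trans (ler_weXn2l u1 k6))// lerDr.
Qed.

Lemma integrable_pow6_gauss_weight s : 0 < s ->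
  mu.-integrable setT (EFin \o (fun u => (1 + u ^+ 6) * gauss_weight s u)).
Proof.
move=> s0; apply: (@le_Rintegrable _ _ _ mu _ _ _ (fun u =>
    gauss_weight s u + 6 * (4 / s) ^+ 3 * gauss_weight (s / 2) u)) => //.
- apply: measurable_funM; last exact: measurable_gauss_weight.
  by apply: measurable_funD => //; exact: measurable_funX.
- apply: RintegrableD => //; first exact: integrable_gauss_weight.
  by apply: RintegrableZ => //; apply: integrable_gauss_weight; rewrite divr_gt0.
- move=> u _; have u6 : 0 <= u ^+ 6 by rewrite exprn_even_ge0.
  rewrite ger0_norm ?mulr_ge0 ?gauss_weight_ge0 ?addr_ge0//.
  by rewrite mulrDl mul1r lerD// pow6_gauss_weight_le.
Qed.

(** The explicit dependence on [s] matters: [s] will be [n ^ -4], and the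
    bound must grow only polynomially in [n]. *)
Lemma integral_pow6_gauss_weight_le s : 0 < s ->
  \int[mu]_u ((1 + u ^+ 6) * gauss_weight s u) <=
  (1 + 6 * (4 / s) ^+ 3) * Num.sqrt (4 * pi / s).
Proof.
move=> s0; have s20 : 0 < s / 2 by rewrite divr_gt0.
have iZ : mu.-integrable setT (EFin \o
    (fun u => 6 * (4 / s) ^+ 3 * gauss_weight (s / 2) u)).
  by apply: RintegrableZ => //; exact: integrable_gauss_weight.
apply: (@le_trans _ _ (\int[mu]_u
    (gauss_weight s u + 6 * (4 / s) ^+ 3 * gauss_weight (s / 2) u))).
  apply: le_Rintegral => //.
  - exact: integrable_pow6_gauss_weight.
  - by apply: RintegrableD => //; exact: integrable_gauss_weight.
  - by move=> u _; rewrite mulrDl mul1r lerD// pow6_gauss_weight_le.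
rewrite RintegralD//; last exact: integrable_gauss_weight.
rewrite RintegralZl//; last exact: integrable_gauss_weight.
rewrite !integral_gauss_weight// [leRHS]mulrDl mul1r.
have -> : 2 * pi / (s / 2) = 4 * pi / s by field; rewrite gt_eqF.
rewrite lerD2r ler_sqrt; last by rewrite divr_ge0 ?mulr_ge0 ?pi_ge0// ltW.
by rewrite ler_pM2r ?invr_gt0// ler_pM2r ?pi_gt0// ler_nat.
Qed.

Lemma integrable_le_pow6 s C (f : R -> R) : 0 < s -> measurable_fun setT f ->
  (forall u, `|f u| <= C * (1 + u ^+ 6) * gauss_weight s u) ->
  mu.-integrable setT (EFin \o f).
Proof.
move=> s0 mf fC; apply: (@le_Rintegrable _ _ _ mu _ _ _ (fun u =>
    C * ((1 + u ^+ 6) * gauss_weight s u))) => //; last first.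
  by move=> u _; rewrite mulrA.
by apply: RintegrableZ => //; exact: integrable_pow6_gauss_weight.
Qed.

Lemma is_derive_Rintegral (f f' : R -> R -> R) (H : R -> R) t :
  (forall x, mu.-integrable setT (EFin \o f x)) ->
  (forall x u, is_derive x 1 (f^~ u) (f' x u)) ->
  mu.-integrable setT (EFin \o H) -> (forall x u, `|f' x u| <= H u) ->
  is_derive t 1 (fun x => \int[mu]_u f x u) (\int[mu]_u f' t u).
Proof.
move=> fi df Hi fH.
have tI : `]t - 1, t + 1[%classic t by rewrite /= in_itv/= ltrBlDr ltrDl ltr01.
have H0 u : 0 <= H u by rewrite (le_trans _ (fH 0 u)).
have dE x u : partial1of2 f x u = f' x u.
  by rewrite partial1of2E; exact: derive_val.
have dfx x u : `]t - 1, t + 1[%classic x -> setT u -> derivable (f ^~ u) x 1.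
  by move=> _ _; case: (df x u).
have fH' x u : `]t - 1, t + 1[%classic x -> setT u -> `|partial1of2 f x u| <= H u.
  by rewrite dE.
have -> : \int[mu]_u f' t u = (fun x => \int[mu]_u f x u)^`()%classic t.
  rewrite (@differentiation_under_integral R _ (measurableTypeR R) mu f setT
    measurableT t _ _ tI _ dfx H H0 Hi fH')//.
  by apply: eq_Rintegral => u _; rewrite dE.
rewrite derive1E; apply: DeriveDef => //.
exact: (@derivable_under_integral R _ (measurableTypeR R) mu f setT
  measurableT t _ _ tI _ dfx H H0 Hi fH').
Qed.

End gauss_weight.

Section gauss_fourier.
Context {R : realType}.
Local Notation mu := (@lebesgue_measure R).
Implicit Types s t u x : R.

Lemma Rintegral_derive_vanish (F f : R -> R) :
  (forall u, is_derive u 1 F (f u)) -> continuous f ->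
  mu.-integrable setT (EFin \o f) ->
  F n%:R @[n --> \oo] --> (0 : R) -> F (- n%:R) @[n --> \oo] --> (0 : R) ->
  \int[mu]_u f u = 0.
Proof.
move=> dF cf fi Fp Fn.
have mf : measurable_fun setT f by exact: Rintegrable_measurable fi.
pose In (n : nat) : set R := `[- n%:R, n%:R]%classic.
have h1 : (\int[mu]_(x in In n) (f x)%:E)%E @[n --> \oo] --> (\int[mu]_x (f x)%:E)%E.
  rewrite (_ : (fun n => _) =
      fun n => (\int[mu]_x ((EFin \o f) \_ (In n)) x)%E); last first.
    by apply/funext => n; rewrite [LHS]integral_mkcond.
  apply: (@dominated_cvg _ (measurableTypeR R) R mu setT measurableT _ _
      (abse \o (EFin \o f))) => //.
  - move=> n; apply/(measurable_restrictT _ _).1; first exact: measurable_itv.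
    by apply/measurable_EFinP; exact: measurable_funS mf.
  - move=> x _; apply: cvg_near_cst.
    exists (Num.bound `|x|) => // n /= nx; rewrite patchE ifT// inE /In/= in_itv/=.
    have xn : `|x| <= n%:R.
      by rewrite (le_trans (ltW (archi_boundP (normr_ge0 x))))// ler_nat.
    by rewrite -ler_norml.
  - exact: integrable_abse.
  - move=> n x _; rewrite patchE; case: ifP => //= _.
    by rewrite normr0 lee_fin.
have h2 : (\int[mu]_(x in In n) (f x)%:E)%E @[n --> \oo] --> (0%E : \bar R).
  have : (F n%:R - F (- n%:R))%:E @[n --> \oo] --> (0%E : \bar R).
    apply: cvg_EFin; first exact: nearW.
    by rewrite -[X in _ --> X](subr0 (0:R)); exact: cvgB.
  apply: cvg_trans; apply: near_eq_cvg; exists 1%N => // n /= n0.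
  rewrite /In (@continuous_FTC2 R f F) ?EFinB//.
  - by rewrite gtrN// ltr0n.
  - exact: continuous_subspaceT.
  - split.
    + by move=> x _; case: (dF x).
    + by apply: cvg_at_right_filter; exact: continuous_of_is_derive (dF _).
    + by apply: cvg_at_left_filter; exact: continuous_of_is_derive (dF _).
  - by move=> x _; rewrite derive1E; exact: derive_val.
rewrite /Rintegral.
have -> : (\int[mu]_x (f x)%:E)%E = 0%E by apply: cvg_unique h1 h2.
by [].
Qed.

Lemma is_derive_Rintegral_sin (h H : R -> R) t :
  (forall t, mu.-integrable setT (EFin \o (fun u => h u * sin (u * t)))) ->
  mu.-integrable setT (EFin \o H) -> (forall u, `|u * h u| <= H u) ->
  is_derive t 1 (fun t => \int[mu]_u (h u * sin (u * t)))
    (\int[mu]_u (u * h u * cos (u * t))).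
Proof.
move=> fi Hi hH.
apply: (@is_derive_Rintegral R (fun t u => h u * sin (u * t))
  (fun t u => u * h u * cos (u * t)) H) => //.
  by move=> x u; derive_by; ring.
move=> x u; rewrite (le_trans _ (hH u))// normrM ler_piMr//.
by rewrite ler_norml cos_geN1 cos_le1.
Qed.

Lemma is_derive_Rintegral_cos (h H : R -> R) t :
  (forall t, mu.-integrable setT (EFin \o (fun u => h u * cos (u * t)))) ->
  mu.-integrable setT (EFin \o H) -> (forall u, `|u * h u| <= H u) ->
  is_derive t 1 (fun t => \int[mu]_u (h u * cos (u * t)))
    (\int[mu]_u (- (u * h u * sin (u * t)))).
Proof.
move=> fi Hi hH.
apply: (@is_derive_Rintegral R (fun t u => h u * cos (u * t))
  (fun t u => - (u * h u * sin (u * t))) H) => //.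
  by move=> x u; derive_by; ring.
move=> x u; rewrite (le_trans _ (hH u))// normrN normrM ler_piMr//.
by rewrite ler_norml sin_geN1 sin_le1.
Qed.

Lemma measurable_sinM t : measurable_fun setT (fun u : R => sin (u * t)).
Proof.
apply: continuous_measurable_fun => u.
by apply: continuous_of_is_derive; derive_rules.
Qed.

Lemma measurable_cosM t : measurable_fun setT (fun u : R => cos (u * t)).
Proof.
apply: continuous_measurable_fun => u.
by apply: continuous_of_is_derive; derive_rules.
Qed.

Lemma integrable_gauss_weight_poly s k (f : R -> R) : 0 < s -> (k <= 6)%N ->
  measurable_fun setT f -> (forall u, `|f u| <= 1) ->
  mu.-integrable setT (EFin \o (fun u => u ^+ k * gauss_weight s u * f u)).
Proof.
move=> s0 k6 mf f1; apply: (@integrable_le_pow6 R s 1) => // [|u].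
  apply: measurable_funM => //; apply: measurable_funM.
    exact: measurable_funX.
  exact: measurable_gauss_weight.
rewrite !normrM mul1r (ger0_norm (gauss_weight_ge0 _ _)) normrX.
apply: (@le_trans _ _ (`|u| ^+ k * gauss_weight s u)).
  by rewrite ler_piMr// mulr_ge0// ?exprn_ge0// gauss_weight_ge0.
by rewrite ler_wpM2r ?gauss_weight_ge0// norm_exp_le6.
Qed.

Lemma norm_sin_le1 x : `|sin x| <= 1.
Proof. by rewrite ler_norml sin_geN1 sin_le1. Qed.

Lemma norm_cos_le1 x : `|cos x| <= 1.
Proof. by rewrite ler_norml cos_geN1 cos_le1. Qed.

Let icos s k t : 0 < s -> (k <= 6)%N ->
  mu.-integrable setT (EFin \o (fun u => u ^+ k * gauss_weight s u * cos (u * t))).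
Proof.
move=> s0 k6; apply: integrable_gauss_weight_poly => // [|u].
  exact: measurable_cosM.
exact: norm_cos_le1.
Qed.

Let isin s k t : 0 < s -> (k <= 6)%N ->
  mu.-integrable setT (EFin \o (fun u => u ^+ k * gauss_weight s u * sin (u * t))).
Proof.
move=> s0 k6; apply: integrable_gauss_weight_poly => // [|u].
  exact: measurable_sinM.
exact: norm_sin_le1.
Qed.

Let ibound s k : 0 < s -> (k <= 6)%N ->
  mu.-integrable setT (EFin \o (fun u => `|u ^+ k * gauss_weight s u|)).
Proof.
move=> s0 k6; apply: RintegrableNorm => //.
have := @integrable_gauss_weight_poly s k (cst 1) s0 k6.
under [X in EFin \o X]eq_fun do rewrite mulr1.
by apply => // u; rewrite normr1.
Qed.

Lemma gauss_weight_cvg0 s : 0 < s -> gauss_weight s n%:R @[n --> \oo] --> (0 : R).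
Proof.
move=> s0.
apply: (@squeeze_cvgr _ _ _ _ (cst 0) (fun n : nat => 4 / s * harmonic n)) => //.
- near=> n; rewrite gauss_weight_ge0/=.
  have n0 : (0 < n)%N by near: n; exists 1%N.
  set z := s * n%:R ^+ 2 / 2; have ez := expR_ge1Dx z.
  have z0 : 0 < z by rewrite divr_gt0// mulr_gt0// exprn_gt0// ltr0n.
  rewrite /gauss_weight -/z expRN /harmonic/= -[leLHS]mul1r ler_pdivrMr ?expR_gt0//.
  rewrite mulrC -ler_pdivrMr ?mulr_gt0 ?divr_gt0 ?invr_gt0 ?ltr0n//.
  rewrite mul1r invfM invrK invf_div; apply: le_trans ez; apply: (@le_trans _ _ z); last by rewrite lerDr.
  have n1 : 1 <= n%:R :> R by rewrite ler1n.
  have -> : s / 4 * n.+1%:R = s * (n.+1%:R / 4) by ring.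
  by rewrite /z -mulrA ler_pM2l// -natr1; nra.
- exact: cvg_cst.
- rewrite -[X in _ --> X](mulr0 (4 / s)); apply: cvgM; first exact: cvg_cst.
  exact: cvg_harmonic.
Unshelve. all: end_near. Qed.

(** Integration by parts: the derivative of [gauss_weight s u * sin (u * t)]
    integrates to 0. *)
Lemma gauss_sin_moment s t : 0 < s ->
  \int[mu]_u (u ^+ 1 * gauss_weight s u * sin (u * t)) =
  t / s * \int[mu]_u (u ^+ 0 * gauss_weight s u * cos (u * t)).
Proof.
move=> s0; pose F u := gauss_weight s u * sin (u * t).
pose f u := t * (u ^+ 0 * gauss_weight s u * cos (u * t)) -
  s * (u ^+ 1 * gauss_weight s u * sin (u * t)).
have dgw := @is_derive_gauss_weight R s.
have dF u : is_derive u 1 F (f u).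
  by rewrite /F; derive_by; rewrite /f expr1 expr0; ring.
have i1 := @icos s 0 t s0 isT; have i2 := @isin s 1 t s0 isT.
have fi : mu.-integrable setT (EFin \o f).
  by apply: RintegrableB => //; exact: RintegrableZ.
have cf : continuous f.
  by move=> u; apply: continuous_of_is_derive; rewrite /f; derive_rules.
have gw0 := gauss_weight_cvg0 s0.
have gwN u : gauss_weight s (- u) = gauss_weight s u by rewrite /gauss_weight sqrrN.
have FC u : `|F u| <= gauss_weight s u.
  rewrite normrM ger0_norm ?gauss_weight_ge0// ler_piMr ?gauss_weight_ge0//.
  exact: norm_sin_le1.
have := Rintegral_derive_vanish dF cf fi.
have -> : \int[mu]_u f u = t * \int[mu]_u (u ^+ 0 * gauss_weight s u * cos (u * t)) -
    s * \int[mu]_u (u ^+ 1 * gauss_weight s u * sin (u * t)).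
  by rewrite /f RintegralB ?RintegralZl//; exact: RintegrableZ.
set I1 := \int[mu]_u _; set I2 := \int[mu]_u _ => h.
suff e : t * I1 - s * I2 = 0.
  have -> : t / s * I1 = (t * I1) / s by ring.
  by move/eqP: e; rewrite subr_eq0 => /eqP ->; field; rewrite gt_eqF.
apply: h.
  apply: norm_cvg0; apply: (@squeeze_cvgr _ _ _ _ (cst 0) _ _ _ _ _ gw0).
    by apply: nearW => n; rewrite normr_ge0 FC.
  exact: cvg_cst.
apply: norm_cvg0; apply: (@squeeze_cvgr _ _ _ _ (cst 0) _ _ _ _ _ gw0).
  by apply: nearW => n; rewrite normr_ge0 -(gwN n%:R) FC.
exact: cvg_cst.
Qed.

(** By [gauss_sin_moment] the transform solves [C' = - (t / s) * C], so it is
    determined by its value at 0. *)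
Lemma gauss_cos_transform s t : 0 < s ->
  \int[mu]_u (u ^+ 0 * gauss_weight s u * cos (u * t)) =
  Num.sqrt (2 * pi / s) * expR (- (t ^+ 2 / (2 * s))).
Proof.
move=> s0; pose C t := \int[mu]_u (u ^+ 0 * gauss_weight s u * cos (u * t)).
have dC x : is_derive x 1 C (- (x / s * C x)).
  have := @is_derive_Rintegral_cos _ _ x (fun t => @icos s 0 t s0 isT)
    (@ibound s 1 s0 isT) _.
  rewrite /C => /(_ _)/is_derive_congr; apply.
    by move=> u; rewrite expr1 expr0 mul1r.
  rewrite -gauss_sin_moment// -mulN1r -RintegralZl//; last exact: isin.
  by apply: eq_Rintegral => u _; rewrite expr0 expr1; ring.
(* Multiplying by the inverse of the expected solution gives a constant
   function. *)
pose D x := C x * expR (x ^+ 2 / (2 * s)).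
have dD x : is_derive x 1 D 0.
  by rewrite /D; derive_by => /=; field; rewrite gt_eqF.
have := is_derive_0_is_cst t 0 dD.
rewrite /D expr0n/= mul0r expR0 mulr1 => DE.
rewrite -/(C t).
have -> : Num.sqrt (2 * pi / s) = C 0.
  rewrite -integral_gauss_weight//; apply: eq_Rintegral => u _.
  by rewrite mulr0 cos0 mulr1 expr0 mul1r.
by rewrite -DE -mulrA -expRD subrr expR0 mulr1.
Qed.

(** Obtained by differentiating [gauss_sin_moment] in [t]; it produces the
    Hermite factor [1 - t ^ 2] of the expansion. *)
Lemma gauss_cos_moment2 t :
  \int[mu]_u (u ^+ 2 * gauss_weight 1 u * cos (u * t)) =
  (1 - t ^+ 2) * (Num.sqrt (2 * pi) * expR (- (t ^+ 2 / 2))).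
Proof.
pose C t := Num.sqrt (2 * pi) * expR (- (t ^+ 2 / 2)) : R.
have SE x : \int[mu]_u (u ^+ 1 * gauss_weight 1 u * sin (u * x)) = x * C x.
  by rewrite gauss_sin_moment// gauss_cos_transform// !divr1 mulr1.
have d1 : is_derive t 1 (fun x => x * C x) ((1 - t ^+ 2) * C t).
  by rewrite /C; derive_by => /=; field.
have d2 := @is_derive_Rintegral_sin _ _ t (fun t => @isin 1 1 t ltr01 isT)
    (@ibound 1 2 ltr01 isT) _.
move: d2; under eq_fun do rewrite SE.
move=> d2.
have [_ <-] := d1.
have [|_ ->] := d2.
  by move=> u; rewrite expr1 mulrA expr2.
by apply: eq_Rintegral => u _; rewrite expr1 mulrA expr2.
Qed.

End gauss_fourier.

(** * The normal distribution function *)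

Section gauss_cdf.
Context {R : realType}.
Local Notation mu := (@lebesgue_measure R).
Implicit Types s t u x y : R.

Lemma sqrt2pi_gt0 : 0 < Num.sqrt (2 * pi) :> R.
Proof. by rewrite sqrtr_gt0 mulr_gt0// pi_gt0. Qed.

Lemma gauss_pdfE y : gauss_pdf y = (Num.sqrt (2 * pi))^-1 * gauss_weight 1 y.
Proof.
rewrite gauss_weightE// sqrtr1 invr1 mulr1 mulrA mulVf ?mul1r//.
by rewrite gt_eqF// sqrt2pi_gt0.
Qed.

Lemma gauss_pdf_ge0 y : 0 <= gauss_pdf y.
Proof. exact: normal_pdf_ge0. Qed.

Lemma gauss_pdf_integrable (D : set R) : measurable D ->
  mu.-integrable D (EFin \o @gauss_pdf R).
Proof.
by move=> mD; apply: (integrableS measurableT) => //; exact: integrable_normal_pdf.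
Qed.

Lemma continuous_gauss_pdf : continuous (@gauss_pdf R).
Proof. by apply: continuous_normal_pdf; exact: oner_neq0. Qed.

Lemma gauss_cdf_ge0 y : 0 <= gauss_cdf y.
Proof. by apply: Rintegral_ge0 => x _; exact: gauss_pdf_ge0. Qed.

Lemma integral_gauss_pdf : \int[mu]_x gauss_pdf x = 1.
Proof. by rewrite /Rintegral integral_normal_pdf. Qed.

Lemma gauss_cdfC y : 1 - gauss_cdf y = \int[mu]_(x in `]y, +oo[) gauss_pdf x.
Proof.
rewrite -integral_gauss_pdf.
have yT : `]-oo, y] `|` `]y, +oo[ = [set: R].
  by rewrite -itv_bndbnd_setU// set_itvNyy.
rewrite -[in \int[mu]_x _]yT Rintegral_setU//=.
- by rewrite addrC addKr.
- by rewrite yT; exact: gauss_pdf_integrable.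
- rewrite disj_set2E; apply/eqP; rewrite -subset0 => x /=; rewrite !in_itv/=.
  by move=> [xy /andP[yx _]]; move: xy; rewrite leNgt yx.
Qed.

Lemma gauss_cdf_le1 y : gauss_cdf y <= 1.
Proof.
rewrite -subr_ge0 gauss_cdfC; apply: Rintegral_ge0 => x _; exact: gauss_pdf_ge0.
Qed.

Lemma gauss_cdf0 : gauss_cdf 0 = 2^-1 :> R.
Proof.
have h : 1 - gauss_cdf 0 = 2^-1 :> R.
  rewrite gauss_cdfC Rintegral_itv_obnd_cbnd; last first.
    by apply: gauss_pdf_integrable; exact: measurable_itv.
  have := @ge0_symfun_integralT R (@gauss_pdf R) gauss_pdf_ge0 continuous_gauss_pdf.
  rewrite integral_normal_pdf => e.
  have {e} : (1 = 2 * \int[mu]_(x in [set x | (0 <= x)%R]) (gauss_pdf x)%:E :> \bar R)%E.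
    by apply: e => x /=; rewrite !gauss_pdfE /gauss_weight sqrrN.
  rewrite -set_itvcy /Rintegral; case: (integral _ _ _) => [r| |].
  - by rewrite -EFinM => -[e] /=; lra.
  - by rewrite gt0_muley.
  - by rewrite gt0_muleNy.
by have -> : gauss_cdf 0 = 1 - (1 - gauss_cdf 0) :> R; [ring | rewrite h; field].
Qed.

Lemma is_derive_gauss_cdf y : is_derive y 1 (@gauss_cdf R) (gauss_pdf y).
Proof.
have y1 : y < y + 1 by rewrite ltrDl.
have iy : mu.-integrable `]-oo, (y + 1)%R] (EFin \o @gauss_pdf R).
  by apply: gauss_pdf_integrable; exact: measurable_itv.
have [] := @continuous_FTC1 R (@gauss_pdf R) -oo%O y (y + 1) y1 iy _
  (@continuous_gauss_pdf y); first exact: ltNye.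
move=> h1; rewrite derive1E => h2.
exact: (DeriveDef h1 h2).
Qed.

Lemma le_gauss_cdf x y : x <= y -> gauss_cdf x <= gauss_cdf y.
Proof.
rewrite le_eqVlt => /predU1P[->//|xy].
have dc := is_derive_gauss_cdf.
have [|c _ e] := MVT xy (fun z _ => dc z).
  by apply: continuous_subspaceT => z; exact: continuous_of_is_derive (dc z).
by rewrite -subr_ge0 e mulr_ge0 ?gauss_pdf_ge0// subr_ge0 ltW.
Qed.

Lemma gauss_cdfN y : gauss_cdf (- y) = 1 - gauss_cdf y.
Proof.
pose h y := gauss_cdf y + gauss_cdf (- y) : R.
have dc := is_derive_gauss_cdf.
have dh x : is_derive x 1 h 0.
  rewrite /h; eapply is_derive_congr.
    eapply (@is_derive_addf _ (@gauss_cdf R)); first exact: dc.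
    eapply (@is_derive1_comp _ (@gauss_cdf R) (fun z => - z)); first exact: dc.
    by derive_rules.
  by rewrite !gauss_pdfE /gauss_weight sqrrN; ring.
have := is_derive_0_is_cst y 0 dh; rewrite /h oppr0 gauss_cdf0 => e.
have -> : gauss_cdf (- y) = (gauss_cdf y + gauss_cdf (- y)) - gauss_cdf y by ring.
by rewrite e; field.
Qed.

(** On the tail [A <= `|u|], so that [A * gauss_pdf u] is dominated by [(1 + u
    ^ 6) * gauss_weight 1 u]; a rate [1 / A] is all that is needed. *)
Lemma gauss_cdf_tail : exists2 C : R, 0 < C &
  forall A, 0 < A -> gauss_cdf (- A) <= C / A.
Proof.
pose C : R := \int[mu]_u ((1 + u ^+ 6) * gauss_weight 1 u).
have iC := @integrable_pow6_gauss_weight R 1 ltr01.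
exists (1 + `|C|) => [|A A0]; first by rewrite ltr_wpDr.
have mA : measurable (`]-oo, - A] : set (measurableTypeR R)) by exact: measurable_itv.
rewrite ler_pdivlMr// mulrC /gauss_cdf -RintegralZl//; last first.
  exact: gauss_pdf_integrable.
apply: (@le_trans _ _ C); last by rewrite (le_trans (ler_norm _))// lerDr.
rewrite Rintegral_mkcond; apply: le_Rintegral => //.
  rewrite -restrict_EFin; apply: (integrable_mkcond _ mA).1.
  by apply: RintegrableZ => //; exact: gauss_pdf_integrable.
move=> u _; rewrite patchE; case: ifPn => [|_]; last first.
  by rewrite mulr_ge0 ?gauss_weight_ge0// addr_ge0// exprn_even_ge0.
rewrite inE /= in_itv/= => uA; rewrite gauss_pdfE.
rewrite ler_pM ?mulr_ge0 ?invr_ge0 ?gauss_weight_ge0 ?sqrtr_ge0// ?(ltW A0)//.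
  rewrite (le_trans _ (@norm_exp_le6 R 1 u _))// expr1 ltr0_norm; lra.
rewrite ler_piMl ?gauss_weight_ge0// invf_le1 ?sqrt2pi_gt0//.
rewrite -[leLHS]sqrtr1 ler_sqrt ?mulr_ge0 ?pi_ge0//.
by have := pi_ge2 R; lra.
Qed.

Lemma measurable_gauss_cdf : measurable_fun setT (@gauss_cdf R).
Proof.
apply: continuous_measurable_fun => y.
exact: continuous_of_is_derive (is_derive_gauss_cdf y).
Qed.

(** The inverse is discontinuous at 0, where its value is 0; it is the limit
    of the continuous functions [u / (u ^ 2 + e)]. *)
Lemma measurable_invr : measurable_fun setT (@GRing.inv R).
Proof.
have mV (e : R) : 0 < e -> measurable_fun setT (fun u : R => u * (u ^+ 2 + e)^-1).
  move=> e0; apply: continuous_measurable_fun => u.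
  apply: cvgM; first exact: cvg_id.
  apply: cvgV; first by rewrite gt_eqF// ltr_wpDl ?sqr_ge0.
  exact: (@continuous_of_is_derive _ (fun u => u ^+ 2 + e)).
apply: (@measurable_fun_cvg _ _ _ _ (fun n u => u * (u ^+ 2 + harmonic n)^-1)) => [n|u _].
  by apply: mV; exact: harmonic_gt0.
have [->|u0] := eqVneq u 0.
  by under eq_fun do rewrite mul0r; rewrite invr0; exact: cvg_cst.
have -> : u^-1 = u * (u ^+ 2 + 0)^-1 by rewrite addr0; field.
apply: cvgM; first exact: cvg_cst.
apply: cvgV; first by rewrite addr0 expf_neq0.
by apply: cvgD; [exact: cvg_cst | exact: cvg_harmonic].
Qed.

Lemma integrable_gauss_sinc s t : 0 < s ->
  mu.-integrable setT (EFin \o (fun u => u^-1 * gauss_weight s u * sin (u * t))).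
Proof.
move=> s0; have igw := @integrable_gauss_weight R s s0.
apply: (@le_Rintegrable _ (measurableTypeR R) _ mu _ _ _
  (fun u => `|t| * gauss_weight s u)) => //.
- apply: measurable_funM; last exact: measurable_sinM.
  apply: measurable_funM; last exact: measurable_gauss_weight.
  exact: measurable_invr.
- exact: RintegrableZ.
- move=> u _; rewrite !normrM (ger0_norm (gauss_weight_ge0 _ _)) mulrAC.
  rewrite ler_wpM2r ?gauss_weight_ge0//.
  have [->|u0] := eqVneq u 0; first by rewrite invr0 normr0 mul0r.
  rewrite normfV ler_pdivrMl ?normr_gt0// -normrM; exact: sin_norm_le.
Qed.

(** Gil-Pelaez inversion for the normal law: both sides vanish at [t = 0], and
    their derivatives in [t] agree by [gauss_cos_transform]. *)
Lemma Rintegral_gauss_sinc s t : 0 < s ->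
  \int[mu]_u (u^-1 * gauss_weight s u * sin (u * t)) =
  2 * pi * (gauss_cdf (t / Num.sqrt s) - 2^-1).
Proof.
move=> s0; pose D t := \int[mu]_u (u^-1 * gauss_weight s u * sin (u * t)).
have igw := @integrable_gauss_weight R s s0.
have iD x := integrable_gauss_sinc x s0.
have dD x : is_derive x 1 D (Num.sqrt (2 * pi / s) * expR (- (x ^+ 2 / (2 * s)))).
  have := @is_derive_Rintegral_sin R _ _ x iD igw _.
  move=> /(_ _)/is_derive_congr; apply.
    move=> u; have [->|u0] := eqVneq u 0.
      by rewrite mul0r normr0 gauss_weight_ge0.
    by rewrite mulrA mulfV// mul1r ger0_norm// gauss_weight_ge0.
  rewrite -gauss_cos_transform// /Rintegral; congr fine.
  have mc := @measurable_cosM R x; have mg := @measurable_gauss_weight R s.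
  apply: ae_eq_integral => //.
  - apply/measurable_EFinP; apply: measurable_funM => //.
    by apply: measurable_funM => //; apply: measurable_funM => //; exact: measurable_invr.
  - by apply/measurable_EFinP; apply: measurable_funM => //; apply: measurable_funM.
  exists [set 0 : R]; split => //; first exact: lebesgue_measure_set1.
  move=> u /= h; apply: contrapT => /eqP u0; apply: h => _.
  by rewrite mulrA mulfV.
pose E t := D t - 2 * pi * gauss_cdf (t / Num.sqrt s).
have dE x : is_derive x 1 E 0.
  rewrite /E; eapply is_derive_congr.
    eapply is_derive_addf; first exact: dD.
    eapply is_derive_oppf; eapply is_derive_mulf; first exact: is_derive_cstf.
    eapply (@is_derive1_comp _ (@gauss_cdf R) (fun z => z / Num.sqrt s)).
      exact: is_derive_gauss_cdf.
    by derive_rules.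
  rewrite gauss_pdfE /gauss_weight /=.
  have q0 : Num.sqrt s != 0 by rewrite gt_eqF// sqrtr_gt0.
  have qE : Num.sqrt s ^+ 2 = s by rewrite sqr_sqrtr// ltW.
  have pE : 2 * pi = Num.sqrt (2 * pi) ^+ 2 :> R.
    by rewrite sqr_sqrtr// mulr_ge0// pi_ge0.
  have p0 : Num.sqrt (2 * pi) != 0 :> R by rewrite gt_eqF// sqrt2pi_gt0.
  rewrite sqrtrM ?mulr_ge0 ?pi_ge0// sqrtrV ?(ltW s0)//.
  move: pE p0; set p := Num.sqrt (2 * pi) => pE p0; rewrite pE.
  have -> : 1 * (x / Num.sqrt s) ^+ 2 / 2 = x ^+ 2 / (2 * s).
    by rewrite expr_div_n qE mul1r; field; rewrite gt_eqF.
  by move: (expR _) (Num.sqrt s) q0 p p0 {pE} => r q q0 p p0; field; rewrite q0.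
have := is_derive_0_is_cst t 0 dE; rewrite /E mul0r gauss_cdf0.
have -> : D 0 = 0.
  rewrite /D; under eq_Rintegral do rewrite mulr0 sin0 mulr0.
  by rewrite Rintegral_cst// mul0r.
rewrite -/(D t) => e.
have -> : D t = D t - 2 * pi * gauss_cdf (t / Num.sqrt s) +
  2 * pi * gauss_cdf (t / Num.sqrt s) by ring.
by rewrite e; ring.
Qed.

End gauss_cdf.

(** * Inversion formula for smoothed distribution functions *)

Section Rfubini.
Context d1 d2 (T1 : measurableType d1) (T2 : measurableType d2) (R : realType).
Variable m1 : {sigma_finite_measure set T1 -> \bar R}.
Variable m2 : {sigma_finite_measure set T2 -> \bar R}.
Variable f : T1 -> T2 -> R.
Hypothesis fi : (m1 \x m2)%E.-integrable setT (fun z => (f z.1 z.2)%:E).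
Hypothesis fi1 : forall x, m2.-integrable setT (EFin \o f x).
Hypothesis fi2 : forall y, m1.-integrable setT (EFin \o f ^~ y).

Let FE x : fubini_F m2 (fun z => (f z.1 z.2)%:E) x = (\int[m2]_y f x y)%:E.
Proof. by rewrite /fubini_F /= /Rintegral fineK//; exact: integrable_fin_num (fi1 x). Qed.

Let GE y : fubini_G m1 (fun z => (f z.1 z.2)%:E) y = (\int[m1]_x f x y)%:E.
Proof. by rewrite /fubini_G /= /Rintegral fineK//; exact: integrable_fin_num (fi2 y). Qed.

Lemma Rintegrable_fubini :
  m2.-integrable setT (EFin \o (fun y => \int[m1]_x f x y)).
Proof.
have mf := measurable_int _ fi.
have mG := measurable_fubini_G fi.
apply/integrableP; split; first by apply: eq_measurable_fun mG => y _; rewrite GE.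
apply: le_lt_trans ((integrable21ltyP m1 m2 mf).1 fi).
apply: ge0_le_integral => //.
- apply: measurableT_comp => //.
  by apply: eq_measurable_fun mG => y _; rewrite GE.
- apply: (measurable_fun_fubini_tonelli_G (abse \o (fun z => (f z.1 z.2)%:E))) => //.
    exact: measurableT_comp.
  by move=> z; exact: abse_ge0.
- move=> y _.
  rewrite (_ : (EFin \o _) y = fubini_G m1 (fun z => (f z.1 z.2)%:E) y); last by rewrite GE.
  apply: le_abse_integral => //.
  exact: measurable_int (fi2 y).
Qed.

Lemma Rintegral_fubini :
  \int[m1]_x \int[m2]_y f x y = \int[m2]_y \int[m1]_x f x y.
Proof.
have := Fubini fi.
under eq_integral do rewrite -/(fubini_F m2 (fun z => (f z.1 z.2)%:E) _) FE.
under [in X in _ = X -> _]eq_integral do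
  rewrite -/(fubini_G m1 (fun z => (f z.1 z.2)%:E) _) GE.
by rewrite /Rintegral => ->.
Qed.

End Rfubini.

(** One term of the exponential series. *)
Lemma pow_exp_bounded (R : realType) (k : nat) (c : R) : 0 < c ->
  exists M : R, forall x, 0 <= x -> x ^+ k.+1 * expR (- (c * x)) <= M.
Proof.
move=> c0; exists (k.+1`!%:R / c ^+ k.+1) => x x0.
have cx0 : 0 <= c * x by rewrite mulr_ge0// ltW.
have e : (c * x) ^+ k.+1 / k.+1`!%:R <= expR (c * x).
  by rewrite (le_trans _ (expR_ge1Dxn k cx0))// lerDr.
have f0 : 0 < k.+1`!%:R :> R by rewrite ltr0n fact_gt0.
rewrite expRN ler_pdivrMr ?expR_gt0// mulrAC ler_pdivlMr ?exprn_gt0//.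
by rewrite mulrC -exprMn [leRHS]mulrC -ler_pdivrMr.
Qed.

Lemma measurable_sinR (R : realType) : measurable_fun setT (@sin R).
Proof. by apply: continuous_measurable_fun => x; exact: continuous_sin. Qed.

Section smoothing.
Context d (Omega : measurableType d) (R : realType) (P : probability Omega R).
Local Notation mu := (@lebesgue_measure R).
Variable S : Omega -> R.
Hypothesis mS : measurable_fun setT S.

Lemma probability_Rintegrable (f : Omega -> R) (C : R) :
  measurable_fun setT f -> (forall w, `|f w| <= C) ->
  P.-integrable setT (EFin \o f).
Proof.
move=> mf fC; apply: (@le_Rintegrable _ _ _ P _ _ _ (cst C)) => //.
exact: finite_measure_integrable_cst.
Qed.

Lemma measurable_sinS (u x : R) : measurable_fun setT (fun w => sin (u * (x - S w))).
Proof.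
apply: (measurableT_comp (@measurable_sinR R)).
by apply: measurable_funM => //; exact: measurable_funB.
Qed.

Hypothesis iS : P.-integrable setT (EFin \o S).

Let kern (s x : R) (w : Omega) (u : R) :=
  u^-1 * gauss_weight s u * sin (u * (x - S w)).

Let kern_le s x w u : `|kern s x w u| <= `|x - S w| * gauss_weight s u.
Proof.
rewrite !normrM (ger0_norm (gauss_weight_ge0 _ _)) mulrAC.
rewrite ler_wpM2r ?gauss_weight_ge0//.
have [->|u0] := eqVneq u 0; first by rewrite invr0 normr0 mul0r.
rewrite normfV ler_pdivrMl ?normr_gt0// -normrM; exact: sin_norm_le.
Qed.

Let kern_measurable s x :
  measurable_fun (setT : set (Omega * measurableTypeR R)) (fun z => kern s x z.1 z.2).
Proof.
have m2 : measurable_fun (setT : set (Omega * measurableTypeR R)) snd.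
  exact: measurable_snd.
have m1 : measurable_fun (setT : set (Omega * measurableTypeR R)) fst.
  exact: measurable_fst.
apply: measurable_funM; first apply: measurable_funM.
- exact: (measurableT_comp (@measurable_invr R) m2).
- exact: (measurableT_comp (@measurable_gauss_weight R s) m2).
- apply: (measurableT_comp (@measurable_sinR R)).
  apply: measurable_funM => //; apply: measurable_funB => //.
  exact: (measurableT_comp mS m1).
Qed.

Let iSx x : P.-integrable setT (EFin \o (fun w => `|x - S w|)).
Proof.
apply: RintegrableNorm => //; apply: RintegrableB => //.
by apply: (@probability_Rintegrable (cst x) `|x|).
Qed.

Let kern_integrable1 s x w : 0 < s ->
  mu.-integrable setT (EFin \o (fun u => kern s x w u)).
Proof.
move=> s0; apply: (@le_Rintegrable _ (measurableTypeR R) _ mu _ _ _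
  (fun u => `|x - S w| * gauss_weight s u)) => //.
- exact: (measurableT_comp (kern_measurable s x) (pair1_measurable w)).
- by apply: RintegrableZ => //; exact: integrable_gauss_weight.
Qed.

Let kern_integrable2 s x u : P.-integrable setT (EFin \o (fun w => kern s x w u)).
Proof.
apply: (@le_Rintegrable _ _ _ P _ _ _ (fun w => gauss_weight s u * `|x - S w|)) => //.
- exact: (measurableT_comp (kern_measurable s x) (pair2_measurable u)).
- exact: RintegrableZ.
- by move=> w _; rewrite mulrC kern_le.
Qed.

Let kern_integrable s x : 0 < s ->
  (P \x mu)%E.-integrable setT (fun z => (kern s x z.1 z.2)%:E).
Proof.
move=> s0; apply: (@integrable12ltyP _ _ Omega (measurableTypeR R) R P mu
    (fun z => (kern s x z.1 z.2)%:E) _).2.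
  by apply/measurable_EFinP; exact: kern_measurable.
apply: (@le_lt_trans _ _ (\int[P]_w (`|x - S w| * \int[mu]_u gauss_weight s u)%:E)%E).
  apply: ge0_le_integral => //.
  - by move=> w _; exact: integral_ge0.
  - apply: (@measurable_fun_fubini_tonelli_F _ _ Omega (measurableTypeR R) R mu
      (abse \o (fun z => (kern s x z.1 z.2)%:E))) => //.
      by apply: measurableT_comp => //; apply/measurable_EFinP; exact: kern_measurable.
    by move=> z; exact: abse_ge0.
  - apply/measurable_EFinP; apply: measurable_funM => //.
    exact: Rintegrable_measurable (iSx x).
  move=> w _.
  have ig := @integrable_gauss_weight R s s0.
  apply: (@le_trans _ _ (\int[mu]_u (`|x - S w| * gauss_weight s u)%:E)%E).
    apply: ge0_le_integral => //.
    - apply/measurable_EFinP; apply: measurableT_comp => //.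
      exact: Rintegrable_measurable (kern_integrable1 x w s0).
    - by apply/measurable_EFinP; apply: measurable_funM => //; exact: measurable_gauss_weight.
    - by move=> u _; rewrite lee_fin kern_le.
  rewrite -RintegralZl// /Rintegral fineK//.
  by apply: integrable_fin_num => //; exact: RintegrableZ.
under eq_integral do rewrite mulrC.
have i := RintegrableZ measurableT (\int[mu]_u gauss_weight s u) (iSx x).
by rewrite -[X in (X < _)%E]fineK ?ltry//; exact: integrable_fin_num i.
Qed.

Let kernE s x u : \int[P]_w kern s x w u =
  u^-1 * gauss_weight s u * \int[P]_w sin (u * (x - S w)).
Proof.
rewrite /kern RintegralZl//; apply: (@probability_Rintegrable _ 1).
  exact: measurable_sinS.
by move=> w; exact: norm_sin_le1.
Qed.

Lemma smoothed_transform_integrable s x : 0 < s ->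
  mu.-integrable setT (EFin \o (fun u =>
    u^-1 * gauss_weight s u * \int[P]_w sin (u * (x - S w)))).
Proof.
move=> s0.
have := @Rintegrable_fubini _ _ _ (measurableTypeR R) R P mu (kern s x)
  (kern_integrable x s0) (kern_integrable2 s x).
by rewrite (_ : (fun y => _) = (fun u =>
  u^-1 * gauss_weight s u * \int[P]_w sin (u * (x - S w))))//; apply/funext.
Qed.

(** Fubini applied to [Rintegral_gauss_sinc]. The left side is the
    distribution function of [S] plus an independent normal variable of
    variance [s]; the Gaussian weight makes the inversion integral absolutely
    convergent, so no truncation of the frequencies is needed. *)
Lemma smoothed_cdf s x : 0 < s ->
  \int[P]_w gauss_cdf ((x - S w) / Num.sqrt s) = 2^-1 + (2 * pi)^-1 *
  \int[mu]_u (u^-1 * gauss_weight s u * \int[P]_w sin (u * (x - S w))).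
Proof.
move=> s0; have p0 : 2 * pi != 0 :> R by rewrite mulf_neq0// gt_eqF// pi_gt0.
under [in RHS]eq_Rintegral do rewrite -kernE.
rewrite -(@Rintegral_fubini _ _ _ (measurableTypeR R) R P mu (kern s x)
  (kern_integrable x s0) (fun w => kern_integrable1 x w s0) (kern_integrable2 s x)).
under [in RHS]eq_Rintegral do rewrite /kern Rintegral_gauss_sinc//.
have ic : P.-integrable setT (EFin \o (fun w => gauss_cdf ((x - S w) / Num.sqrt s))).
  apply: (@probability_Rintegrable _ 1).
    apply: (measurableT_comp (@measurable_gauss_cdf R)).
    by apply: measurable_funM => //; exact: measurable_funB.
  by move=> w; rewrite ger0_norm ?gauss_cdf_ge0// gauss_cdf_le1.
have ih : P.-integrable setT (EFin \o (cst (2^-1 : R))).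
  by apply: (@probability_Rintegrable _ `|2^-1|).
rewrite RintegralZl//; last exact: RintegrableB.
rewrite RintegralB// Rintegral_cst//= probability_setT mulr1 mulrA mulVf// mul1r.
by rewrite addrC subrK.
Qed.

Lemma measurable_lt_level x : measurable [set w | S w < x].
Proof.
have := mS measurableT (measurable_itv `]-oo, x[); rewrite setTI.
by congr (measurable _); apply/seteqP; split => w /=; rewrite in_itv.
Qed.

Let integrable_cdf s y : P.-integrable setT
  (EFin \o (fun w => gauss_cdf ((y - S w) / Num.sqrt s))).
Proof.
apply: (@probability_Rintegrable _ 1).
  apply: (measurableT_comp (@measurable_gauss_cdf R)).
  by apply: measurable_funM => //; exact: measurable_funB.
by move=> w; rewrite ger0_norm ?gauss_cdf_ge0// gauss_cdf_le1.
Qed.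

Let integrable_cst (c : R) : P.-integrable setT (EFin \o (fun=> c)).
Proof. by apply: (@probability_Rintegrable _ `|c|). Qed.

Let integrable_ind x : P.-integrable setT (EFin \o \1_[set w | S w < x]).
Proof.
apply: (@probability_Rintegrable _ 1).
  by apply: measurable_indic; exact: measurable_lt_level.
by move=> w; rewrite indicE; case: (_ \in _); rewrite ?normr1 ?normr0.
Qed.

Let prob_ind x : fine (P [set w | S w < x]) = \int[P]_w \1_[set w | S w < x] w.
Proof.
by rewrite /Rintegral integral_indic ?setIT//; exact: measurable_lt_level.
Qed.

(** The normal perturbation exceeds [Num.sqrt s * A] with probability
    [gauss_cdf (- A)]; a shift of the argument by that amount therefore
    removes it, thanks to the monotonicity of distribution functions alone. *)
Lemma smoothing_lower (s x A : R) : 0 < s ->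
  \int[P]_w gauss_cdf ((x - Num.sqrt s * A - S w) / Num.sqrt s) - gauss_cdf (- A)
  <= fine (P [set w | S w < x]).
Proof.
move=> s0; have q0 : 0 < Num.sqrt s by rewrite sqrtr_gt0.
have -> : gauss_cdf (- A) = \int[P]_w gauss_cdf (- A).
  by rewrite Rintegral_cst//= probability_setT mulr1.
rewrite prob_ind -(RintegralB measurableT (integrable_cdf s _) (integrable_cst _)).
apply: le_Rintegral => //.
  by apply: RintegrableB => //; exact: integrable_cst.
move=> w _; rewrite indicE; case: (boolP (w \in _)) => [_|].
  by rewrite lerBlDr (le_trans (gauss_cdf_le1 _))// lerDl gauss_cdf_ge0.
rewrite notin_setE /= => /negP; rewrite -leNgt => xS.
rewrite subr_le0 le_gauss_cdf// ler_pdivrMr//; lra.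
Qed.

Lemma smoothing_upper (s x A : R) : 0 < s ->
  fine (P [set w | S w < x]) <=
  \int[P]_w gauss_cdf ((x + Num.sqrt s * A - S w) / Num.sqrt s) + gauss_cdf (- A).
Proof.
move=> s0; have q0 : 0 < Num.sqrt s by rewrite sqrtr_gt0.
have -> : gauss_cdf (- A) = \int[P]_w gauss_cdf (- A).
  by rewrite Rintegral_cst//= probability_setT mulr1.
rewrite prob_ind -(RintegralD measurableT (integrable_cdf s _) (integrable_cst _)).
apply: le_Rintegral => //.
  by apply: RintegrableD => //; exact: integrable_cst.
move=> w _; rewrite indicE; case: (boolP (w \in _)) => [|_]; last first.
  by rewrite addr_ge0 ?gauss_cdf_ge0.
rewrite inE /= => Sx; rewrite gauss_cdfN.
have : gauss_cdf A <= gauss_cdf ((x + Num.sqrt s * A - S w) / Num.sqrt s).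
  by rewrite le_gauss_cdf// ler_pdivlMr//; lra.
by rewrite mulr1n; lra.
Qed.

End smoothing.

(** * Edgeworth expansion of a smoothed distribution function *)

Section expansion_kernel.
Context {R : realType}.
Implicit Types (a b c K N kap u x s : R).

(** The integrand of the inversion formula against that of the expansion. Here
    [expR (- a)] and [b] are the modulus and the argument of a characteristic
    function at [u]. The difference splits into an error on the modulus, first
    order in [a - u ^ 2 / 2], and an error on the phase, where [sin (u * x -
    b)] is expanded to first order in [b]. The factor [`|u|] compensates the
    singular factor [u^-1] of the inversion formula. *)
Lemma expansion_kernel_error a b c K N kap u x s :
  0 < c -> 0 < K -> 0 < N -> 0 <= s -> s <= N^-1 ->
  expR (- a) <= expR (- (c * u ^+ 2)) + expR (- (c * N)) ->
  `|a - u ^+ 2 / 2| <= K * `|u| ^+ 4 / N ->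
  `|b| <= K * `|u| ^+ 3 / Num.sqrt N ->
  `|b + kap / Num.sqrt N * u ^+ 3 / 6| <= K * `|u| ^+ 4 / N ->
  `|gauss_weight s u * (expR (- a) * sin (u * x - b)) -
    gauss_weight 1 u * (sin (u * x) + kap / Num.sqrt N * u ^+ 3 / 6 * cos (u * x))| <=
  `|u| * ((2 * K ^+ 2 + 2 * K + 1) / N * (1 + u ^+ 6) *
    (gauss_weight (2 * c) u + expR (- (c * N)) * gauss_weight s u + gauss_weight 1 u)).
Proof.
move=> c0 K0 N0 s0 sN ea a2 b3 b4.
set E := expR (- a) in ea *; set w := gauss_weight s u.
have w0 : 0 <= w := gauss_weight_ge0 _ _.
have w1 : w <= 1 := gauss_weight_le1 _ s0.
set g := gauss_weight 1 u; have g0 : 0 <= g := gauss_weight_ge0 _ _.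
set h := gauss_weight (2 * c) u; have h0 : 0 <= h := gauss_weight_ge0 _ _.
have hE : h = expR (- (c * u ^+ 2)) by rewrite /h /gauss_weight; congr expR; field.
set e := expR (- (c * N)) in ea *; have e0 : 0 <= e := expR_ge0 _.
have E0 : 0 <= E := expR_ge0 _.
set k := kap / Num.sqrt N * u ^+ 3 / 6 in b4 *.
set r := `|u| in a2 b3 b4 *; have r0 : 0 <= r := normr_ge0 _.
have u2 : u ^+ 2 = r ^+ 2 by rewrite /r -normrX ger0_norm// sqr_ge0.
have u6 : u ^+ 6 = r ^+ 6.
  by rewrite /r -normrX ger0_norm// exprn_even_ge0.
have rk (j : nat) : (j <= 6)%N -> r ^+ j <= 1 + r ^+ 6.
  by move=> j6; rewrite -u6; exact: norm_exp_le6.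
have r1 := rk 1 isT; have r3 := rk 3 isT; have r5 := rk 5 isT.
have wE : w * E <= h + e * w.
  have : E * w <= (h + e) * w by rewrite ler_wpM2r// hE.
  by rewrite mulrC => /le_trans; apply; rewrite mulrDl lerD2r ler_piMr.
have first : `|w * E - g| <= (K * r ^+ 4 + r ^+ 2) / N * (h + e * w + g).
  have -> : w * E = expR (- (a + s * u ^+ 2 / 2)).
    by rewrite /w /E /gauss_weight -expRD; congr expR; ring.
  have -> : g = expR (- (u ^+ 2 / 2)) by rewrite /g /gauss_weight mul1r.
  apply: (le_trans (expR_sub_le _ _)).
  have -> : expR (- (u ^+ 2 / 2)) = g by rewrite /g /gauss_weight mul1r.
  have -> : expR (- (a + s * u ^+ 2 / 2)) = w * E.
    by rewrite /w /E /gauss_weight -expRD; congr expR; ring.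
  apply: ler_pM; rewrite ?normr_ge0 ?addr_ge0 ?mulr_ge0 ?lerD2r//.
  have -> : a + s * u ^+ 2 / 2 - u ^+ 2 / 2 = (a - u ^+ 2 / 2) + s * u ^+ 2 / 2 by ring.
  rewrite (le_trans (ler_normD _ _))// [leRHS]mulrDl lerD//.
  have r20 : 0 <= r ^+ 2 by rewrite exprn_ge0.
  have -> : `|s * u ^+ 2 / 2| = r ^+ 2 * (s / 2).
    by rewrite u2 ger0_norm ?divr_ge0 ?mulr_ge0//; ring.
  by rewrite ler_wpM2l//; lra.
have second : `|sin (u * x - b) - (sin (u * x) + k * cos (u * x))| <=
    (2 * K ^+ 2 * r ^+ 6 + K * r ^+ 4) / N.
  have -> : sin (u * x - b) - (sin (u * x) + k * cos (u * x)) =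
     (sin (u * x - b) - sin (u * x) + b * cos (u * x)) - (b + k) * cos (u * x) by ring.
  rewrite (le_trans (ler_normB _ _))// [leRHS]mulrDl lerD//.
    apply: (le_trans (sin_sub_taylor _ _)).
    have -> : 2 * K ^+ 2 * r ^+ 6 / N = 2 * ((K * r ^+ 3) ^+ 2 / N) by ring.
    rewrite ler_pM2l//.
    have -> : b ^+ 2 = `|b| ^+ 2 by rewrite real_normK ?num_real.
    apply: (@le_trans _ _ ((K * r ^+ 3 / Num.sqrt N) ^+ 2)).
      by rewrite lerXn2r// nnegrE// (le_trans _ b3).
    by rewrite expr_div_n sqr_sqrtr ?(ltW N0).
  by rewrite normrM (le_trans _ b4)// ler_piMr// norm_cos_le1.
have -> : w * (E * sin (u * x - b)) - g * (sin (u * x) + k * cos (u * x)) =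
  (w * E - g) * sin (u * x - b) +
  g * (sin (u * x - b) - (sin (u * x) + k * cos (u * x))) by ring.
set G := h + e * w + g in first *.
have G0 : 0 <= G by rewrite !addr_ge0// mulr_ge0.
have gG : g <= G by rewrite lerDr addr_ge0// mulr_ge0.
have Ni : 0 <= N^-1 by rewrite invr_ge0 ltW.
apply: (@le_trans _ _ ((K * r ^+ 4 + r ^+ 2) / N * G +
    G * ((2 * K ^+ 2 * r ^+ 6 + K * r ^+ 4) / N))).
  rewrite (le_trans (ler_normD _ _))// lerD//.
    by rewrite normrM (le_trans _ first)// ler_piMr// norm_sin_le1.
  rewrite normrM ger0_norm// ler_pM//.
have -> : (K * r ^+ 4 + r ^+ 2) / N * G +
    G * ((2 * K ^+ 2 * r ^+ 6 + K * r ^+ 4) / N) =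
  r * (N^-1 * (K * r ^+ 3 + r ^+ 1 + 2 * K ^+ 2 * r ^+ 5 + K * r ^+ 3) * G) by ring.
have -> : r * ((2 * K ^+ 2 + 2 * K + 1) / N * (1 + u ^+ 6) * G) =
  r * (N^-1 * ((2 * K ^+ 2 + 2 * K + 1) * (1 + u ^+ 6)) * G) by ring.
rewrite ler_wpM2l// ler_wpM2r// ler_wpM2l// u6.
have K20 : 0 <= 2 * K ^+ 2 by rewrite mulr_ge0// sqr_ge0.
have := ler_wpM2l K20 r5; have := ler_wpM2l (ltW K0) r3; lra.
Qed.

End expansion_kernel.

(** At frequencies where the characteristic function is only known to be
    exponentially small in [n], the integral extends up to [`|u|] of order [n
    ^ 2] and grows like [n ^ 14]; the exponential wins. *)
Lemma gauss_pow6_damped (R : realType) (c : R) : 0 < c -> exists M : R, forall n : nat,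
  (0 < n)%N -> expR (- (c * n%:R)) *
  \int[lebesgue_measure]_u ((1 + u ^+ 6) * gauss_weight (n%:R ^- 4) u) <= M.
Proof.
move=> c0; have [M hM] := @pow_exp_bounded R 13 c c0.
exists ((1 + 6 * 4 ^+ 3) * Num.sqrt (4 * pi) * M) => n n0.
have N1 : 1 <= n%:R :> R by rewrite ler1n.
have N0 : 0 < n%:R :> R by rewrite ltr0n.
set N := n%:R : R in N1 N0 *.
have s0 : 0 < N ^- 4 by rewrite invr_gt0 exprn_gt0.
have e0 := expR_ge0 (- (c * N)).
apply: (le_trans (ler_wpM2l e0 (integral_pow6_gauss_weight_le s0))).
have -> : Num.sqrt (4 * pi / N ^- 4) = Num.sqrt (4 * pi) * N ^+ 2.
  rewrite invrK sqrtrM ?mulr_ge0 ?pi_ge0//; congr (_ * _).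
  by rewrite (_ : N ^+ 4 = (N ^+ 2) ^+ 2) ?sqrtr_sqr ?ger0_norm ?exprn_ge0 ?(ltW N0)// -exprM.
have -> : 6 * (4 / N ^- 4) ^+ 3 = 6 * 4 ^+ 3 * N ^+ 12.
  by rewrite invrK exprMn mulrA -exprM.
have N12 : 1 <= N ^+ 12 by rewrite exprn_ege1.
have h := hM N (ltW N0).
have c1 : 0 <= (1 + 6 * 4 ^+ 3) * Num.sqrt (4 * pi) :> R.
  by rewrite mulr_ge0 ?sqrtr_ge0// addr_ge0// mulr_ge0// exprn_ge0.
apply: le_trans (ler_wpM2l c1 h).
have -> : expR (- (c * N)) * ((1 + 6 * 4 ^+ 3 * N ^+ 12) * (Num.sqrt (4 * pi) * N ^+ 2)) =
  (1 + 6 * 4 ^+ 3 * N ^+ 12) * (Num.sqrt (4 * pi) * (N ^+ 2 * expR (- (c * N)))) by ring.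
have -> : (1 + 6 * 4 ^+ 3) * Num.sqrt (4 * pi) * (N ^+ 14 * expR (- (c * N))) =
  ((1 + 6 * 4 ^+ 3) * N ^+ 12) * (Num.sqrt (4 * pi) * (N ^+ 2 * expR (- (c * N)))).
  by rewrite (_ : N ^+ 14 = N ^+ 12 * N ^+ 2) -?exprD//; ring.
apply: ler_wpM2r.
  by rewrite mulr_ge0 ?sqrtr_ge0// mulr_ge0 ?exprn_ge0 ?expR_ge0// ltW.
by rewrite [leRHS]mulrDl mul1r lerD2r.
Qed.

Lemma sin_shift_expectation d (Omega : measurableType d) (R : realType)
    (P : probability Omega R) (S : Omega -> R) (e b u x : R) :
  measurable_fun setT S ->
  \int[P]_w cos (u * S w) = e * cos b -> \int[P]_w sin (u * S w) = e * sin b ->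
  \int[P]_w sin (u * (x - S w)) = e * sin (u * x - b).
Proof.
move=> mS hc hs.
have ms : measurable_fun setT (fun w => sin (u * S w)).
  by apply: (measurableT_comp (@measurable_sinR R)); exact: measurable_funM.
have mc : measurable_fun setT (fun w => cos (u * S w)).
  apply: (measurableT_comp (f := @cos R)); last exact: measurable_funM.
  by apply: continuous_measurable_fun => z; exact: continuous_cos.
have ic : P.-integrable setT (EFin \o (fun w => cos (u * S w))).
  by apply: (@probability_Rintegrable _ _ _ _ _ 1) => // w; exact: norm_cos_le1.
have isn : P.-integrable setT (EFin \o (fun w => sin (u * S w))).
  by apply: (@probability_Rintegrable _ _ _ _ _ 1) => // w; exact: norm_sin_le1.
under eq_Rintegral do rewrite mulrBr sinB.
rewrite RintegralB ?RintegralZl ?hc ?hs//; try exact: RintegrableZ.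
by rewrite sinB; ring.
Qed.

Section edgeworth.
Context {R : realType}.
Local Notation mu := (@lebesgue_measure R).

(** Both sides are inversion integrals, and [expansion_kernel_error] bounds
    the difference of the integrands by [1 / n] times a function whose
    integral is bounded uniformly in [n]. The hypotheses are those satisfied
    by a standardized sum of [n] independent terms; the constant depends on
    [c] and [K] only. *)
Lemma edgeworth_smoothed (c K : R) : 0 < c -> 0 < K -> exists2 C : R, 0 <= C &
  forall d (Omega : measurableType d) (P : probability Omega R) (S : Omega -> R)
    (a b : R -> R) (kap : R) (n : nat) (x : R),
  measurable_fun setT S -> P.-integrable setT (EFin \o S) -> (0 < n)%N ->
  (forall u, \int[P]_w cos (u * S w) = expR (- a u) * cos (b u)) ->
  (forall u, \int[P]_w sin (u * S w) = expR (- a u) * sin (b u)) ->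
  (forall u, expR (- a u) <= expR (- (c * u ^+ 2)) + expR (- (c * n%:R))) ->
  (forall u, `|a u - u ^+ 2 / 2| <= K * `|u| ^+ 4 / n%:R) ->
  (forall u, `|b u| <= K * `|u| ^+ 3 / Num.sqrt n%:R) ->
  (forall u, `|b u + kap / Num.sqrt n%:R * u ^+ 3 / 6| <= K * `|u| ^+ 4 / n%:R) ->
  `|\int[P]_w gauss_cdf ((x - S w) / Num.sqrt (n%:R ^- 4)) -
    (gauss_cdf x + kap / Num.sqrt n%:R / 6 * (1 - x ^+ 2) * gauss_pdf x)| <= C / n%:R.
Proof.
move=> c0 K0.
pose J s := \int[mu]_u ((1 + u ^+ 6) * gauss_weight s u) : R.
have J0 s : 0 <= J s.
  by apply: Rintegral_ge0 => u _; rewrite mulr_ge0 ?gauss_weight_ge0 ?addr_ge0// exprn_even_ge0.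
have [M hM] := gauss_pow6_damped c0.
have M0 : 0 <= M by apply: le_trans (hM 1%N isT); rewrite mulr_ge0 ?expR_ge0// J0.
pose K2 := 2 * K ^+ 2 + 2 * K + 1.
have K20 : 0 <= K2 by rewrite /K2 !addr_ge0// mulr_ge0// ?sqr_ge0// ltW.
have p0 : 0 < 2 * pi :> R by rewrite mulr_gt0// pi_gt0.
exists ((2 * pi)^-1 * (K2 * (J (2 * c) + M + J 1))).
  by rewrite mulr_ge0 ?invr_ge0 ?(ltW p0)// mulr_ge0// !addr_ge0// J0.
move=> d Omega P S a b kap n x mS iS n0 hc hs ea a2 b3 b4.
have N1 : 1 <= n%:R :> R by rewrite ler1n.
have N0 : 0 < n%:R :> R by rewrite ltr0n.
set N := n%:R : R in ea a2 b3 b4 N1 N0 *.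
(* Any [n ^ (- p)] with [p > 2] would do: removing the smoothing moves the
   argument by [sqrt s * A], which is then [o(1 / sqrt n)] for some [A]
   growing faster than [sqrt n]. *)
set s := N ^- 4.
have s0 : 0 < s by rewrite invr_gt0 exprn_gt0.
have sN : s <= N^-1.
  rewrite lef_pV2 ?posrE ?exprn_gt0//.
  by rewrite -[leLHS]expr1 ler_weXn2l.
pose I1 u := u^-1 * gauss_weight s u * \int[P]_w sin (u * (x - S w)).
pose I2 u := u^-1 * gauss_weight 1 u * sin (u * x) +
  kap / Num.sqrt N / 6 * (u ^+ 2 * gauss_weight 1 u * cos (u * x)).
have iI1 : mu.-integrable setT (EFin \o I1) by exact: smoothed_transform_integrable.
have iI2a := @integrable_gauss_sinc R 1 x ltr01.
have iI2b : mu.-integrable setT (EFin \o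
    (fun u => u ^+ 2 * gauss_weight 1 u * cos (u * x))).
  apply: integrable_gauss_weight_poly => //; first exact: measurable_cosM.
  by move=> u; exact: norm_cos_le1.
have iI2 : mu.-integrable setT (EFin \o I2).
  by apply: RintegrableD => //; exact: RintegrableZ.
pose H u := K2 / N * ((1 + u ^+ 6) * gauss_weight (2 * c) u +
  expR (- (c * N)) * ((1 + u ^+ 6) * gauss_weight s u) +
  (1 + u ^+ 6) * gauss_weight 1 u).
have c20 : 0 < 2 * c by rewrite mulr_gt0.
have i1 := integrable_pow6_gauss_weight c20.
have i2 := integrable_pow6_gauss_weight s0.
have i3 := @integrable_pow6_gauss_weight R 1 ltr01.
have i2' := RintegrableZ measurableT (expR (- (c * N))) i2.
have i12 := RintegrableD measurableT i1 i2'.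
have i123 := RintegrableD measurableT i12 i3.
have iH : mu.-integrable setT (EFin \o H) by exact: RintegrableZ.
have IH : \int[mu]_u H u <= K2 / N * (J (2 * c) + M + J 1).
  rewrite /H RintegralZl// RintegralD// RintegralD// RintegralZl//.
  rewrite ler_wpM2l ?divr_ge0 ?(ltW N0)// lerD2r lerD2l.
  exact: hM.
have I12 u : `|I1 u - I2 u| <= H u.
  have -> : I1 u - I2 u = u^-1 * (gauss_weight s u * (expR (- a u) * sin (u * x - b u)) -
    gauss_weight 1 u * (sin (u * x) + kap / Num.sqrt N * u ^+ 3 / 6 * cos (u * x))).
    rewrite /I1 /I2 (sin_shift_expectation x mS (hc u) (hs u)).
    have [->|u0] := eqVneq u 0; first by rewrite expr0n/= invr0 !mul0r mulr0 addr0 subr0.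
    by field; rewrite u0 /= gt_eqF// sqrtr_gt0.
  rewrite normrM.
  have := @expansion_kernel_error R (a u) (b u) c K N kap u x s c0 K0 N0 (ltW s0) sN
    (ea u) (a2 u) (b3 u) (b4 u).
  move=> /(ler_wpM2l (normr_ge0 u^-1))/le_trans; apply.
  rewrite mulrA /H; set w := gauss_weight 1 u.
  have -> : K2 / N * ((1 + u ^+ 6) * gauss_weight (2 * c) u +
    expR (- (c * N)) * ((1 + u ^+ 6) * gauss_weight s u) + (1 + u ^+ 6) * w) =
    1 * (K2 / N * (1 + u ^+ 6) * (gauss_weight (2 * c) u + expR (- (c * N)) * gauss_weight s u + w)).
    by ring.
  apply: ler_wpM2r.
    rewrite mulr_ge0// ?mulr_ge0 ?invr_ge0 ?(ltW N0)// ?addr_ge0 ?gauss_weight_ge0//.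
      by rewrite exprn_even_ge0.
    by rewrite mulr_ge0 ?expR_ge0 ?gauss_weight_ge0.
  rewrite -normrM; have [->|u0] := eqVneq u 0; first by rewrite mulr0 normr0.
  by rewrite mulVf// normr1.
have I2E : \int[mu]_u I2 u = 2 * pi * (gauss_cdf x - 2^-1 +
    kap / Num.sqrt N / 6 * (1 - x ^+ 2) * gauss_pdf x).
  rewrite RintegralD ?RintegralZl//; last exact: RintegrableZ.
  rewrite Rintegral_gauss_sinc// sqrtr1 divr1 gauss_cos_moment2.
  have q0 := @sqrt2pi_gt0 R.
  have qE : 2 * pi = Num.sqrt (2 * pi) ^+ 2 :> R by rewrite sqr_sqrtr// ltW.
  rewrite gauss_pdfE /gauss_weight mul1r; set q := Num.sqrt (2 * pi) in q0 qE *.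
  by rewrite qE; field; rewrite !gt_eqF// sqrtr_gt0.
rewrite smoothed_cdf// -/(I1 _).
have -> : 2^-1 + (2 * pi)^-1 * \int[mu]_u I1 u -
  (gauss_cdf x + kap / Num.sqrt N / 6 * (1 - x ^+ 2) * gauss_pdf x) =
  (2 * pi)^-1 * (\int[mu]_u (I1 u - I2 u)).
  rewrite (RintegralB measurableT iI1 iI2) I2E [RHS]mulrBr [in RHS]mulrA.
  by rewrite mulVf ?gt_eqF// mul1r; ring.
rewrite normrM ger0_norm ?invr_ge0 ?(ltW p0)// -mulrA ler_wpM2l ?invr_ge0 ?(ltW p0)//.
have -> : K2 * (J (2 * c) + M + J 1) / N = K2 / N * (J (2 * c) + M + J 1) by ring.
apply: le_trans IH; apply: norm_Rintegral_le => //.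
exact: RintegrableB.
Qed.

End edgeworth.

(** * Trigonometric moments of the Poisson law *)

Section exp_trig_series.
Context {R : realType}.
Implicit Types c d r : R.

(** The real part of [exp (i d)] times the partial sum of the exponential
    series at [r * exp (i c)]. *)
Definition exp_trig_sum c (n : nat) d r : R :=
  \sum_(k < n) cos (c * k%:R + d) * (r ^+ k / k`!%:R).

Let F c d r := expR (r * cos c) * cos (r * sin c + d).

(** Differentiation in [r] shifts the phase by [c], as it does for the limit;
    this is what lets [exp_trig_sum_error] go by induction on the number of
    terms. *)
Lemma is_derive_exp_trig_sum c n d r :
  is_derive r 1 (exp_trig_sum c n.+1 d) (exp_trig_sum c n (d + c) r).
Proof.
rewrite /exp_trig_sum; elim: n => [|n IHn].
  rewrite big_ord0; under eq_fun do rewrite big_ord1 /= expr0.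
  exact: is_derive_cst.
under eq_fun do rewrite big_ord_recr /=; rewrite big_ord_recr /=.
eapply is_derive_congr.
  eapply is_derive_addf; first exact: IHn.
  by derive_rules.
rewrite /= factS natrM -natr1; congr (_ + _).
have n0 : n%:R + 1 != 0 :> R by rewrite natr1 pnatr_eq0.
have f0 : n`!%:R != 0 :> R by rewrite pnatr_eq0 -lt0n fact_gt0.
rewrite (_ : c * n%:R + (d + c) = c * (n%:R + 1) + d); last by ring.
by field; rewrite f0 n0.
Qed.

Let is_derive_F c d r : is_derive r 1 (F c d) (F c (d + c) r).
Proof. rewrite /F; derive_by.
have -> : r * sin c + (d + c) = r * sin c + d + c by ring.
by rewrite [cos (r * sin c + d + c)]cosD; ring. Qed.

(** Taylor's inequality in [r] with the phase free: the derivative of the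
    remainder of order [n + 1] is the remainder of order [n] at a shifted
    phase. *)
Lemma exp_trig_sum_error c (rho : R) n d r : 0 <= r -> r <= rho ->
  `|F c d r - exp_trig_sum c n d r| <= expR rho * (r ^+ n / n`!%:R).
Proof.
elim: n d r => [|n IHn] d r r0 rr.
  rewrite /exp_trig_sum big_ord0 subr0 expr0 fact0 divr1 mulr1 /F.
  rewrite normrM ger0_norm ?expR_ge0// (@le_trans _ _ (expR (r * cos c)))//.
    by rewrite ler_piMr ?expR_ge0// ler_norml cos_geN1 cos_le1.
  by rewrite ler_expR (le_trans _ rr)// ler_piMr// cos_le1.
move: r0; rewrite le_eqVlt => /predU1P[<-|r0].
  rewrite /F /exp_trig_sum big_ord_recl /= big1 => [|i _]; last first.
    by rewrite /bump /= exprS !mul0r mulr0.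
  rewrite !mul0r expR0 mulr0 expr0 fact0 divr1 mulr1 mul1r addr0 add0r subrr normr0.
  by rewrite mulr_ge0 ?expR_ge0// divr_ge0// exprn_ge0.
pose D x := F c d x - exp_trig_sum c n.+1 d x.
pose D' x := F c (d + c) x - exp_trig_sum c n (d + c) x.
have dD (x : R) : is_derive x 1 D (D' x).
  rewrite /D; eapply is_derive_addf; first exact: is_derive_F.
  by eapply is_derive_oppf; exact: is_derive_exp_trig_sum.
pose B x := expR rho * (x ^+ n.+1 / n.+1`!%:R).
have dB (x : R) : is_derive x 1 B (expR rho * (x ^+ n / n`!%:R)).
  rewrite /B; derive_by => /=; rewrite factS natrM -natr1.
  have n0 : n%:R + 1 != 0 :> R by rewrite natr1 pnatr_eq0.
  have f0 : n`!%:R != 0 :> R by rewrite pnatr_eq0 -lt0n fact_gt0.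
  by field; rewrite f0 n0.
have D0 : D 0 = 0.
  rewrite /D /F /exp_trig_sum big_ord_recl /= big1 => [|i _]; last first.
    by rewrite /bump /= exprS !mul0r mulr0.
  by rewrite !mul0r expR0 mulr0 expr0 fact0 divr1 mulr1 mul1r addr0 add0r subrr.
have B0 : B 0 = 0 by rewrite /B expr0n /= mul0r mulr0.
(* Both inequalities, for the two signs, come from the mean value theorem
   applied to [B - sg * D]. *)
have key (sg : R) : `|sg| = 1 -> sg * D r <= B r.
  move=> sg1; pose g x := B x - sg * D x.
  have dg (x : R) : is_derive x 1 g (expR rho * (x ^+ n / n`!%:R) - sg * D' x).
    rewrite /g; eapply is_derive_congr.
      eapply is_derive_addf; first exact: dB.
      eapply is_derive_oppf; eapply is_derive_mulf; first exact: is_derive_cstf.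
      exact: dD.
    by rewrite mul0r add0r.
  have [|z /[!in_itv]/= /andP[z0 zr]] := MVT r0 (fun x _ => dg x).
    by apply: continuous_subspaceT => x; exact: continuous_of_is_derive (dg x).
  rewrite {2}/g D0 B0 mulr0 !subr0 => e.
  rewrite -subr_ge0 -/(g r) e mulr_ge0 ?(ltW r0)// subr_ge0.
  rewrite (le_trans (ler_norm _))// normrM sg1 mul1r.
  by apply: IHn; [exact: ltW | rewrite (le_trans (ltW zr))].
rewrite ler_norml lerNl -mulN1r key ?normrN1//=.
by have := key 1 (normr1 _); rewrite mul1r.
Qed.

Lemma cvg_exp_trig_sum c d r : 0 <= r ->
  exp_trig_sum c n d r @[n --> \oo] --> expR (r * cos c) * cos (r * sin c + d).
Proof.
move=> r0; apply/subr_cvg0; apply: norm_cvg0.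
have e0 : exp_coeff r n @[n --> \oo] --> (0 : R).
  exact: cvg_series_cvg_0 (is_cvg_series_exp_coeff r).
apply: (@squeeze_cvgr _ _ _ _ (cst 0) (fun n => expR r * exp_coeff r n)).
- near=> n; rewrite normr_ge0 /= distrC.
  exact: exp_trig_sum_error.
- exact: cvg_cst.
- by rewrite -[X in _ --> X](mulr0 (expR r)); apply: cvgM => //; exact: cvg_cst.
Unshelve. all: end_near. Qed.

End exp_trig_series.

Lemma poisson_probE (R : realType) (r : R) (k : nat) : 0 <= r ->
  poisson_prob r 0 [set k] = (r ^+ k / k`!%:R * expR (- r))%:E.
Proof.
rewrite /poisson_prob le_eqVlt => /predU1P[<-|r0].
  rewrite ltxx diracE expr0n oppr0 expR0 mulr1.
  case: k => [|k]; rewrite ?fact0 ?divr1.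
    by rewrite mem_set.
  by rewrite memNset//= mul0r.
rewrite r0 esum_set1 ?lee_fin ?poisson_pmf_ge0// /poisson_pmf r0.
by [].
Qed.

Lemma cvg_monotone_integral d (T : measurableType d) (R : realType)
    (mu : {measure set T -> \bar R}) (D : set T) (g : (T -> \bar R)^nat)
    (f : T -> \bar R) : measurable D ->
  (forall n, measurable_fun D (g n)) -> (forall n x, D x -> (0 <= g n x)%E) ->
  (forall x, D x -> {homo g ^~ x : n m / (n <= m)%N >-> (n <= m)%E}) ->
  (forall x, D x -> g n x @[n --> \oo] --> f x) ->
  (\int[mu]_(x in D) g n x)%E @[n --> \oo] --> (\int[mu]_(x in D) f x)%E.
Proof.
move=> mD mg g0 gh gf.
have -> : (\int[mu]_(x in D) f x = \int[mu]_(x in D) limn (g ^~ x))%E.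
  by apply: eq_integral => x /set_mem Dx; apply/esym/cvg_lim => //; exact: gf.
exact: cvg_monotone_convergence.
Qed.

Section poisson_variable.
Context d (Omega : measurableType d) (R : realType) (P : probability Omega R).
Variables (N : Omega -> R) (r : R).
Hypothesis mN : measurable_fun setT N.
Hypothesis natN : forall w, N w \is a Num.nat.
Hypothesis r0 : 0 <= r.
Hypothesis PN : forall k : nat, P [set w | N w = k%:R] = poisson_prob r 0 [set k].

Let q k := r ^+ k / k`!%:R * expR (- r).
Let ind k (w : Omega) : R := \1_[set w | N w = k%:R] w.

Let mA k : measurable [set w | N w = k%:R].
Proof.
have := mN measurableT (measurable_set1 (k%:R : R)); rewrite setTI.
by congr measurable; apply/seteqP; split.
Qed.

Let mind k : measurable_fun setT (ind k).
Proof. exact: measurable_indic. Qed.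

Let iind k : P.-integrable setT (EFin \o ind k).
Proof.
apply: (@le_Rintegrable _ _ _ P _ _ _ (cst 1)) => //.
  exact: finite_measure_integrable_cst.
by move=> w _; rewrite /ind indicE; case: (_ \in _); rewrite ?normr1 ?normr0.
Qed.

Let Eind k : \int[P]_w ind k w = q k.
Proof.
rewrite -[RHS]/(fine (q k)%:E) -poisson_probE// -PN.
by rewrite /Rintegral /ind integral_indic ?setIT.
Qed.

Let iZ (f : nat -> R) k : P.-integrable setT (EFin \o (fun w => f k * ind k w)).
Proof. exact: RintegrableZ. Qed.

Let isum (f : nat -> R) n :
  P.-integrable setT (EFin \o (fun w => \sum_(k < n) f k * ind k w)).
Proof.
by have [] := Rintegral_sum_ord (f := fun (k : 'I_n) w => f k * ind k w) measurableT
  (fun k => iZ f k).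
Qed.

Let Esum (f : nat -> R) n :
  \int[P]_w (\sum_(k < n) f k * ind k w) = \sum_(k < n) f k * q k.
Proof.
have [_ ->] := Rintegral_sum_ord (f := fun (k : 'I_n) w => f k * ind k w) measurableT
  (fun k => iZ f k).
by apply: eq_bigr => k _; rewrite RintegralZl// Eind.
Qed.

Let sum_ind (f : nat -> R) n w : \sum_(k < n) f k * ind k w =
  if (Num.trunc (N w) < n)%N then f (Num.trunc (N w)) else 0.
Proof.
have NE : N w = (Num.trunc (N w))%:R by have := natN w; rewrite natrEtruncn => /eqP.
have indE k : ind k w = (k == Num.trunc (N w))%:R.
  rewrite /ind indicE; congr (_%:R); congr nat_of_bool.
  apply/idP/eqP => [|->]; last by rewrite inE /= -NE.
  by rewrite inE /= => ->; rewrite natrK.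
case: ifPn => [jn|jn].
  rewrite (bigD1 (Ordinal jn)) //= indE eqxx mulr1 big1 ?addr0// => i ij.
  by rewrite indE (_ : (_ == _) = false) ?mulr0//; apply/negbTE.
rewrite big1// => i _; rewrite indE (_ : (_ == _) = false) ?mulr0//.
by apply/negbTE; apply: contra jn => /eqP <-.
Qed.

Let cvg_q : \sum_(k < n) q k @[n --> \oo] --> (1 : R).
Proof.
have := @cvg_exp_trig_sum R 0 0 r r0.
rewrite cos0 sin0 mulr0 addr0 cos0 !mulr1 => h.
have -> : 1 = expR r * expR (- r) by rewrite -expRD subrr expR0.
rewrite (_ : (fun n => _) = (fun n => exp_trig_sum 0 n 0 r * expR (- r))).
  by apply: cvgM => //; exact: cvg_cst.
apply/funext => n; rewrite /exp_trig_sum mulr_suml; apply: eq_bigr => k _.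
by rewrite mul0r addr0 cos0 mul1r.
Qed.

(** The events [N = k] exhaust the space, so the truncated sum misses at most
    the remaining mass. *)
Lemma poisson_expectation_bounded (f : R -> R) : measurable_fun setT f ->
  (forall x, `|f x| <= 1) ->
  \sum_(k < n) f k%:R * q k @[n --> \oo] --> \int[P]_w f (N w).
Proof.
move=> mf f1.
have mfN : measurable_fun setT (fun w => f (N w)) by exact: measurableT_comp.
have ifN : P.-integrable setT (EFin \o (fun w => f (N w))).
  apply: (@le_Rintegrable _ _ _ P _ _ _ (cst 1)) => //.
  exact: finite_measure_integrable_cst.
have i1 : P.-integrable setT (EFin \o (cst (1 : R))).
  exact: finite_measure_integrable_cst.
apply/subr_cvg0; apply: norm_cvg0.
apply: (@squeeze_cvgr _ _ _ _ (cst 0) (fun n => 1 - \sum_(k < n) q k)).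
- apply: nearW => n; rewrite normr_ge0 /= distrC.
  have -> : 1 - \sum_(k < n) q k = \int[P]_w (1 - \sum_(k < n) 1 * ind k w).
    rewrite (RintegralB measurableT i1 (isum (fun=> 1) n)) Rintegral_cst//=.
    rewrite (Esum (fun=> 1)) probability_setT mulr1; congr (_ - _); by apply: eq_bigr => k _; rewrite mul1r.
  rewrite -(Esum (fun k => f k%:R)).
  rewrite -(RintegralB measurableT ifN (isum (fun k => f k%:R) n)).
  have ifs := RintegrableB measurableT ifN (isum (fun k => f k%:R) n).
  have i1s := RintegrableB measurableT i1 (isum (fun=> 1) n).
  apply: (norm_Rintegral_le measurableT ifs i1s).
  move=> w _; rewrite (sum_ind (fun k => f k%:R)) (sum_ind (fun=> 1)).
  have NE : N w = (Num.trunc (N w))%:R by have := natN w; rewrite natrEtruncn => /eqP.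
  by case: ifP => _; rewrite -?NE ?subrr ?normr0// !subr0.
- exact: cvg_cst.
- by rewrite -[X in _ --> X](subrr (1:R)); apply: cvgB => //; exact: cvg_cst.
Qed.

(** The characteristic function of the Poisson law in real form. The free
    phase covers cosine and sine at once. *)
Lemma poisson_trig_shift c d' :
  \int[P]_w cos (c * N w + d') = expR (- (r * (1 - cos c))) * cos (r * sin c + d').
Proof.
have h := @poisson_expectation_bounded (fun x => cos (c * x + d')) _ _.
apply: (@cvg_unique _ (@Rhausdorff R) _ _ _ _ (h _ _)).
- apply: continuous_measurable_fun => x.
  by apply: continuous_of_is_derive; derive_rules.
- by move=> x; rewrite ler_norml cos_geN1 cos_le1.
have := @cvg_exp_trig_sum R c d' r r0 => g.
rewrite (_ : expR _ * _ = expR (r * cos c) * cos (r * sin c + d') * expR (- r)).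
  rewrite (_ : (fun n => _) = (fun n => exp_trig_sum c n d' r * expR (- r))).
    by apply: cvgM => //; exact: cvg_cst.
  by apply/funext => n; rewrite /exp_trig_sum mulr_suml; apply: eq_bigr => k _; rewrite /q !mulrA.
by rewrite mulrAC -expRD; congr (expR _ * _); ring.
Qed.

Lemma poisson_cos c : \int[P]_w cos (c * N w) =
  expR (- (r * (1 - cos c))) * cos (r * sin c).
Proof. by have := poisson_trig_shift c 0; under eq_Rintegral do rewrite addr0; rewrite addr0. Qed.

Lemma poisson_sin c : \int[P]_w sin (c * N w) =
  expR (- (r * (1 - cos c))) * sin (r * sin c).
Proof.
have sE (x : R) : sin x = cos (x + - (pi / 2)) by rewrite cosB cos_pihalf sin_pihalf mulr0 mulr1 add0r.
by under eq_Rintegral do rewrite sE; rewrite poisson_trig_shift -sE.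
Qed.

Lemma poisson_mean_variable : (\int[P]_w (N w)%:E = r%:E)%E.
Proof.
have h n : (\int[P]_w (\sum_(k < n) k%:R * ind k w)%:E = (\sum_(k < n) k%:R * q k)%:E)%E.
  rewrite -(Esum (fun k => k%:R)) /Rintegral fineK//.
  exact: (integrable_fin_num measurableT (isum (fun k => k%:R) n)).
have c1 : (\int[P]_w (\sum_(k < n) k%:R * ind k w)%:E)%E @[n --> \oo] -->
    (\int[P]_w (N w)%:E)%E.
  apply: cvg_monotone_integral => //.
  - by move=> n; apply/measurable_EFinP; exact: Rintegrable_measurable (isum _ n).
  - by move=> n w _; rewrite lee_fin sumr_ge0// => k _; rewrite mulr_ge0// /ind indicE.
  - move=> w _ m n mn; rewrite lee_fin !(sum_ind (fun k => k%:R)).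
    case: ifP => [jm|_]; first by rewrite (leq_trans jm mn).
    by case: ifP.
  - move=> w _; apply: cvg_EFin; first exact: nearW.
    apply: cvg_near_cst; exists (Num.trunc (N w)).+1 => // n /= jn.
    rewrite (sum_ind (fun k => k%:R)) jn.
    by have := natN w; rewrite natrEtruncn => /eqP.
have c2 : (\sum_(k < n.+1) k%:R * q k)%:E @[n --> \oo] --> r%:E.
  apply: cvg_EFin; first exact: nearW.
  rewrite (_ : _ \o _ = (fun n => r * \sum_(k < n) q k)).
    by rewrite -[X in _ --> X]mulr1; apply: cvgM => //; exact: cvg_cst.
  apply/funext => n /=; rewrite big_ord_recl /= mul0r add0r mulr_sumr.
  apply: eq_bigr => k _; rewrite /q /bump /= add1n factS natrM exprS.
  have f0 : k`!%:R != 0 :> R by rewrite pnatr_eq0 -lt0n fact_gt0.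
  have k0 : k.+1%:R != 0 :> R by rewrite pnatr_eq0.
  by move: k0 f0 (expR _) (r ^+ k); move: k.+1%:R k`!%:R => a b a0 b0 y z; field; rewrite b0.
apply: (@cvg_unique _ _ _ _ _ _ c1) => //=.
under eq_fun do rewrite h.
by move: c2; rewrite (cvg_shiftS (fun n => (\sum_(k < n) k%:R * q k)%:E)).
Qed.

End poisson_variable.

(** * Independence and trigonometric moments of sums *)

Section grid_approx.
Context {R : realType}.
Variable N : nat.
Hypothesis N0 : (0 < N)%N.

Let cell (k : nat) : set R := `[k%:R / N%:R - 1, k.+1%:R / N%:R - 1[%classic.

(** Rounds a point of [-1, 1] down to a multiple of [1 / N]; being a finite
    sum of indicators of Borel sets, it reduces statements on bounded
    functions of [f] to events about [f]. *)
Definition grid_step (x : R) : R :=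
  \sum_(k < (2 * N).+1) (k%:R / N%:R - 1) * \1_(cell k) x.

Lemma grid_step_error (x : R) : `|x| <= 1 -> `|x - grid_step x| <= N%:R^-1.
Proof.
move=> x1; have Np : 0 < N%:R :> R by rewrite ltr0n.
have [xm xp] : -1 <= x /\ x <= 1 by move: x1; rewrite ler_norml => /andP.
pose j := Num.trunc (N%:R * (x + 1)).
have y0 : 0 <= N%:R * (x + 1) by apply: mulr_ge0; [exact: ltW | lra].
have /andP[j1 j2] := truncn_itv y0.
rewrite -/j in j1 j2.
have jN : (j < (2 * N).+1)%N.
  rewrite ltnS -(ler_nat R) (le_trans j1)// natrM mulrC ler_wpM2r ?(ltW Np)//; lra.
have jx1 : j%:R / N%:R - 1 <= x by rewrite lerBlDr ler_pdivrMr// mulrC.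
have jx2 : x < j.+1%:R / N%:R - 1 by rewrite ltrBrDr ltr_pdivlMr// mulrC.
have cellE k : \1_(cell k) x = (k == j)%:R :> R.
  rewrite indicE; congr (_%:R); congr nat_of_bool; apply/idP/eqP => [|->]; last first.
    by rewrite inE /cell /= in_itv/= jx1.
  rewrite inE /cell /= in_itv/= => /andP[k1 k2]; apply/esym/truncn_def.
  move: k1 k2; rewrite lerBlDr ler_pdivrMr// mulrC => ->.
  by rewrite ltrBrDr ltr_pdivlMr// mulrC => ->.
have -> : grid_step x = j%:R / N%:R - 1.
  rewrite /grid_step (bigD1 (Ordinal jN))//= cellE eqxx mulr1 big1 ?addr0// => i ij.
  by rewrite cellE (_ : (_ == _) = false) ?mulr0//; apply/negbTE.
rewrite ger0_norm ?subr_ge0//.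
by move: jx2; rewrite -natr1 mulrDl mul1r; lra.
Qed.

End grid_approx.

Lemma measurable_bigsum d (T : measurableType d) (R : realType) (I : Type)
    (r : seq I) (Q : pred I) (f : I -> T -> R) :
  (forall i, measurable_fun setT (f i)) ->
  measurable_fun setT (fun w => \sum_(i <- r | Q i) f i w).
Proof.
by move=> mf; under eq_fun do rewrite -big_filter; exact: measurable_sum.
Qed.

Lemma measurable_bigprod d (T : measurableType d) (R : realType) (I : eqType)
    (r : seq I) (Q : pred I) (f : I -> T -> R) :
  (forall i, measurable_fun setT (f i)) ->
  measurable_fun setT (fun w => \prod_(i <- r | Q i) f i w).
Proof.
move=> mf; under eq_fun do rewrite -big_filter.
by apply: measurable_prod => i _; exact: mf.
Qed.

Section independence.
Context d (Omega : measurableType d) (R : realType) (P : probability Omega R).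

Lemma bounded1_Rintegrable (f : Omega -> R) :
  measurable_fun setT f -> (forall w, `|f w| <= 1) -> P.-integrable setT (EFin \o f).
Proof. exact: probability_Rintegrable. Qed.

Lemma norm_expectation_le (f : Omega -> R) (e : R) :
  P.-integrable setT (EFin \o f) -> (forall w, `|f w| <= e) ->
  `|\int[P]_w f w| <= e.
Proof.
move=> fi fe; have -> : e = \int[P]_w cst e w.
  by rewrite Rintegral_cst//= probability_setT mulr1.
by apply: norm_Rintegral_le => //; exact: finite_measure_integrable_cst.
Qed.

(** Independence of events extends to bounded functions: uniformly approximate
    [f] by [grid_step N \o f], a combination of indicators of events about
    [f]. *)
Lemma expectation_factor (f h : Omega -> R) (c : R) :
  measurable_fun setT f -> measurable_fun setT h ->
  (forall w, `|f w| <= 1) -> (forall w, `|h w| <= 1) ->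
  (forall B : set R, measurable B -> \int[P]_w (\1_(f @^-1` B) w * h w) =
     \int[P]_w \1_(f @^-1` B) w * c) ->
  \int[P]_w (f w * h w) = \int[P]_w f w * c.
Proof.
move=> mf mh f1 h1 fact; apply/eqP; rewrite -subr_eq0 -normr_le0.
apply/ler_addgt0Pr => e e0; rewrite add0r.
pose N := (Num.trunc ((1 + `|c|) / e)).+1.
have Np : 0 < N%:R :> R by rewrite ltr0n.
have N0 : (0 < N)%N by [].
pose g w := grid_step N (f w).
have mind B : measurable B -> measurable_fun setT (\1_(f @^-1` B) : Omega -> R).
  by move=> mB; apply: measurable_indic; rewrite -[X in measurable X]setTI; exact: mf.
have ind1 (B : set Omega) w : `|\1_B w : R| <= 1.
  by rewrite indicE; case: (_ \in _); rewrite ?normr1 ?normr0.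
pose B k : set R := `[k%:R / N%:R - 1, k.+1%:R / N%:R - 1[%classic.
have mB k : measurable (B k) by exact: measurable_itv.
have gE w : g w = \sum_(k < (2 * N).+1) (k%:R / N%:R - 1) * \1_(f @^-1` B k) w.
  by apply: eq_bigr => k _; rewrite !indicE.
have i1 (k : 'I_(2 * N).+1) : P.-integrable setT
    (EFin \o (fun w => (k%:R / N%:R - 1) * \1_(f @^-1` B k) w)).
  apply: RintegrableZ => //; apply: bounded1_Rintegrable => //; exact: mind.
have i2' (k : 'I_(2 * N).+1) : P.-integrable setT
    (EFin \o (fun w => \1_(f @^-1` B k) w * h w)).
  apply: bounded1_Rintegrable; first by apply: measurable_funM => //; exact: mind.
  by move=> w; rewrite normrM mulr_ile1.
have i2 (k : 'I_(2 * N).+1) : P.-integrable setT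
    (EFin \o (fun w => (k%:R / N%:R - 1) * (\1_(f @^-1` B k) w * h w))).
  exact: RintegrableZ.
have [ig Eg] := Rintegral_sum_ord measurableT i1.
have [igh Egh] := Rintegral_sum_ord measurableT i2.
have {}ig : P.-integrable setT (EFin \o g).
  by move: ig; congr (_.-integrable _ (_ \o _)); apply/funext => w; rewrite gE.
have {}igh : P.-integrable setT (EFin \o (fun w => g w * h w)).
  move: igh; congr (_.-integrable _ (_ \o _)); apply/funext => w.
  by rewrite gE mulr_suml; apply: eq_bigr => k _; rewrite mulrA.
have gh : \int[P]_w (g w * h w) = \int[P]_w g w * c.
  under eq_Rintegral do rewrite gE mulr_suml.
  under [in RHS]eq_Rintegral do rewrite gE.
  rewrite Eg mulr_suml.
  under eq_Rintegral do under eq_bigr do rewrite -mulrA.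
  rewrite Egh; apply: eq_bigr => k _; rewrite !RintegralZl//; last first.
    by apply: bounded1_Rintegrable => //; exact: mind.
  by rewrite fact// mulrA.
have ifi := bounded1_Rintegrable mf f1.
have ifh : P.-integrable setT (EFin \o (fun w => f w * h w)).
  apply: bounded1_Rintegrable; first exact: measurable_funM.
  by move=> w; rewrite normrM mulr_ile1.
have -> : \int[P]_w (f w * h w) - \int[P]_w f w * c =
    \int[P]_w (f w * h w - g w * h w) - \int[P]_w (f w - g w) * c.
  by rewrite !RintegralB// gh; ring.
have fg w : `|f w - g w| <= N%:R^-1 by exact: grid_step_error.
apply: (@le_trans _ _ (N%:R^-1 + N%:R^-1 * `|c|)).
  rewrite (le_trans (ler_normB _ _))// lerD//.
    apply: norm_expectation_le; first exact: RintegrableB.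
    by move=> w; rewrite -mulrBl normrM (le_trans _ (fg w))// ler_piMr.
  rewrite normrM ler_wpM2r//; apply: norm_expectation_le => //.
  exact: RintegrableB.
rewrite -[X in X + _]mulr1 -mulrDr mulrC ler_pdivrMr// mulrC -ler_pdivrMr//.
by rewrite ltW// truncnS_gt.
Qed.

Section product_rule.
Variables (n : nat) (F : 'I_n -> set_system Omega).
Hypothesis indF : independent_systems P F.
Hypothesis F_measurable : forall i A, F i A -> measurable A.
Hypothesis F_set0 : forall i, F i set0.
Hypothesis F_setT : forall i, F i setT.

(** Measurability of [f] for the system [F i], which is a bare system of sets
    rather than a measurable structure on [Omega]. *)
Definition adapted (i : 'I_n) (f : Omega -> R) :=
  forall B, measurable B -> F i (f @^-1` B).

Lemma adapted_measurable i f : adapted i f -> measurable_fun setT f.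
Proof. by move=> fi _ B mB; rewrite setTI; apply: (@F_measurable i); exact: fi. Qed.

Lemma adapted_comp i f (phi : R -> R) : measurable_fun setT phi ->
  adapted i f -> adapted i (fun w => phi (f w)).
Proof.
move=> mphi fi B mB; have := fi (phi @^-1` B); apply.
by rewrite -[X in measurable X]setTI; exact: mphi.
Qed.

Lemma prod_norm_le1 (f : 'I_n -> Omega -> R) (Q : pred 'I_n) w :
  (forall i w, `|f i w| <= 1) -> `|\prod_(i | Q i) f i w| <= 1.
Proof.
move=> f1; rewrite normr_prod; apply: prodr_ile1 => i _.
by rewrite normr_ge0 f1.
Qed.

Lemma measurable_prod_fun (f : 'I_n -> Omega -> R) (Q : pred 'I_n) :
  (forall i, measurable_fun setT (f i)) ->
  measurable_fun setT (fun w => \prod_(i | Q i) f i w).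
Proof. by move=> mf; exact: measurable_bigprod. Qed.

(** The factors are replaced by indicators one at a time with
    [expectation_factor]; when all of them are indicators, this is the product
    rule for events. *)
Lemma expectation_prod (f : 'I_n -> Omega -> R) :
  (forall i, adapted i (f i)) -> (forall i w, `|f i w| <= 1) ->
  \int[P]_w (\prod_i f i w) = \prod_i \int[P]_w f i w.
Proof.
move=> fa f1.
have ind_ok (B : set Omega) w : `|\1_B w : R| <= 1.
  by rewrite indicE; case: (_ \in _); rewrite ?normr1 ?normr0.
(* Induction on the number [k] of factors that are not yet known to be
   indicators. *)
suff H (k : nat) : forall f : 'I_n -> Omega -> R,
    (forall i, adapted i (f i)) -> (forall i w, `|f i w| <= 1) ->
    (forall i : 'I_n, (k <= i)%N -> exists2 A, F i A & f i = \1_A) ->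
    \int[P]_w (\prod_i f i w) = \prod_i \int[P]_w f i w.
  by apply: (H n) => // i; rewrite leqNgt ltn_ord.
elim: k => {f fa f1} [|k IHk] f fa f1 fk.
  have /choice[A hA] : forall i, exists A, F i A /\ f i = \1_A.
    by move=> i; have [A FA fA] := fk i isT; exists A.
  have mA i : measurable (A i) by apply: (@F_measurable i); have [] := hA i.
  have h := @indF (finset.finset (fun _ : 'I_n => true)) A (fun i _ => (hA i).1).
  have -> : \int[P]_w (\prod_i f i w) = fine (P (\bigcap_(i in [set` finset.finset (fun _ : 'I_n => true)]) A i)).
    rewrite -[X in P X]setIT -integral_indic//; last first.
      by apply: fin_bigcap_measurable => //; exact: finite_finset.
    apply: eq_Rintegral => w _; rewrite indicE.
    case: (boolP (w \in _)) => [/set_mem wA|wA].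
      rewrite big1// => i _; have [_ ->] := hA i.
      by rewrite indicE mem_set//; apply: wA => /=; rewrite inE.
    have [i wi] : exists i, ~ A i w.
      apply/existsNP => h'; move/negP: wA; apply; apply/mem_set => i _; exact: h'.
    rewrite (bigD1 i)//=; have [_ ->] := hA i.
    by rewrite indicE memNset// mul0r.
  rewrite h (_ : (\prod_(i in finset.finset (fun _ : 'I_n => true)) P (A i))%E =
      (\prod_i \int[P]_w f i w)%:E)//.
  rewrite (big_morph EFin EFinM erefl); apply: eq_big => [i|i _]; first by rewrite inE.
  have [_ ->] := hA i.
  rewrite /Rintegral integral_indic// setIT fineK//.
  exact: fin_num_measure.
have [kn|nk] := ltnP k n; last first.
  by apply: IHk => // i ki; have := ltn_ord i; rewrite ltnNge (leq_trans nk ki).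
pose i0 := Ordinal kn.
pose h w := \prod_(i | i != i0) f i w.
have mf i : measurable_fun setT (f i) by exact: adapted_measurable (fa i).
have -> : \int[P]_w (\prod_i f i w) = \int[P]_w (f i0 w * h w).
  by apply: eq_Rintegral => w _; rewrite (bigD1 i0).
rewrite (bigD1 i0)//=; apply: expectation_factor => //.
- exact: measurable_prod_fun.
- by move=> w; exact: prod_norm_le1.
move=> B mB; pose f' i := if i == i0 then \1_(f i0 @^-1` B) else f i.
have := IHk f' _ _ _; rewrite (bigD1 i0)//= /f' eqxx.
rewrite (eq_bigr (fun i => \int[P]_w f i w)); last first.
  by move=> i ii0; apply: eq_Rintegral => w _; rewrite (negbTE ii0).
move=> <-.
- apply: eq_Rintegral => w _; rewrite (bigD1 i0)//= eqxx; congr (_ * _).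
  by apply: eq_bigr => i ii0; rewrite (negbTE ii0).
- move=> i; case: eqP => [->|_]; last exact: fa.
  move=> C mC.
  apply: (adapted_comp (phi := \1_B) _ (fa i0)) mC.
  exact: measurable_indic.
- by move=> i w; case: ifP.
- move=> i ki; case: eqP => [->|ii0].
    by exists (f i0 @^-1` B) => //; exact: fa.
  apply: fk; rewrite ltn_neqAle ki andbT; apply: contra_not_neq ii0 => e.
  exact: val_inj.
Qed.

(** The moduli multiply and the arguments add. This is the multiplicativity of
    characteristic functions, kept in real form: the addition formulas move
    one variable at a time from the product into the sum. *)
Lemma independent_trig (U : 'I_n -> Omega -> R) (a b : 'I_n -> R) :
  (forall i, adapted i (U i)) ->
  (forall i, \int[P]_w cos (U i w) = expR (- a i) * cos (b i)) ->
  (forall i, \int[P]_w sin (U i w) = expR (- a i) * sin (b i)) ->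
  \int[P]_w cos (\sum_i U i w) = expR (- \sum_i a i) * cos (\sum_i b i) /\
  \int[P]_w sin (\sum_i U i w) = expR (- \sum_i a i) * sin (\sum_i b i).
Proof.
move=> Ua Uc Us.
have mcos : measurable_fun setT (@cos R).
  by apply: continuous_measurable_fun => x; exact: continuous_cos.
have msin : measurable_fun setT (@sin R).
  by apply: continuous_measurable_fun => x; exact: continuous_sin.
have cos1 (x : R) : `|cos x| <= 1 by rewrite ler_norml cos_geN1 cos_le1.
have sin1 (x : R) : `|sin x| <= 1 by rewrite ler_norml sin_geN1 sin_le1.
pose S k w := \sum_(i < n | (i < k)%N) U i w.
have mS k : measurable_fun setT (S k).
  by apply: measurable_bigsum => i; exact: adapted_measurable (Ua i).
pose ok (f : 'I_n -> Omega -> R) :=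
  (forall i, adapted i (f i)) /\ (forall i w, `|f i w| <= 1).
(* The first [k] variables are already gathered under one [cos] or [sin]; the
   remaining factors are arbitrary bounded adapted functions, so that the
   addition formulas can be applied again. *)
have H k (f : 'I_n -> Omega -> R) : (k <= n)%N -> ok f ->
   \int[P]_w (cos (S k w) * \prod_(i < n | (k <= i)%N) f i w) =
     expR (- \sum_(i < n | (i < k)%N) a i) * cos (\sum_(i < n | (i < k)%N) b i) *
       \prod_(i < n | (k <= i)%N) \int[P]_w f i w /\
   \int[P]_w (sin (S k w) * \prod_(i < n | (k <= i)%N) f i w) =
     expR (- \sum_(i < n | (i < k)%N) a i) * sin (\sum_(i < n | (i < k)%N) b i) *
       \prod_(i < n | (k <= i)%N) \int[P]_w f i w.
  elim: k f => [|k IHk] f kn [fa f1].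
    have z (V : 'I_n -> R) : \sum_(i < n | (i < 0)%N) V i = 0 by rewrite big_pred0.
    rewrite !z oppr0 expR0 cos0 sin0 mulr0 !mul0r mul1r mul1r.
    split.
      rewrite -expectation_prod//; apply: eq_Rintegral => w _.
      by rewrite /S z cos0 mul1r.
    have -> : 0 = \int[P]_w cst 0 w by rewrite Rintegral_cst// mul0r.
    by apply: eq_Rintegral => w _; rewrite /S big_pred0// sin0 mul0r.
  pose i0 := Ordinal kn.
  have sumS (V : 'I_n -> R) : \sum_(i < n | (i < k.+1)%N) V i =
      V i0 + \sum_(i < n | (i < k)%N) V i.
    rewrite (bigD1 i0) ?ltnS//=; congr (_ + _); apply: eq_bigl => i.
    by rewrite ltnS [RHS]ltn_neqAle andbC.
  have prodS (V : 'I_n -> R) : \prod_(i < n | (k <= i)%N) V i =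
      V i0 * \prod_(i < n | (k.+1 <= i)%N) V i.
    rewrite (bigD1 i0)//=; congr (_ * _); apply: eq_bigl => i.
    by rewrite [RHS]ltn_neqAle andbC eq_sym.
  pose upd g i := if i == i0 then g else f i.
  have updE g (Q : (Omega -> R) -> R) : \prod_(i < n | (k.+1 <= i)%N) Q (upd g i) =
      \prod_(i < n | (k.+1 <= i)%N) Q (f i).
    apply: eq_bigr => i ki; rewrite /upd ifN//.
    by apply: contraTneq ki => ->; rewrite /= ltnn.
  have okc : ok (upd (fun w => cos (U i0 w))).
    by split=> i; rewrite /upd; case: eqP => [ii0|_] //; rewrite ii0; exact: adapted_comp.
  have oks : ok (upd (fun w => sin (U i0 w))).
    by split=> i; rewrite /upd; case: eqP => [ii0|_] //; rewrite ii0; exact: adapted_comp.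
  have mp g : ok g -> measurable_fun setT (fun w => \prod_(i < n | (k <= i)%N) g i w).
    by move=> [ga _]; apply: measurable_prod_fun => i; exact: adapted_measurable (ga i).
  have int g (phi : R -> R) : ok g -> measurable_fun setT phi -> (forall x : R, `|phi x| <= 1) ->
      P.-integrable setT
        (EFin \o (fun w => phi (S k w) * \prod_(i < n | (k <= i)%N) g i w)).
    move=> okg mphi phi1; apply: bounded1_Rintegrable.
      apply: measurable_funM; last exact: mp.
      exact: (measurableT_comp mphi (mS k)).
    by move=> w; rewrite normrM mulr_ile1//; apply: prod_norm_le1; case: okg.
  have [cc sc] := IHk _ (ltnW kn) okc; have [cs ss] := IHk _ (ltnW kn) oks.
  have PE g w : \prod_(i < n | (k <= i)%N) upd g i w =
      g w * \prod_(i < n | (k.+1 <= i)%N) f i w.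
    by rewrite prodS (updE g (fun f => f w)) /upd eqxx.
  have IE g : \prod_(i < n | (k <= i)%N) \int[P]_w upd g i w =
      \int[P]_w g w * \prod_(i < n | (k.+1 <= i)%N) \int[P]_w f i w.
    by rewrite prodS (updE g (fun f => \int[P]_w f w)) /upd eqxx.
  rewrite !IE Uc Us in cc sc cs ss.
  have SE w : S k.+1 w = U i0 w + S k w by rewrite /S sumS.
  rewrite !sumS opprD expRD cosD sinD.
  split.
    transitivity (\int[P]_w (
        cos (S k w) * \prod_(i < n | (k <= i)%N) upd (fun w => cos (U i0 w)) i w -
        sin (S k w) * \prod_(i < n | (k <= i)%N) upd (fun w => sin (U i0 w)) i w)).
      by apply: eq_Rintegral => w _; rewrite SE cosD !PE; ring.
    rewrite (RintegralB measurableT (int _ _ okc mcos cos1) (int _ _ oks msin sin1)).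
    by rewrite cc ss; ring.
  transitivity (\int[P]_w (
      cos (S k w) * \prod_(i < n | (k <= i)%N) upd (fun w => sin (U i0 w)) i w +
      sin (S k w) * \prod_(i < n | (k <= i)%N) upd (fun w => cos (U i0 w)) i w)).
    by apply: eq_Rintegral => w _; rewrite SE sinD !PE; ring.
  rewrite (RintegralD measurableT (int _ _ oks mcos cos1) (int _ _ okc msin sin1)).
  by rewrite cs sc; ring.
have f0 : ok (fun _ _ => 1).
  split=> [i B mB|i w]; last by rewrite normr1.
  rewrite preimage_cst; case: ifP => _; first exact: F_setT.
  exact: F_set0.
have [] := H n (fun _ _ => 1) (leqnn n) f0.
have sT (V : 'I_n -> R) : \sum_(i < n | (i < n)%N) V i = \sum_i V i.
  by apply: eq_bigl => i; rewrite ltn_ord.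
have pT (V : 'I_n -> R) : \prod_(i < n | (n <= i)%N) V i = 1.
  by rewrite big_pred0// => i; rewrite leqNgt ltn_ord.
rewrite !sT (pT (fun=> \int[P]_w 1)) (pT (fun=> 1)) => h1 h2.
rewrite mulr1 in h1; rewrite mulr1 in h2.
by rewrite -h1 -h2; split; apply: eq_Rintegral => w _; rewrite mulr1 /S sT.
Qed.

End product_rule.
End independence.

(** * Measurability of integrals against the jumps of a process *)

Lemma lebesgue_stieltjes_measure_ocitv (R : realType) (f : cumulative R R) (a b : R) :
  a <= b -> lebesgue_stieltjes_measure f `]a, b] = (f b - f a)%:E.
Proof.
move=> ab; rewrite /lebesgue_stieltjes_measure /measure_extension/=.
rewrite measurable_mu_extE/=; first by rewrite wlength_itv_bnd.
by exists (a, b).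
Qed.

Section borel_induction.
Import HBSimple HBNNSimple.
Context {R : realType}.

(** Dynkin's lemma for the half-open intervals, which are stable under
    intersection. *)
Lemma borel_set_induction (H : set (set R)) :
  (forall a b : R, H `]a, b]%classic) -> H setT ->
  (forall A B, measurable A -> measurable B -> B `<=` A -> H A -> H B -> H (A `\` B)) ->
  (forall F : (set R)^nat, nondecreasing_seq F -> (forall n, measurable (F n)) ->
     (forall n, H (F n)) -> H (\bigcup_n F n)) ->
  forall A, measurable A -> H A.
Proof.
move=> Hitv HT HD HU A mA.
pose K := [set B : set R | measurable B /\ H B].
suff [] : K A by [].
apply: (@lambda_system_subset R (@ocitv R) (@ocitvI R) setT K) mA => //.
- split => //.
  + move=> B C CB [mB HB] [mC HC]; split; first exact: measurableD.
    exact: HD.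
  + move=> F ndF KF; split; first by apply: bigcupT_measurable => n; exact: (KF n).1.
    by apply: HU => // n; [exact: (KF n).1 | exact: (KF n).2].
- by move=> _ [[a b] _ <-]; split; [exact: measurable_itv | exact: Hitv].
Qed.

(** A nonnegative measurable function is an increasing limit of nonnegative
    simple functions. *)
Lemma borel_nonneg_induction (Q : (R -> \bar R) -> Prop) :
  Q (cst 0%E) ->
  (forall (x : R) (A : set R) (h : R -> \bar R), 0 <= x -> measurable A ->
     measurable_fun setT h -> (forall t, (0 <= h t)%E) -> Q h ->
     Q (fun t => (x%:E * (\1_A t)%:E + h t)%E)) ->
  (forall (g : (R -> \bar R)^nat) (h : R -> \bar R),
     (forall n, measurable_fun setT (g n)) -> (forall n t, (0 <= g n t)%E) ->
     (forall t, {homo g ^~ t : n m / (n <= m)%N >-> (n <= m)%E}) ->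
     (forall t, g n t @[n --> \oo] --> h t) -> (forall n, Q (g n)) -> Q h) ->
  forall h, measurable_fun setT h -> (forall t, (0 <= h t)%E) -> Q h.
Proof.
move=> Q0 QD Qlim h mh h0.
have Qs (f : {nnsfun (measurableTypeR R) >-> R}) : Q (fun t => (f t)%:E).
  pose s := finmap.enum_fset (fset_set (range f)).
  have fE t : (f t)%:E = (\sum_(y <- s) y%:E * (\1_(f @^-1` [set y]) t)%:E)%E.
    rewrite fimfunE fsbig_finite//= -/s.
    by rewrite -sumEFin; apply: eq_bigr => y _; rewrite EFinM.
  rewrite (_ : (fun t => _) = (fun t =>
    (\sum_(y <- s) y%:E * (\1_(f @^-1` [set y]) t)%:E)%E)); last exact/funext.
  have s0 y : y \in s -> 0 <= y.
    by rewrite /s in_fset_set// => /set_mem[t _ <-]; exact: fun_ge0.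
  have mf y : measurable (f @^-1` [set y] : set (measurableTypeR R)) by [].
  elim: {fE} s s0 => [|y s IH] s0.
    by rewrite (_ : (fun t => _) = cst 0%E)//; apply/funext => t; rewrite big_nil.
  rewrite (_ : (fun t => _) = (fun t => (y%:E * (\1_(f @^-1` [set y]) t)%:E +
     \sum_(y <- s) y%:E * (\1_(f @^-1` [set y]) t)%:E)%E)); last first.
    by apply/funext => t; rewrite big_cons.
  have s0' z : z \in s -> 0 <= z by move=> zs; apply: s0; rewrite in_cons zs orbT.
  apply: QD => //.
  - by apply: s0; rewrite mem_head.
  - exact: mf.
  - apply: emeasurable_sum => z; apply/measurable_EFinP.
    by apply: measurable_funM => //; apply: measurable_indic; exact: mf.
  - move=> t; rewrite big_seq; apply: sume_ge0 => z zs.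
    by rewrite -EFinM lee_fin mulr_ge0// ?s0'// indicE.
  - exact: IH.
apply: (Qlim (fun n t => (@nnsfun_approx _ (measurableTypeR R) R setT measurableT h mh n t)%:E)) => //.
- move=> n; apply/measurable_EFinP.
  move=> _ B mB; rewrite setTI; move: (nnsfun_approx _ _ _) => f.
  by have := @measurable_funPT _ _ (measurableTypeR R) R f measurableT B mB; rewrite setTI.
- by move=> n t; rewrite lee_fin.
- move=> t n m nm; rewrite lee_fin.
  by have := @nd_nnsfun_approx _ (measurableTypeR R) R setT measurableT h mh _ _ nm => /lefP.
- by move=> t; exact: (@cvg_nnsfun_approx _ (measurableTypeR R) R setT measurableT h mh (fun x _ => h0 x) t I).
Qed.

End borel_induction.

Section measurability.
Context d (Omega : measurableType d) (R : realType) (tau : R).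
Variable X : Omega -> cumulative R R.
Hypothesis tau0 : 0 < tau.
Hypothesis mX : forall t, t \in `[0, tau] -> measurable_fun setT (fun w => X w t).
Local Notation D := (`]0, tau]%classic : set R).
Local Notation M w := (lebesgue_stieltjes_measure (X w)).

Lemma measurable_oc : measurable (D : set (measurableTypeR R)).
Proof. exact: measurable_itv. Qed.

Lemma jump_mass_fin w (A : set R) : measurable A -> M w (A `&` D) \is a fin_num.
Proof.
move=> mA; rewrite ge0_fin_numE//; apply: (@le_lt_trans _ _ (M w D)).
  apply: le_measure => //; apply: mem_set; last exact: measurable_oc.
  exact: (measurableI _ _ mA measurable_oc).
by rewrite lebesgue_stieltjes_measure_ocitv ?ltry// ltW.
Qed.

(** The intersection with [D] may be empty, whence the case distinction. *)
Lemma jump_mass_itv w a b : M w (`]a, b]%classic `&` D) =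
  (if Order.max a 0 <= Order.min b tau then
     X w (Order.min b tau) - X w (Order.max a 0) else 0)%:E.
Proof.
have -> : (`]a, b]%classic `&` D) = `]Order.max a 0, Order.min b tau]%classic.
  by apply/seteqP; split => t /=; rewrite !in_itv/= gt_max le_min;
    [move=> [/andP[-> ->] /andP[-> ->]] | move=> /andP[/andP[-> ->] /andP[-> ->]]].
case: ifPn => [h|]; first by rewrite lebesgue_stieltjes_measure_ocitv.
rewrite -ltNge => h.
by rewrite set_itv_ge ?measure0// bnd_simp -leNgt ltW.
Qed.

Lemma measurable_jump_mass A : measurable A ->
  measurable_fun setT (fun w => M w (A `&` D)).
Proof.
move: A; apply: (borel_set_induction (H := fun A => measurable_fun setT (fun w => M w (A `&` D)))).
- move=> a b; under eq_fun do rewrite jump_mass_itv.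
  apply/measurable_EFinP.
  case: (boolP (Order.max a 0 <= Order.min b tau)) => [h|_]; last exact: measurable_cst.
  have t1 : Order.min b tau \in `[0, tau].
    by rewrite in_itv/= ge_min lexx orbT andbT (le_trans _ h)// le_max lexx orbT.
  have t2 : Order.max a 0 \in `[0, tau].
    rewrite in_itv/= le_max lexx orbT/=.
    by move: t1; rewrite in_itv/= => /andP[_]; exact: le_trans.
  by apply: measurable_funB; exact: mX.
- under eq_fun do rewrite setTI lebesgue_stieltjes_measure_ocitv ?(ltW tau0)//.
  by apply/measurable_EFinP; apply: measurable_funB; apply: mX; rewrite in_itv/= ?lexx ?ltW.
- move=> A B mA mB BA hA hB.
  rewrite (_ : (fun w => _) = fun w => (M w (A `&` D) - M w (B `&` D))%E).
    exact: emeasurable_funB.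
  apply/funext => w.
  have mAD : measurable (A `&` D : set (measurableTypeR R)) by exact: (measurableI _ _ mA measurable_oc).
  have mBD : measurable (B `&` D : set (measurableTypeR R)) by exact: (measurableI _ _ mB measurable_oc).
  have -> : (A `\` B) `&` D = (A `&` D) `\` (B `&` D).
    apply/seteqP; split => t /=; first by move=> [[At Bt] Dt]; split => // -[].
    by move=> [[At Dt] BD]; split => //; split => // Bt; apply: BD.
  have fA : (M w (A `&` D) < +oo)%E by rewrite -ge0_fin_numE//; exact: jump_mass_fin.
  rewrite (measureD mAD mBD fA); congr (_ - M w _)%E.
  by apply/setIidr; exact: setSI.
- move=> F ndF mF hF.
  apply: (@emeasurable_fun_cvg _ _ _ _ (fun n w => M w (F n `&` D))) => // w _.
  rewrite setI_bigcupl; apply: nondecreasing_cvg_mu.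
  + by move=> n; exact: (measurableI _ _ (mF n) measurable_oc).
  + by apply: bigcupT_measurable => n; exact: (measurableI _ _ (mF n) measurable_oc).
  + move=> n m nm; apply/subsetPset; apply: setSI.
    by apply/subsetPset; exact: ndF.
Qed.

Lemma jump_integral_indic w (x : R) (A : set R) (h : R -> \bar R) :
  0 <= x -> measurable A -> measurable_fun setT h -> (forall t, (0 <= h t)%E) ->
  (\int[M w]_(t in D) (x%:E * (\1_A t)%:E + h t) =
   x%:E * M w (A `&` D) + \int[M w]_(t in D) h t)%E.
Proof.
move=> x0 mA mh h0.
have mi : measurable_fun D (fun t => (\1_A t : R)%:E).
  by apply/measurable_EFinP; exact: measurable_funTS (measurable_indic mA).
have mxi : measurable_fun D (fun t => (x%:E * (\1_A t : R)%:E)%E) by exact: emeasurable_funM.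
have i0 t : D t -> (0%R <= (\1_A t : R)%:E)%E by rewrite lee_fin indicE.
transitivity (\int[M w]_(t in D) (x%:E * (\1_A t)%:E) + \int[M w]_(t in D) h t)%E.
  apply: ge0_integralD => //.
    by move=> t Dt; rewrite mule_ge0 ?lee_fin ?i0.
  exact: measurable_funS mh.
congr (_ + _)%E; rewrite ge0_integralZl ?lee_fin//.
by rewrite integral_indic//; exact: measurable_oc.
Qed.

Lemma measurable_jump_integral (h : R -> \bar R) :
  measurable_fun setT h -> (forall t, (0 <= h t)%E) ->
  measurable_fun setT (fun w => (\int[M w]_(t in D) h t)%E).
Proof.
move: h; apply: (borel_nonneg_induction
  (Q := fun h => measurable_fun setT (fun w => (\int[M w]_(t in D) h t)%E))).
- by under eq_fun do rewrite /= integral0; exact: measurable_cst.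
- move=> x A h x0 mA mh h0 IH.
  under eq_fun do rewrite jump_integral_indic//.
  apply: emeasurable_funD => //; apply: emeasurable_funM => //.
  exact: measurable_jump_mass.
- move=> g h mg g0 ndg gh IH.
  apply: (@emeasurable_fun_cvg _ _ _ _ (fun n w => (\int[M w]_(t in D) g n t)%E)) => // w _.
  apply: cvg_monotone_integral => //.
  by move=> n; exact: measurable_funS (mg n).
Qed.

(** The measurable structure on [Omega] is arbitrary: it is also applied with
    the sigma-algebra generated by the process itself, which gives
    independence of the integrals of independent processes. *)
Lemma measurable_stochastic_integral (g : R -> R) :
  measurable_fun setT g -> measurable_fun setT (stochastic_integral tau g X).
Proof.
move=> mg; rewrite /stochastic_integral /Rintegral.
apply: measurableT_comp => //.
under eq_fun do rewrite integralE.
apply: emeasurable_funB; apply: measurable_jump_integral => //.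
- by apply: measurable_funepos; exact/measurable_EFinP.
- by apply: measurable_funeneg; exact/measurable_EFinP.
Qed.

End measurability.

(** * Campbell's formula *)

Section campbell.
Context d (Omega : measurableType d) (R : realType) (P : probability Omega R).
Variables (tau : R) (lambda : R -> R) (X : Omega -> cumulative R R).
Hypothesis tau0 : 0 < tau.
Hypothesis mlam : measurable_fun `[0, tau] lambda.
Hypothesis lam0 : forall t, t \in `[0, tau] -> 0 <= lambda t.
Hypothesis HX : is_poisson_process P tau lambda X.
Local Notation mu := (@lebesgue_measure R).
Local Notation D := (`]0, tau]%classic : set R).
Local Notation M w := (lebesgue_stieltjes_measure (X w)).

Lemma poisson_lambda_integrable : mu.-integrable `[0, tau] (EFin \o lambda).
Proof. by case: HX. Qed.

Lemma poisson_measurable t : t \in `[0, tau] -> measurable_fun setT (fun w => X w t).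
Proof. by case: HX => _ mX _ _ _; exact: mX. Qed.

Let DI : D `<=` `[0, tau].
Proof. exact: subset_itv_oc_cc. Qed.

Let mDlam : measurable_fun D lambda.
Proof. exact: measurable_funS mlam. Qed.

Let Dlam0 t : D t -> 0 <= lambda t.
Proof. by move=> /DI; exact: lam0. Qed.

Let iDlam : mu.-integrable D (EFin \o lambda).
Proof. by apply: integrableS poisson_lambda_integrable => //; exact: measurable_itv. Qed.

Lemma poisson_mean_itv s t : 0 <= s -> s <= t -> t <= tau ->
  (\int[mu]_(u in `]s, t]) (lambda u)%:E = (poisson_mean lambda s t)%:E)%E.
Proof.
move=> s0 st tt.
have sI : `[s, t] `<=` `[0, tau].
  by move=> u /=; rewrite !in_itv/= => /andP[su ut]; rewrite (le_trans s0 su) (le_trans ut tt).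
have i1 : mu.-integrable `[s, t] (EFin \o lambda).
  by apply: integrableS poisson_lambda_integrable => //; exact: measurable_itv.
rewrite /poisson_mean /Rintegral fineK; last exact: integrable_fin_num.
rewrite integral_itv_obnd_cbnd//.
apply/measurable_EFinP; apply: measurable_funS mlam => //.
by apply: subset_trans sI; exact: subset_itv_oc_cc.
Qed.

Lemma poisson_mean_ge0 s t : 0 <= s -> t <= tau -> 0 <= poisson_mean lambda s t.
Proof.
move=> s0 tt; apply: Rintegral_ge0 => u /=; rewrite in_itv/= => /andP[su ut].
by apply: lam0; rewrite in_itv/= (le_trans s0 su) (le_trans ut tt).
Qed.

Lemma poisson_increment_nat s t w : 0 <= s -> s <= t -> t <= tau ->
  X w t - X w s \is a Num.nat.
Proof.
move=> s0 st tt; have [_ _ /(_ w)[_ natX] _ _] := HX.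
have s1 : X w s \is a Num.nat by apply: natX; rewrite in_itv/= s0 (le_trans st).
have t1 : X w t \is a Num.nat by apply: natX; rewrite in_itv/= tt andbT (le_trans s0).
have st1 : X w s <= X w t by exact: cumulative_is_nondecreasing.
move: s1 t1 st1 => /natrP[i ->] /natrP[j ->]; rewrite ler_nat => ij.
by rewrite -natrB// natr_nat.
Qed.

Lemma poisson_increment_measurable s t : 0 <= s -> s <= t -> t <= tau ->
  measurable_fun setT (fun w => X w t - X w s).
Proof.
move=> s0 st tt; apply: measurable_funB; apply: poisson_measurable; rewrite in_itv/=.
  by rewrite tt andbT (le_trans s0).
by rewrite s0 (le_trans st).
Qed.

Lemma poisson_increment_prob s t : 0 <= s -> s <= t -> t <= tau -> forall k : nat,
  P [set w | X w t - X w s = k%:R] = poisson_prob (poisson_mean lambda s t) 0 [set k].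
Proof. by move=> s0 st tt k; have [_ _ _ h _] := HX; exact: h. Qed.

Let G (h : R -> \bar R) := (\int[P]_w \int[M w]_(t in D) h t)%E.
Let L (h : R -> \bar R) := (\int[mu]_(t in D) (h t * (lambda t)%:E))%E.

Let mXt := poisson_measurable.

Let mG h : measurable_fun setT h -> (forall t, (0 <= h t)%E) ->
  measurable_fun setT (fun w => (\int[M w]_(t in D) h t)%E).
Proof. exact: measurable_jump_integral. Qed.

Let GD (h1 h2 : R -> \bar R) : measurable_fun setT h1 -> measurable_fun setT h2 ->
  (forall t, (0 <= h1 t)%E) -> (forall t, (0 <= h2 t)%E) ->
  (G (fun t => h1 t + h2 t) = G h1 + G h2)%E.
Proof.
move=> m1 m2 p1 p2; rewrite /G -ge0_integralD//; first last.
- exact: mG.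
- by move=> w _; exact: integral_ge0.
- exact: mG.
- by move=> w _; exact: integral_ge0.
apply: eq_integral => w _; rewrite ge0_integralD//.
- exact: measurable_funS m1.
- exact: measurable_funS m2.
Qed.

Let mlamE (h : R -> \bar R) : measurable_fun setT h ->
  measurable_fun D (fun t => (h t * (lambda t)%:E)%E).
Proof.
move=> mh; apply: emeasurable_funM; first exact: measurable_funS mh.
exact/measurable_EFinP.
Qed.

Let LD (h1 h2 : R -> \bar R) : measurable_fun setT h1 -> measurable_fun setT h2 ->
  (forall t, (0 <= h1 t)%E) -> (forall t, (0 <= h2 t)%E) ->
  (L (fun t => h1 t + h2 t) = L h1 + L h2)%E.
Proof.
move=> m1 m2 p1 p2; rewrite /L -ge0_integralD//; first last.
- exact: mlamE.
- by move=> t Dt; rewrite mule_ge0// lee_fin Dlam0.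
- exact: mlamE.
- by move=> t Dt; rewrite mule_ge0// lee_fin Dlam0.
by apply: eq_integral => t _; rewrite ge0_muleDl.
Qed.

Let Glim (g : (R -> \bar R)^nat) (h : R -> \bar R) :
  (forall n, measurable_fun setT (g n)) -> (forall n t, (0 <= g n t)%E) ->
  (forall t, {homo g ^~ t : n m / (n <= m)%N >-> (n <= m)%E}) ->
  (forall t, g n t @[n --> \oo] --> h t) -> G (g n) @[n --> \oo] --> G h.
Proof.
move=> mg g0 ndg gh; apply: cvg_monotone_integral => //.
- by move=> n; apply: mG; [exact: mg | exact: g0].
- by move=> n w _; exact: integral_ge0.
- move=> w _ n m nm; apply: ge0_le_integral => //.
  + exact: measurable_funS (mg n).
  + exact: measurable_funS (mg m).
  + by move=> t _; exact: ndg.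
- move=> w _; apply: cvg_monotone_integral => //.
  by move=> n; exact: measurable_funS (mg n).
Qed.

Let Llim (g : (R -> \bar R)^nat) (h : R -> \bar R) :
  (forall n, measurable_fun setT (g n)) -> (forall n t, (0 <= g n t)%E) ->
  (forall t, {homo g ^~ t : n m / (n <= m)%N >-> (n <= m)%E}) ->
  (forall t, g n t @[n --> \oo] --> h t) -> L (g n) @[n --> \oo] --> L h.
Proof.
move=> mg g0 ndg gh; apply: cvg_monotone_integral => //.
- by move=> n; exact: mlamE.
- by move=> n t Dt; rewrite mule_ge0// lee_fin Dlam0.
- by move=> t Dt n m nm; rewrite lee_wpmul2r ?lee_fin ?Dlam0//; exact: ndg.
- by move=> t Dt; apply: cvgeZr => //; exact: gh.
Qed.

Let mind (A : set R) : measurable A -> measurable_fun setT (fun t => (\1_A t : R)%:E).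
Proof. by move=> mA; apply/measurable_EFinP; exact: measurable_indic. Qed.

Let ind0 (A : set R) t : (0 <= (\1_A t : R)%:E)%E.
Proof. by rewrite lee_fin indicE. Qed.

Let Lind_fin (A : set R) : measurable A -> L (fun t => (\1_A t : R)%:E) \is a fin_num.
Proof.
move=> mA; rewrite ge0_fin_numE; last first.
  by apply: integral_ge0 => t Dt; rewrite mule_ge0// lee_fin Dlam0.
apply: (@le_lt_trans _ _ (\int[mu]_(t in D) (lambda t)%:E)%E).
  apply: ge0_le_integral => //.
  - by move=> t Dt; rewrite mule_ge0// lee_fin Dlam0.
  - by apply: mlamE; exact: mind.
  - exact/measurable_EFinP.
  - by move=> t Dt; rewrite -EFinM lee_fin ler_piMl ?Dlam0// indicE lern1 leq_b1.
by have := integrable_fin_num (measurable_oc tau) iDlam; rewrite fin_numE => /andP[_]; rewrite ltey.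
Qed.

Let GLitv (a b : R) : G (fun t => (\1_(`]a, b]%classic) t : R)%:E) =
  L (fun t => (\1_(`]a, b]%classic) t : R)%:E).
Proof.
have mitv : measurable (`]a, b]%classic : set (measurableTypeR R)) by exact: measurable_itv.
have -> : G (fun t => (\1_(`]a, b]%classic) t : R)%:E) = (\int[P]_w M w (`]a, b]%classic `&` D))%E.
  by apply: eq_integral => w _; rewrite integral_indic.
have -> : L (fun t => (\1_(`]a, b]%classic) t : R)%:E) =
    (\int[mu]_(t in `]a, b]%classic `&` D) (lambda t)%:E)%E.
  rewrite /L [RHS]integral_mkcondl; apply: eq_integral => t _.
  by rewrite patchE indicE; case: (t \in _); rewrite ?mul1e ?mul0e.
have DE : `]a, b]%classic `&` D = `]Order.max a 0, Order.min b tau]%classic.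
  by apply/seteqP; split => t /=; rewrite !in_itv/= gt_max le_min;
    [move=> [/andP[-> ->] /andP[-> ->]] | move=> /andP[/andP[-> ->] /andP[-> ->]]].
under eq_integral do rewrite jump_mass_itv//.
rewrite DE; case: (boolP (Order.max a 0 <= Order.min b tau)) => [h|]; last first.
  rewrite -ltNge => h; rewrite set_itv_ge ?integral_set0 ?integral0//.
  by rewrite bnd_simp -leNgt ltW.
have a0 : 0 <= Order.max a 0 by rewrite le_max lexx orbT.
have bt : Order.min b tau <= tau by rewrite ge_min lexx orbT.
rewrite poisson_mean_itv//.
apply: (@poisson_mean_variable _ _ _ P (fun w => X w _ - X w _)).
- exact: poisson_increment_measurable.
- by move=> w; exact: poisson_increment_nat.
- exact: poisson_mean_ge0.
- exact: poisson_increment_prob.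
Qed.

Let GLset (A : set R) : measurable A ->
  G (fun t => (\1_A t : R)%:E) = L (fun t => (\1_A t : R)%:E).
Proof.
move: A; apply: (borel_set_induction (H := fun A => G (fun t => (\1_A t : R)%:E) = L (fun t => (\1_A t : R)%:E))).
- exact: GLitv.
- have e (t : R) : D t -> (\1_setT t : R)%:E = (\1_D t : R)%:E.
    by move=> Dt; rewrite !indicE !mem_set.
  have := GLitv 0 tau; rewrite /G /L => h.
  transitivity (\int[P]_w \int[M w]_(t in D) (\1_D t)%:E)%E.
    by apply: eq_integral => w _; apply: eq_integral => t /set_mem Dt; exact: e.
  by rewrite h; apply: eq_integral => t /set_mem Dt; rewrite e.
- move=> A B mA mB BA hA hB.
  have mAB : measurable (A `\` B) by exact: measurableD.
  have AE : (fun t => (\1_A t : R)%:E) =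
      (fun t => (\1_B t : R)%:E + (\1_(A `\` B) t : R)%:E)%E.
    apply/funext => t; rewrite -EFinD !indicE in_setD; congr _%:E.
    case: (boolP (t \in B)) => [/set_mem/BA/mem_set -> /=|_ /=].
      by rewrite addr0.
    by rewrite andbT add0r.
  move: hA; rewrite AE GD ?LD//; [|exact: mind..].
  have cancel (x y z : \bar R) : x \is a fin_num -> (x + y = x + z)%E -> y = z.
    by move=> xf e; rewrite -(addeK y xf) -(addeK z xf) ![(_ + x)%E]addeC e.
  by rewrite hB; apply: cancel; exact: Lind_fin.
- move=> F ndF mF hF.
  have c t : (\1_(F n) t : R)%:E @[n --> \oo] --> (\1_(\bigcup_n F n) t : R)%:E.
    apply: cvg_near_cst.
    have [[n _ Fn]|h] := pselect ((\bigcup_n F n) t).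
      exists n => // m /= nm; rewrite !indicE !mem_set//; first by exists n.
      by have /subsetPset := ndF _ _ nm; apply.
    apply: nearW => n; rewrite !indicE !memNset// => Fn; apply: h; exists n => //.
  have nd t : {homo (fun n => (\1_(F n) t : R)%:E) : n m / (n <= m)%N >-> (n <= m)%E}.
    move=> n m nm; rewrite lee_fin !indicE; case: (boolP (t \in F n)) => // /set_mem Fn.
    by rewrite mem_set//; have /subsetPset := ndF _ _ nm; apply.
  have c1 := Glim (fun n => mind (mF n)) (fun n => ind0 (F n)) nd c.
  have c2 := Llim (fun n => mind (mF n)) (fun n => ind0 (F n)) nd c.
  apply: (cvg_unique _ c1) => //.
  rewrite [X in [set x | X @ _ --> x]](_ : _ = (fun n => L (fun t => (\1_(F n) t : R)%:E))) => [//|].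
  by apply/funext => n; exact: hF.
Qed.

(** On an interval this is the mean of the Poisson law. Both sides are
    additive and continuous along increasing sequences in [h], hence agree on
    Borel sets and then on nonnegative functions. *)
Lemma campbell (h : R -> \bar R) : measurable_fun setT h -> (forall t, (0 <= h t)%E) ->
  (\int[P]_w \int[lebesgue_stieltjes_measure (X w)]_(t in `]0%R, tau]) h t =
   \int[mu]_(t in `]0%R, tau]) (h t * (lambda t)%:E))%E.
Proof.
move: h; apply: (borel_nonneg_induction (Q := fun h => G h = L h)).
- rewrite /G /L [RHS]integral0_eq => [|t _]; last by rewrite mul0e.
  by apply: integral0_eq => w _; exact: integral0.
- move=> x A h x0 mA mh h0 IH.
  have m1 : measurable_fun setT (fun t : R => (x%:E * (\1_A t : R)%:E)%E).
    by apply: emeasurable_funM => //; exact: mind.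
  have p1 t : (0 <= x%:E * (\1_A t : R)%:E)%E by rewrite mule_ge0.
  rewrite GD// LD// IH; congr (_ + _)%E.
  have -> : G (fun t => x%:E * (\1_A t : R)%:E)%E = (x%:E * G (fun t => (\1_A t : R)%:E))%E.
    rewrite /G -ge0_integralZl//; last first.
    - by move=> w _; exact: integral_ge0.
    - by apply: mG; [exact: mind | exact: ind0].
    apply: eq_integral => w _; rewrite ge0_integralZl//.
    exact: measurable_funS (mind mA).
  rewrite GLset// /L -ge0_integralZl//; last first.
  - by move=> t Dt; rewrite mule_ge0// lee_fin Dlam0.
  - by apply: mlamE; exact: mind.
  by apply: eq_integral => t _; rewrite muleA.
- move=> g h mg g0 ndg gh IH.
  have c1 := Glim mg g0 ndg gh; have c2 := Llim mg g0 ndg gh.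
  apply: (cvg_unique _ c1) => //.
  by have -> : (fun n => G (g n)) = (fun n => L (g n)) by apply/funext => n; exact: IH.
Qed.

End campbell.

(** * Approximation by step functions on a grid *)

Section step_functions.
Context {R : realType}.
Variable tau : R.
Hypothesis tau0 : 0 < tau.
Local Notation D := (`]0, tau]%classic : set R).

Definition grid (k i : nat) : R := tau * i%:R / k%:R.

Definition step_fun (k : nat) (c : nat -> R) (t : R) : R :=
  \sum_(i < k) c i * \1_(`]grid k i, grid k i.+1]%classic) t.

Lemma grid_nondecreasing k i j : (i <= j)%N -> grid k i <= grid k j.
Proof.
move=> ij; rewrite /grid ler_wpM2r ?invr_ge0//.
by rewrite ler_wpM2l ?(ltW tau0)// ler_nat.
Qed.

Lemma grid_cc k i : (i <= k)%N -> grid k i \in `[0, tau].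
Proof.
move=> ik; rewrite in_itv/= /grid; apply/andP; split.
  by rewrite !mulr_ge0 ?invr_ge0 ?(ltW tau0).
case: k ik => [|k ik]; first by rewrite invr0 mulr0 ltW.
by rewrite ler_pdivrMr ?ltr0n// ler_wpM2l ?(ltW tau0)// ler_nat.
Qed.

Lemma gridS k i : grid k i.+1 = grid k i + tau / k%:R.
Proof. by rewrite /grid -natr1 mulrDr mulr1 mulrDl. Qed.

Lemma grid_cell k t : (0 < k)%N -> D t ->
  exists2 i, (i < k)%N & t \in `]grid k i, grid k i.+1].
Proof.
move=> k0; rewrite /= in_itv/= => /andP[t0 tt].
have ex : exists i, t <= grid k i.
  by exists k; rewrite /grid mulfK// pnatr_eq0 -lt0n.
case: (ex_minnP ex) => -[|i] ti imin.
  by move: ti; rewrite /grid mulr0 mul0r leNgt t0.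
exists i; last first.
  by rewrite in_itv/= ti andbT ltNge; apply/negP => /imin; rewrite ltnn.
by apply: imin; rewrite /grid mulfK// pnatr_eq0 -lt0n.
Qed.

Lemma cell_indic_neq k i j t : i != j -> t \in `]grid k i, grid k i.+1] ->
  \1_(`]grid k j, grid k j.+1]%classic) t = 0 :> R.
Proof.
move=> ij; rewrite in_itv/= => /andP[it ti]; rewrite indicE memNset//=.
rewrite in_itv/= => /andP[jt tj]; case: (ltngtP i j) => h; last by rewrite h eqxx in ij.
  by have := le_lt_trans (le_trans ti (grid_nondecreasing k h)) jt; rewrite ltxx.
by have := le_lt_trans (le_trans tj (grid_nondecreasing k h)) it; rewrite ltxx.
Qed.

Lemma step_fun_cell k c i t : (i < k)%N -> t \in `]grid k i, grid k i.+1] ->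
  step_fun k c t = c i.
Proof.
move=> ik it; rewrite /step_fun (bigD1 (Ordinal ik))//= big1 ?addr0.
  by rewrite indicE mem_set// mulr1.
move=> j ji; rewrite (@cell_indic_neq k i)// ?mulr0//.
by apply: contra ji => /eqP ij; apply/eqP/val_inj.
Qed.

(** Cells are disjoint and cover [D], so that a function of a step function is
    again one; this lets the exponents be computed cell by cell. *)
Lemma step_fun_comp k c (phi : R -> R) t : (0 < k)%N -> D t ->
  phi (step_fun k c t) = step_fun k (phi \o c) t.
Proof. by move=> k0 /(grid_cell k0)[i ik it]; rewrite !(step_fun_cell _ ik it). Qed.

Lemma measurable_step_fun k c : measurable_fun setT (step_fun k c).
Proof.
by apply: measurable_bigsum => i; apply: measurable_funM => //.
Qed.

Lemma step_funD k c c' t : step_fun k c t + step_fun k c' t = step_fun k (fun i => c i + c' i) t.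
Proof. by rewrite /step_fun -big_split/=; apply: eq_bigr => i _; rewrite mulrDl. Qed.

Lemma step_funZ k (x : R) c t : x * step_fun k c t = step_fun k (fun i => x * c i) t.
Proof. by rewrite /step_fun big_distrr/=; apply: eq_bigr => i _; rewrite mulrA. Qed.

End step_functions.

Section density.
Context {R : realType}.
Variables (tau : R) (lambda : R -> R).
Hypothesis tau0 : 0 < tau.
Local Notation mu := (@lebesgue_measure R).
Local Notation D := (`]0, tau]%classic : set R).
Hypothesis lam0 : forall t, D t -> 0 <= lambda t.
Hypothesis ilam : mu.-integrable D (EFin \o lambda).

(** The norm of L1 for the intensity; by [campbell], it bounds the mean
    distance between stochastic integrals. *)
Definition weighted_norm (h : R -> R) : \bar R :=
  (\int[mu]_(t in D) (`|h t| * lambda t)%:E)%E.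
Local Notation N1 := weighted_norm.

Let mlam : measurable_fun D lambda.
Proof. exact: Rintegrable_measurable ilam. Qed.

Lemma measurable_weighted (h : R -> R) : measurable_fun setT h ->
  measurable_fun D (fun t => (`|h t| * lambda t)%:E).
Proof.
move=> mh; apply/measurable_EFinP; apply: measurable_funM => //.
by apply: measurableT_comp => //; exact: measurable_funTS mh.
Qed.

Lemma weighted_ge0 (h : R -> R) t : D t -> (0 <= (`|h t| * lambda t)%:E)%E.
Proof. by move=> Dt; rewrite lee_fin mulr_ge0// lam0. Qed.

Lemma le_weighted_norm (h h' : R -> R) : measurable_fun setT h -> measurable_fun setT h' ->
  (forall t, D t -> `|h t| <= `|h' t|) -> (N1 h <= N1 h')%E.
Proof.
move=> mh mh' hh; apply: ge0_le_integral.
- exact: measurable_oc.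
- by move=> t; exact: weighted_ge0.
- exact: measurable_weighted.
- exact: measurable_weighted.
- by move=> t Dt; rewrite lee_fin ler_wpM2r ?lam0 ?hh.
Qed.

Lemma weighted_norm_triangle (h1 h2 h : R -> R) :
  measurable_fun setT h1 -> measurable_fun setT h2 -> measurable_fun setT h ->
  (forall t, D t -> `|h t| <= `|h1 t| + `|h2 t|) -> (N1 h <= N1 h1 + N1 h2)%E.
Proof.
move=> m1 m2 mh hh; rewrite /N1 -ge0_integralD//; first last.
- exact: measurable_weighted.
- by move=> t; exact: weighted_ge0.
- exact: measurable_weighted.
- by move=> t; exact: weighted_ge0.
apply: ge0_le_integral.
- exact: measurable_oc.
- by move=> t; exact: weighted_ge0.
- exact: measurable_weighted.
- by apply: emeasurable_funD; exact: measurable_weighted.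
- by move=> t Dt; rewrite -EFinD lee_fin -mulrDl ler_wpM2r ?lam0 ?hh.
Qed.

Lemma weighted_normZ (x : R) h : measurable_fun setT h ->
  N1 (fun t => x * h t) = (`|x|%:E * N1 h)%E.
Proof.
move=> mh; rewrite /N1 -ge0_integralZl//.
- by apply: eq_integral => t _; rewrite -EFinM normrM mulrA.
- exact: measurable_weighted.
- by move=> t; exact: weighted_ge0.
Qed.

Lemma weighted_norm_cvg0 (h : nat -> R -> R) (H : R -> R) :
  (forall n, measurable_fun setT (h n)) -> measurable_fun setT H -> (N1 H < +oo)%E ->
  (forall n t, D t -> `|h n t| <= `|H t|) ->
  (forall t, D t -> h n t @[n --> \oo] --> (0 : R)) ->
  forall e : R, 0 < e -> exists N, forall n, (N <= n)%N -> (N1 (h n) <= e%:E)%E.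
Proof.
move=> mh mH H_fin hH h_0 e e0.
have iH : mu.-integrable D (fun t => (`|H t| * lambda t)%:E).
  apply/integrableP; split; first exact: measurable_weighted.
  rewrite (_ : (\int[mu]_(t in D) _)%E = N1 H)//.
  by apply: eq_integral => t /set_mem Dt; rewrite gee0_abs// weighted_ge0.
have [] := @dominated_convergence _ (measurableTypeR R) _ mu D (measurable_oc tau)
  (fun n t => (`|h n t| * lambda t)%:E) (cst 0%E) (fun t => (`|H t| * lambda t)%:E).
- by move=> n; exact: measurable_weighted.
- exact: measurable_cst.
- apply: aeW => t Dt; apply: cvg_EFin; first exact: nearW.
  rewrite (_ : 0 = `|0 : R| * lambda t); last by rewrite normr0 mul0r.
  by apply: cvgMl; apply: cvg_norm; exact: h_0.
- exact: iH.
- apply: aeW => t Dt n; rewrite gee0_abs ?weighted_ge0//.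
  by rewrite lee_fin ler_wpM2r ?lam0 ?hH.
move=> _ _; rewrite integral0 => c.
have /fine_cvgP[fc cc] : N1 (h n) @[n --> \oo] --> (0 : R)%:E by exact: c.
have [N1' _ hN1] := fc.
move/cvgrPdist_le : cc => /(_ e e0)[N2 _ hN2].
exists (maxn N1' N2) => n; rewrite geq_max => /andP[n1 n2].
have := hN2 n n2; rewrite /= sub0r normrN => h2.
have := hN1 n n1 => /= h1.
by rewrite -(fineK h1) lee_fin (le_trans (ler_norm _)).
Qed.

(** Approximability is required on all grids that are fine enough, rather than
    on some grid, so that two functions can be approximated on the same grid
    and added. *)
Definition grid_approximable (g : R -> R) := forall e : R, 0 < e ->
  exists N, forall k, (N <= k)%N ->
    exists c, (N1 (fun t => g t - step_fun tau k c t)%R <= e%:E)%E.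
Local Notation V := grid_approximable.

Let mstep k c : measurable_fun setT (step_fun tau k c).
Proof. exact: measurable_step_fun. Qed.

Lemma grid_approximable_closed (g : R -> R) : measurable_fun setT g ->
  (forall e : R, 0 < e -> exists h : R -> R, [/\ measurable_fun setT h, V h &
     (N1 (fun t => g t - h t)%R <= e%:E)%E]) -> V g.
Proof.
move=> mg gh e e0; have e2 : 0 < e / 2 by rewrite divr_gt0.
have [h [mh Vh ghe]] := gh _ e2; have [N hN] := Vh _ e2.
exists N => k /hN[c hc]; exists c; rewrite (splitr e) EFinD.
apply: le_trans (leeD ghe hc); apply: weighted_norm_triangle.
- exact: measurable_funB.
- exact: measurable_funB.
- exact: measurable_funB.
by move=> t _; rewrite -(subrKA (h t)); exact: ler_normD.
Qed.

Lemma grid_approximableD (g h : R -> R) : measurable_fun setT g -> measurable_fun setT h ->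
  V g -> V h -> V (fun t => g t + h t).
Proof.
move=> mg mh Vg Vh e e0; have e2 : 0 < e / 2 by rewrite divr_gt0.
have [N hN] := Vg _ e2; have [N' hN'] := Vh _ e2.
exists (maxn N N') => k; rewrite geq_max => /andP[/hN[c hc] /hN'[c' hc']].
exists (fun i => c i + c' i); rewrite (splitr e) EFinD.
apply: le_trans (leeD hc hc'); apply: weighted_norm_triangle.
- exact: measurable_funB.
- exact: measurable_funB.
- by apply: measurable_funB => //; exact: measurable_funD.
by move=> t _; rewrite -step_funD opprD addrACA; exact: ler_normD.
Qed.

Lemma grid_approximableZ (x : R) (g : R -> R) : measurable_fun setT g -> V g -> V (fun t => x * g t).
Proof.
move=> mg Vg e e0; have [->|x0] := eqVneq x 0.
  exists 0%N => k _; exists (fun=> 0); rewrite (_ : (fun t => _) = fun t => 0 * g t).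
    by rewrite weighted_normZ// normr0 mul0e lee_fin ltW.
  apply/funext => t; rewrite /step_fun big1 ?subr0// => i _.
  by rewrite mul0r.
have [N hN] := Vg (e / `|x|) ltac:(by rewrite divr_gt0// normr_gt0).
exists N => k /hN[c hc]; exists (fun i => x * c i).
rewrite (_ : (fun t => _) = fun t => x * (g t - step_fun tau k c t)).
  rewrite weighted_normZ; last exact: measurable_funB.
  apply: (le_trans (lee_wpmul2l _ hc)) => //.
  by rewrite -EFinM mulrCA divff ?mulr1// normr_eq0.
by apply/funext => t; rewrite -step_funZ mulrBr.
Qed.

Let mitv (b : R) : measurable_fun setT (\1_(`]-oo, b]%classic) : R -> R).
Proof. by apply: measurable_indic; exact: measurable_itv. Qed.

Let one_fin : (N1 (cst 1%R) < +oo)%E.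
Proof.
rewrite /N1; under eq_integral do rewrite /= normr1 mul1r.
have := integrable_fin_num (measurable_oc tau) ilam; rewrite ge0_fin_numE//.
by apply: integral_ge0 => t Dt; rewrite lee_fin lam0.
Qed.

(** The value [1] is given to the cells that start before [b]; the error is
    supported in [b, b + tau / k], whose weight tends to 0. *)
Lemma grid_approximable_ray (b : R) : V (\1_(`]-oo, b]%classic) : R -> R).
Proof.
have ms k : measurable_fun setT (\1_(`]b, b + tau / k.+1%:R]%classic) : R -> R).
  by apply: measurable_indic; exact: measurable_itv.
have small := @weighted_norm_cvg0 (fun k => \1_(`]b, b + tau / k.+1%:R]%classic)) (cst 1)
  ms (measurable_cst _) one_fin.
move=> e e0; have [] // := small _ _ e e0.
- by move=> k t _; rewrite normr1 indicE; case: (_ \in _); rewrite ?normr1 ?normr0.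
- move=> t _; apply: cvg_near_cst.
  have [tb|bt] := leP t b.
    by apply: nearW => k; rewrite indicE memNset//= in_itv/= ltNge tb.
  have : (tau / k.+1%:R) @[k --> \oo] --> (0 : R).
    by rewrite -[0](mulr0 tau); apply: cvgMr; exact: cvg_harmonic.
  move/cvgrPdist_lt => /(_ (t - b)); rewrite subr_gt0 => /(_ bt); apply: filterS => k.
  rewrite sub0r normrN gtr0_norm ?divr_gt0// ltrBrDl => h.
  by rewrite indicE memNset//= in_itv/= leNgt h andbF.
move=> N hN; exists N.+1 => -[//|k] Nk.
(* Only the cell containing [b] can contribute to the error. *)
exists (fun i => (grid tau k.+1 i < b)%R%:R).
apply: le_trans (hN k Nk); apply: le_weighted_norm.
- by apply: measurable_funB.
- exact: ms.
move=> t Dt; have [i ik it] := grid_cell (ltn0Sn k) Dt.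
rewrite (step_fun_cell tau0 _ ik it) !indicE.
move: it; rewrite in_itv/= gridS => /andP[it ti].
have -> : (t \in `]-oo, b]%classic) = (t <= b).
  by apply/idP/idP => [/set_mem|]; [|move=> ?; apply: mem_set]; rewrite /= in_itv/=.
have [tb|bt] := leP t b; first by rewrite (lt_le_trans it tb) subrr normr0.
case: ltP => ib; last by rewrite subrr normr0.
rewrite mem_set ?sub0r ?normrN ?normr1//= in_itv/= bt/= (le_trans ti)//.
by rewrite lerD2r ltW.
Qed.

Lemma grid_approximable_indic A : measurable A -> V (\1_A : R -> R).
Proof.
move: A; apply: (borel_set_induction (H := fun A => V (\1_A : R -> R))).
- move=> a b; have [ab|ba] := leP a b; last first.
    rewrite set_itv_ge ?bnd_simp -?leNgt ?ltW//.
    have := grid_approximableZ 0 (mitv 0) (@grid_approximable_ray 0).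
    by congr V; apply/funext => t; rewrite mul0r indicE in_set0.
  have -> : \1_(`]a, b]%classic) = (fun t : R => \1_(`]-oo, b]%classic) t + -1 * \1_(`]-oo, a]%classic) t) :> (R -> R).
    apply/funext => t; rewrite !indicE.
    have E (i : interval R) : (t \in [set` i]) = (t \in i).
      by apply/idP/idP => [/set_mem|] //; exact: mem_set.
    rewrite !E !in_itv/= mulN1r; have [ta|at_] := leP t a.
      by rewrite (le_trans ta ab) subrr.
    by rewrite subr0.
  apply: grid_approximableD; [exact: mitv|exact: measurable_funM| |].
    exact: grid_approximable_ray.
  by apply: grid_approximableZ; [exact: mitv|exact: grid_approximable_ray].
- move=> e e0; exists 1%N => k k0; exists (fun=> 1).
  rewrite /N1 (_ : (\int[mu]_(t in D) _)%E = 0%E) ?lee_fin ?ltW//.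
  apply: integral0_eq => t Dt; have [i ik it] := grid_cell k0 Dt.
  by rewrite (step_fun_cell tau0 _ ik it) indicE in_setT subrr normr0 mul0r.
- move=> A B mA mB BA hA hB.
  have -> : \1_(A `\` B) = (fun t : R => \1_A t + -1 * \1_B t) :> (R -> R).
    apply/funext => t; rewrite !indicE in_setD mulN1r.
    case: (boolP (t \in B)) => [/set_mem/BA/mem_set -> /=|_ /=].
      by rewrite subrr.
    by rewrite andbT subr0.
  apply: grid_approximableD => //; first exact: measurable_funM.
  exact: grid_approximableZ.
- move=> F ndF mF hF.
  have mU : measurable (\bigcup_n F n) by exact: bigcupT_measurable.
  have mFn n := @measurable_indic _ _ R setT _ (mF n).
  have mUi := @measurable_indic _ _ R setT _ mU.
  apply: grid_approximable_closed => // e e0.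
  have [] // := @weighted_norm_cvg0 (fun n t => \1_(\bigcup_n F n) t - \1_(F n) t) (cst 1) _ (measurable_cst _) one_fin _ _ e e0.
  + by move=> n; exact: measurable_funB.
  + move=> n t _; rewrite normr1 !indicE; case: (boolP (t \in F n)) => [/set_mem Ft|_].
      by rewrite mem_set ?subrr ?normr0//; exists n.
    by rewrite subr0; case: (_ \in _); rewrite ?normr1 ?normr0.
  + move=> t _; apply: cvg_near_cst.
    have [[n _ Fn]|h] := pselect ((\bigcup_n F n) t).
      exists n => // m /= nm; rewrite !indicE !mem_set ?subrr//; last by exists n.
      by have /subsetPset := ndF _ _ nm; apply.
    apply: nearW => n; rewrite !indicE !memNset ?subrr// => Fn; apply: h; exists n => //.
  move=> N hN; exists (\1_(F N)); split => //.
  by apply: hN.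
Qed.

Let nonneg (h : R -> \bar R) : measurable_fun setT h -> (forall t, (0 <= h t)%E) ->
  (forall t, (h t < +oo)%E) -> (N1 (fine \o h) < +oo)%E -> V (fine \o h).
Proof.
move: h; apply: (borel_nonneg_induction (Q := fun h =>
  (forall t, (h t < +oo)%E) -> (N1 (fine \o h) < +oo)%E -> V (fine \o h))).
- move=> _ _.
  have := grid_approximableZ 0 (mitv 0) (@grid_approximable_ray 0).
  by congr V; apply/funext => t; rewrite mul0r.
- move=> x A h x0 mA mh h0 IH hfin Nfin.
  have mAi := @measurable_indic _ _ R setT _ mA.
  have hf t : (h t < +oo)%E.
    apply: le_lt_trans (hfin t); rewrite leeDr// -EFinM lee_fin mulr_ge0// indicE.
  have hfn t : h t \is a fin_num by rewrite ge0_fin_numE.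
  have E : (fine \o (fun t => (x%:E * (\1_A t)%:E + h t)%E)) =
      (fun t => x * \1_A t + (fine \o h) t).
    by apply/funext => t; rewrite /= -EFinM fineD.
  have mf : measurable_fun setT (fine \o h) by exact: measurableT_comp.
  have mxA : measurable_fun setT (fun t => x * \1_A t) by exact: measurable_funM.
  rewrite E; apply: grid_approximableD => //.
    by apply: grid_approximableZ => //; exact: grid_approximable_indic.
  apply: IH => //; apply: le_lt_trans Nfin; rewrite E; apply: le_weighted_norm => //.
    exact: measurable_funD.
  move=> t _; have f0 : 0 <= (fine \o h) t by rewrite fine_ge0.
  have xA : 0 <= x * \1_A t by rewrite mulr_ge0// indicE.
  by rewrite !ger0_norm ?addr_ge0// lerDr.
- move=> g h mg g0 ndg gh IH hfin Nfin.
  have gleh n t : (g n t <= h t)%E.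
    apply: cvge_ge (gh t).
    by exists n => // m /= nm; exact: ndg.
  have h0 t : (0 <= h t)%E by exact: le_trans (g0 0%N t) (gleh 0%N t).
  have gfin n t : g n t \is a fin_num.
    by rewrite ge0_fin_numE//; exact: le_lt_trans (gleh n t) (hfin t).
  have hfn t : h t \is a fin_num by rewrite ge0_fin_numE.
  have mh : measurable_fun setT h.
    by apply: emeasurable_fun_cvg mg _ => t _; exact: gh.
  have mfh : measurable_fun setT (fine \o h) by exact: measurableT_comp.
  have mfg n : measurable_fun setT (fine \o g n) by exact: measurableT_comp.
  have gl n t : (fine \o g n) t <= (fine \o h) t by rewrite /= fine_le.
  have f0 t : 0 <= (fine \o h) t by rewrite /= fine_ge0.
  have f0' n t : 0 <= (fine \o g n) t by rewrite /= fine_ge0.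
  apply: grid_approximable_closed => // e e0.
  have [] // := @weighted_norm_cvg0 (fun n t => (fine \o h) t - (fine \o g n) t) (fine \o h) _ mfh Nfin _ _ e e0.
  + by move=> n; exact: measurable_funB.
  + by move=> n t _; rewrite !ger0_norm ?subr_ge0// lerBlDr lerDl.
  + move=> t _; rewrite -[X in _ --> X](subrr ((fine \o h) t)); apply: cvgB; first exact: cvg_cst.
    by apply: (@fine_cvg _ _ _ _ (fun n => g n t)); rewrite /= fineK//; exact: gh.
  move=> N hN; exists (fine \o g N); split => //; last exact: hN.
  apply: IH.
    by move=> t; exact: le_lt_trans (gleh N t) (hfin t).
  apply: le_lt_trans Nfin; apply: le_weighted_norm => // t _.
  by rewrite !ger0_norm.
Qed.

Lemma grid_approximable_integrable (g : R -> R) : measurable_fun setT g -> (N1 g < +oo)%E -> V g.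
Proof.
move=> mg Ng.
have aux (f : R -> R) : measurable_fun setT f -> (forall t, 0 <= f t) ->
    (forall t, f t <= `|g t|) -> V f.
  move=> mf f0 fg; apply: (@nonneg (EFin \o f)).
  - exact/measurable_EFinP.
  - by move=> t; rewrite /= lee_fin.
  - by move=> t; rewrite /= ltry.
  - apply: le_lt_trans Ng; apply: le_weighted_norm => // t _.
    by rewrite /= ger0_norm.
have mp : measurable_fun setT (fun t => Num.max (g t) 0) by exact: measurable_maxr.
have mn : measurable_fun setT (fun t => Num.max (- g t) 0).
  by apply: measurable_maxr => //; exact: measurableT_comp.
have -> : g = (fun t => Num.max (g t) 0 + -1 * Num.max (- g t) 0).
  apply/funext => t; rewrite mulN1r; have [g0|g0] := leP (g t) 0.
    by rewrite max_l ?oppr_ge0// add0r opprK.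
  by rewrite max_r ?subr0// oppr_le0 ltW.
apply: grid_approximableD => //; first exact: measurable_funM.
  apply: aux => // t; first by rewrite le_max lexx orbT.
  by rewrite ge_max ler_norm normr_ge0.
apply: grid_approximableZ => //; apply: aux => // t; first by rewrite le_max lexx orbT.
by rewrite ge_max -normrN ler_norm normr_ge0.
Qed.

End density.

(** * Trigonometric moments of Poisson stochastic integrals *)

Lemma cos_lipschitz {R : realType} (x y : R) : `|cos x - cos y| <= `|x - y|.
Proof.
have := @MVT_bound R (fun z => cos (y + z) - cos y) (fun z => - sin (y + z)) 1 0.
move=> /(_ _ _ _ (x - y)).
rewrite (addrC y (x - y)) subrK mul1r expr1; apply.
- by rewrite addr0 subrr.
- by move=> z; derive_by; ring.
- by move=> z; rewrite normrN expr0 mulr1; exact: norm_sin_le1.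
Qed.

Lemma sin_lipschitz {R : realType} (x y : R) : `|sin x - sin y| <= `|x - y|.
Proof.
have sE (z : R) : sin z = cos (z - pi / 2) by rewrite cosB cos_pihalf sin_pihalf mulr0 mulr1 add0r.
by rewrite !sE (le_trans (cos_lipschitz _ _))// opprB addrA subrK.
Qed.

Section jump_integrals.
Context d (Omega : measurableType d) (R : realType) (P : probability Omega R).
Variables (tau : R) (lambda : R -> R) (X : Omega -> cumulative R R).
Hypothesis tau0 : 0 < tau.
Hypothesis mlam : measurable_fun `[0, tau] lambda.
Hypothesis lam0 : forall t, t \in `[0, tau] -> 0 <= lambda t.
Hypothesis HX : is_poisson_process P tau lambda X.
Local Notation mu := (@lebesgue_measure R).
Local Notation D := (`]0, tau]%classic : set R).
Local Notation M w := (lebesgue_stieltjes_measure (X w)).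
Local Notation Y g w := (stochastic_integral tau g X w).
Local Notation N1 := (weighted_norm tau lambda).

Let DI : D `<=` `[0, tau].
Proof. exact: subset_itv_oc_cc. Qed.

Let Dlam0 t : D t -> 0 <= lambda t.
Proof. by move=> /DI; exact: lam0. Qed.

Let ilam : mu.-integrable D (EFin \o lambda).
Proof.
apply: integrableS (poisson_lambda_integrable HX) => //.
Qed.

Let mX := poisson_measurable HX.

Let cell_sub k i : (i < k)%N -> `]grid tau k i, grid tau k i.+1]%classic `<=` D.
Proof.
move=> ik t; rewrite /= !in_itv/= => /andP[it ti].
have := grid_cc tau0 (ltnW ik); rewrite in_itv/= => /andP[g0 _].
have := grid_cc tau0 ik; rewrite in_itv/= => /andP[_ gt].
by rewrite (le_lt_trans g0 it) (le_trans ti gt).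
Qed.

Lemma Rintegral_step_fun (nu : {measure set (measurableTypeR R) -> \bar R}) (h : R -> R) k c :
  nu.-integrable D (EFin \o h) ->
  nu.-integrable D (EFin \o (fun t => step_fun tau k c t * h t)) /\
  \int[nu]_(t in D) (step_fun tau k c t * h t) =
  \sum_(i < k) c i * \int[nu]_(t in `]grid tau k i, grid tau k i.+1]) h t.
Proof.
move=> ih.
pose f (i : 'I_k) (t : R) := c i * (\1_(`]grid tau k i, grid tau k i.+1]%classic) t * h t).
have mh : measurable_fun D h by exact: Rintegrable_measurable ih.
have if1 (i : 'I_k) : nu.-integrable D
    (EFin \o (fun t => \1_(`]grid tau k i, grid tau k i.+1]%classic) t * h t)).
  apply: (@le_Rintegrable _ (measurableTypeR R) _ nu _ _ _ (fun t => `|h t|)).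
  - exact: measurable_oc.
  - by apply: measurable_funM => //; apply: measurable_funTS.
  - by apply: RintegrableNorm => //; exact: measurable_oc.
  - move=> t _; rewrite normrM ler_piMl// indicE; case: (t \in _).
      by rewrite normr1.
    by rewrite normr0.
have if2 (i : 'I_k) : nu.-integrable D (EFin \o f i).
  exact: RintegrableZ (measurable_oc tau) _ _ (if1 i).
have [h1 h2] := Rintegral_sum_ord (measurable_oc tau) if2.
have E : (fun t => step_fun tau k c t * h t) = (fun t => \sum_(i < k) f i t).
  by apply/funext => t; rewrite /step_fun big_distrl/=; apply: eq_bigr => i _; rewrite /f mulrA.
rewrite E; split => //; rewrite h2; apply: eq_bigr => i _.
rewrite /f RintegralZl//; congr (_ * _).
rewrite -[in RHS](setIidl (cell_sub (ltn_ord i))) Rintegral_mkcondl.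
apply: eq_Rintegral => t _; rewrite patchE indicE.
by case: (t \in _); rewrite ?mul1r ?mul0r.
Qed.

Let M_fin w : (M w D < +oo)%E.
Proof. by rewrite lebesgue_stieltjes_measure_ocitv ?ltry// ltW. Qed.

Let one_integrable w : (M w).-integrable D (EFin \o cst 1).
Proof.
apply/integrableP; split; first by apply/measurable_EFinP; exact: measurable_cst.
under eq_integral do rewrite /= normr1.
by rewrite integral_cst//= mul1e; exact: M_fin.
Qed.

Lemma step_fun_integrable w k c : (M w).-integrable D (EFin \o step_fun tau k c).
Proof.
have [h _] := @Rintegral_step_fun (M w) (cst 1) k c (one_integrable w).
by move: h; congr (_.-integrable _ _); apply/funext => t; rewrite /= mulr1.
Qed.

Lemma stochastic_integral_step_fun k c w : Y (step_fun tau k c) w =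
  \sum_(i < k) c i * (X w (grid tau k i.+1) - X w (grid tau k i)).
Proof.
have [_ h] := @Rintegral_step_fun (M w) (cst 1) k c (one_integrable w).
transitivity (\int[M w]_(t in D) (step_fun tau k c t * cst 1 t)).
  by apply: eq_Rintegral => t _; rewrite mulr1.
rewrite h; apply: eq_bigr => i _; congr (_ * _).
have g : grid tau k i <= grid tau k i.+1 by exact: grid_nondecreasing.
by rewrite Rintegral_cst//= lebesgue_stieltjes_measure_ocitv ?ltry//= mul1r.
Qed.

Let r k i := poisson_mean lambda (grid tau k i) (grid tau k i.+1).

Lemma weighted_integral_step_fun k c (phi : R -> R) : (0 < k)%N ->
  \int[mu]_(t in D) (phi (step_fun tau k c t) * lambda t) =
  \sum_(i < k) phi (c i) * r k i.
Proof.
move=> k0; have [_ h] := @Rintegral_step_fun mu lambda k (phi \o c) ilam.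
transitivity (\int[mu]_(t in D) (step_fun tau k (phi \o c) t * lambda t)).
  by apply: eq_Rintegral => t /set_mem Dt; rewrite (step_fun_comp tau0).
rewrite h; apply: eq_bigr => i _; congr (_ * _).
rewrite /Rintegral (poisson_mean_itv mlam HX)//=.
- by have := grid_cc tau0 (ltnW (ltn_ord i)); rewrite in_itv/= => /andP[].
- exact: grid_nondecreasing.
- by have := grid_cc tau0 (ltn_ord i); rewrite in_itv/= => /andP[].
Qed.

(** The increments over the cells are independent Poisson variables. *)
Lemma step_fun_trig k c (v : R) : (0 < k)%N ->
  let a := \int[mu]_(t in D) ((1 - cos (v * step_fun tau k c t)) * lambda t) in
  let b := \int[mu]_(t in D) (sin (v * step_fun tau k c t) * lambda t) in
  \int[P]_w cos (v * Y (step_fun tau k c) w) = expR (- a) * cos b /\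
  \int[P]_w sin (v * Y (step_fun tau k c) w) = expR (- a) * sin b.
Proof.
move=> k0 a b; rewrite {}/a {}/b.
rewrite (@weighted_integral_step_fun k c (fun x => 1 - cos (v * x)) k0).
rewrite (@weighted_integral_step_fun k c (fun x => sin (v * x)) k0).
pose I (i : 'I_k) w := X w (grid tau k i.+1) - X w (grid tau k i).
pose U (i : 'I_k) w := v * c i * I i w.
have UE w : v * Y (step_fun tau k c) w = \sum_i U i w.
  by rewrite stochastic_integral_step_fun big_distrr/=; apply: eq_bigr => i _; rewrite mulrA.
have g0 i : (i <= k)%N -> 0 <= grid tau k i.
  by move=> /(grid_cc tau0); rewrite in_itv/= => /andP[].
have gt i : (i <= k)%N -> grid tau k i <= tau.
  by move=> /(grid_cc tau0); rewrite in_itv/= => /andP[].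
have gS i : grid tau k i <= grid tau k i.+1 by exact: grid_nondecreasing.
have mI (i : 'I_k) : measurable_fun setT (I i).
  by apply: (poisson_increment_measurable HX); rewrite ?g0 ?gt//; exact: ltnW.
have nI (i : 'I_k) w : I i w \is a Num.nat.
  by apply: (poisson_increment_nat HX); rewrite ?g0 ?gt//; exact: ltnW.
have r0 (i : 'I_k) : 0 <= r k i.
  by apply: (poisson_mean_ge0 lam0); rewrite ?g0 ?gt//; exact: ltnW.
have Ir (i : 'I_k) : forall j : nat, P [set w | I i w = j%:R] = poisson_prob (r k i) 0 [set j].
  by apply: (poisson_increment_prob HX); rewrite ?g0 ?gt//; exact: ltnW.
have [_ _ _ _ /(_ k (grid tau k)) ind] := HX.
have indF := ind (fun i ik => grid_cc tau0 ik) (fun i _ => gS i).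
under eq_Rintegral do rewrite UE.
under [X in _ /\ X = _]eq_Rintegral do rewrite UE.
apply: (@independent_trig _ _ _ P k _ indF).
- by move=> i A [B mB <-]; exact: mI.
- by move=> i; exists set0 => //; rewrite preimage_set0 setI0.
- by move=> i; exists setT => //; rewrite preimage_setT setIT.
- move=> i; apply: (@adapted_comp _ _ _ k (fun i => g_sigma_algebra_preimage (I i)) i (I i) (fun x => v * c i * x)).
    exact: measurable_funM.
  by move=> B mB; exists B => //; rewrite setTI.
- by move=> i; rewrite ![_ * r k i]mulrC; apply: poisson_cos (Ir i) (v * c i).
- by move=> i; rewrite ![_ * r k i]mulrC; apply: poisson_sin (Ir i) (v * c i).
Qed.

(** When the right side is infinite there is nothing to prove; otherwise [g]
    is integrable along with [s]. *)
Lemma stochastic_integral_dist (g s : R -> R) w : measurable_fun setT g ->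
  (M w).-integrable D (EFin \o s) ->
  ((`|Y g w - Y s w|)%:E <= \int[M w]_(t in D) (`|g t - s t|)%:E)%E.
Proof.
move=> mg is_; have mg' : measurable_fun D g by exact: measurable_funTS.
have ms : measurable_fun D s by exact: Rintegrable_measurable is_.
have mgs : measurable_fun D (fun t => g t - s t) by exact: measurable_funB.
have [fin|] := ltP (\int[M w]_(t in D) (`|g t - s t|)%:E)%E +oo%E; last first.
  by rewrite leye_eq => /eqP ->; rewrite leey.
have igs : (M w).-integrable D (EFin \o (fun t => g t - s t)).
  by apply/integrableP; split => //; apply/measurable_EFinP.
have ig : (M w).-integrable D (EFin \o g).
  have -> : g = (fun t => (g t - s t) + s t) by apply/funext => t; rewrite subrK.
  exact: (RintegrableD (measurable_oc tau) igs is_).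
have in_ : (M w).-integrable D (EFin \o (fun t => `|g t - s t|)).
  apply/integrableP; split.
    by apply/measurable_EFinP; apply: measurableT_comp => //.
  by under eq_integral do rewrite /= normr_id.
rewrite /stochastic_integral -(RintegralB (measurable_oc tau) ig is_).
rewrite -[leRHS]fineK; last exact: (integrable_fin_num (measurable_oc tau) in_).
by rewrite lee_fin; apply: (norm_Rintegral_le (measurable_oc tau)) => //.
Qed.

Let mY (g : R -> R) : measurable_fun setT g -> measurable_fun setT (fun w => Y g w).
Proof. exact: measurable_stochastic_integral. Qed.

Lemma stochastic_integral_mean_dist (g s : R -> R) : measurable_fun setT g ->
  measurable_fun setT s -> (forall w, (M w).-integrable D (EFin \o s)) ->
  (\int[P]_w (`|Y g w - Y s w|)%:E <= N1 (fun t => g t - s t)%R)%E.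
Proof.
move=> mg ms is_.
have mgs : measurable_fun setT (fun t => (`|g t - s t|)%:E).
  by apply/measurable_EFinP; apply: measurableT_comp => //; exact: measurable_funB.
have := campbell tau0 mlam lam0 HX mgs (fun t => _).
rewrite /weighted_norm; under [X in _ -> (_ <= X)%E]eq_integral do rewrite EFinM.
move=> <- //; apply: ge0_le_integral => //.
- by apply/measurable_EFinP; apply: measurableT_comp => //; apply: measurable_funB; exact: mY.
- exact: measurable_jump_integral.
- by move=> w _; exact: stochastic_integral_dist.
Qed.

Lemma stochastic_integral_integrable (g : R -> R) : measurable_fun setT g ->
  (N1 g < +oo)%E -> P.-integrable setT (EFin \o (fun w => Y g w)).
Proof.
move=> mg Ng; apply/integrableP; split; first by apply/measurable_EFinP; exact: mY.
apply: le_lt_trans Ng.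
have := @stochastic_integral_mean_dist g (cst 0) mg (measurable_cst _).
have Y0 w : Y (cst 0) w = 0.
  by rewrite /stochastic_integral /Rintegral integral0.
under eq_integral do rewrite Y0 subr0.
rewrite (_ : (fun t => (g t - cst 0 t)%R) = g); last by apply/funext => t; rewrite subr0.
by apply => w; exact: integrable0.
Qed.

Section lipschitz_functional.
Variables (phi : R -> R) (v : R).
Hypothesis phi_lip : forall x y, `|phi x - phi y| <= `|x - y|.
Hypothesis phi_le1 : forall x, `|phi x| <= 1.

Let mphi : measurable_fun setT phi.
Proof.
apply: continuous_measurable_fun => x.
apply/cvgrPdist_lt => e e0; near=> y; apply: (le_lt_trans (phi_lip x y)).
by near: y; exact: cvgr_dist_lt.
Unshelve. all: by end_near. Qed.

Let weighted_functional (h psi : R -> R) := \int[mu]_(t in D) (psi (v * h t) * lambda t).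

Let weighted_dist (g s psi : R -> R) (e : R) : measurable_fun setT g ->
  measurable_fun setT s -> (N1 (fun t => g t - s t)%R <= e%:E)%E ->
  (forall x y, `|psi x - psi y| <= `|x - y|) -> (forall x, `|psi x| <= 2) ->
  `|weighted_functional g psi - weighted_functional s psi| <= `|v| * e.
Proof.
move=> mg ms Ngs psi_lip psi2.
have mpsi : measurable_fun setT psi.
  apply: continuous_measurable_fun => x.
  apply/cvgrPdist_lt => e' e0; near=> y; apply: (le_lt_trans (psi_lip x y)).
  by near: y; exact: cvgr_dist_lt.
have int (h : R -> R) : measurable_fun setT h ->
    mu.-integrable D (EFin \o (fun t => psi (v * h t) * lambda t)).
  move=> mh; apply: (@le_Rintegrable _ (measurableTypeR R) _ mu _ _ _ (fun t => 2 * lambda t)).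
  - exact: measurable_oc.
  - apply: measurable_funM; last exact: Rintegrable_measurable ilam.
    by apply: measurable_funTS; apply: measurableT_comp => //; exact: measurable_funM.
  - exact: (RintegrableZ (measurable_oc tau) _ ilam).
  - by move=> t Dt; rewrite normrM (ger0_norm (Dlam0 Dt)) ler_wpM2r ?Dlam0.
have iN : mu.-integrable D (EFin \o (fun t => `|g t - s t| * lambda t)).
  apply/integrableP; split.
    by apply: measurable_weighted ilam _ _; exact: measurable_funB.
  rewrite (_ : (\int[mu]_(t in D) _)%E = N1 (fun t => g t - s t)).
    by apply: le_lt_trans Ngs _; rewrite ltry.
  apply: eq_integral => t /set_mem Dt; rewrite gee0_abs//.
  by rewrite lee_fin mulr_ge0// Dlam0.
rewrite /weighted_functional -(RintegralB (measurable_oc tau) (int _ mg) (int _ ms)).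
have ii := RintegrableB (measurable_oc tau) (int _ mg) (int _ ms).
apply: (le_trans (norm_Rintegral_le (measurable_oc tau) ii (RintegrableZ (measurable_oc tau) `|v| iN) _)).
  move=> t Dt; rewrite -mulrBl normrM (ger0_norm (Dlam0 Dt)) mulrA.
  by rewrite ler_wpM2r ?Dlam0// -normrM mulrBr.
rewrite (RintegralZl _ (measurable_oc tau) iN) ler_wpM2l//.
rewrite -lee_fin fineK//.
exact: (integrable_fin_num (measurable_oc tau) iN).
Unshelve. all: by end_near. Qed.

(** Both sides are continuous in [g] for [weighted_norm]: the left side
    because [phi] is Lipschitz and by [stochastic_integral_mean_dist], the
    right side because [cos] and [sin] are Lipschitz. Step functions are dense
    by [grid_approximable_integrable]. *)
Lemma poisson_functional (g : R -> R) : measurable_fun setT g -> (N1 g < +oo)%E ->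
  (forall k c, (0 < k)%N ->
    \int[P]_w phi (v * Y (step_fun tau k c) w) =
    expR (- \int[mu]_(t in D) ((1 - cos (v * step_fun tau k c t)) * lambda t)) *
    phi (\int[mu]_(t in D) (sin (v * step_fun tau k c t) * lambda t))) ->
  \int[P]_w phi (v * Y g w) =
  expR (- \int[mu]_(t in D) ((1 - cos (v * g t)) * lambda t)) *
  phi (\int[mu]_(t in D) (sin (v * g t) * lambda t)).
Proof.
move=> mg Ng Hstep; apply/eqP; rewrite -subr_eq0 -normr_le0.
apply/ler_addgt0Pl => eps eps0; rewrite addr0.
pose e := eps / (4 * (`|v| + 1)).
have v1 : 0 < 4 * (`|v| + 1) by rewrite mulr_gt0// ltr_wpDl.
have e0 : 0 < e by rewrite divr_gt0.
have [N hN] := grid_approximable_integrable tau0 Dlam0 ilam mg Ng e0.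
have [c hc] := hN N.+1 (leqnSn N).
set s := step_fun tau N.+1 c in hc.
have ms : measurable_fun setT s by exact: measurable_step_fun.
have mphiY (h : R -> R) : measurable_fun setT h ->
    measurable_fun setT (fun w => phi (v * Y h w)).
  by move=> mh; apply: measurableT_comp => //; apply: measurable_funM => //; exact: mY.
have iphi (h : R -> R) : measurable_fun setT h ->
    P.-integrable setT (EFin \o (fun w => phi (v * Y h w))).
  by move=> mh; apply: bounded1_Rintegrable => //; exact: mphiY.
have d1 : `|\int[P]_w phi (v * Y g w) - \int[P]_w phi (v * Y s w)| <= `|v| * e.
  rewrite -(RintegralB measurableT (iphi _ mg) (iphi _ ms)).
  have md : measurable_fun setT (fun w => `|Y g w - Y s w|).
    by apply: measurableT_comp => //; apply: measurable_funB; exact: mY.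
  have dist := stochastic_integral_mean_dist mg ms (fun w => step_fun_integrable w N.+1 c).
  have iY : P.-integrable setT (EFin \o (fun w => `|Y g w - Y s w|)).
    apply/integrableP; split; first exact/measurable_EFinP.
    under eq_integral do rewrite /= normr_id.
    by apply: le_lt_trans dist _; apply: le_lt_trans hc _; rewrite ltry.
  have ii := RintegrableB measurableT (iphi _ mg) (iphi _ ms).
  apply: (le_trans (norm_Rintegral_le measurableT ii (RintegrableZ measurableT `|v| iY) _)).
    by move=> w _; apply: (le_trans (phi_lip _ _)); rewrite -mulrBr normrM.
  rewrite (RintegralZl _ measurableT iY) ler_wpM2l//.
  rewrite -lee_fin fineK; first exact: le_trans dist hc.
  exact: (integrable_fin_num measurableT iY).
have lc (x y : R) : `|(1 - cos x) - (1 - cos y)| <= `|x - y|.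
  by rewrite opprB addrC addrA subrK distrC cos_lipschitz.
have d2 := @weighted_dist g s (fun x => 1 - cos x) e mg ms hc lc _.
have d3 := @weighted_dist g s sin e mg ms hc sin_lipschitz _.
rewrite /weighted_functional in d2 d3.
have {}d2 := d2 ltac:(by move=> x; rewrite (le_trans (ler_normB _ _))// normr1 lerD2l norm_cos_le1).
have {}d3 := d3 ltac:(by move=> x; rewrite (le_trans (norm_sin_le1 _))// ler1n).
have age0 (h : R -> R) : 0 <= \int[mu]_(t in D) ((1 - cos (v * h t)) * lambda t).
  by apply: Rintegral_ge0 => t Dt; rewrite mulr_ge0 ?Dlam0// subr_ge0 cos_le1.
have ag := age0 g; have as_ := age0 s.
have := Hstep N.+1 c isT; rewrite -/s => E.
rewrite {}E in d1.
move: d1 d2 d3 ag as_; set L := \int[P]_w _; set a := \int[mu]_(t in D) _.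
set a' := \int[mu]_(t in D) _; set b := \int[mu]_(t in D) _; set b' := \int[mu]_(t in D) _.
move=> d1 d2 d3 b0 a0.
have ea1 : expR (- a) <= 1 by rewrite expR_le1 oppr_le0.
have eb1 : expR (- b) <= 1 by rewrite expR_le1 oppr_le0.
have -> : L - expR (- b) * phi b' = (L - expR (- a) * phi a') +
    ((expR (- a) - expR (- b)) * phi a' + expR (- b) * (phi a' - phi b')) by ring.
have h1 : `|(expR (- a) - expR (- b)) * phi a'| <= 2 * `|a - b|.
  rewrite normrM; apply: (@le_trans _ _ `|expR (- a) - expR (- b)|).
    by rewrite ler_piMr.
  apply: (le_trans (expR_sub_le a b)).
  by rewrite mulrC ler_wpM2r// -[2]/(1 + 1) lerD.
have h2 : `|expR (- b) * (phi a' - phi b')| <= `|a' - b'|.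
  rewrite normrM ger0_norm ?expR_ge0//.
  by apply: le_trans (phi_lip a' b'); rewrite ler_piMl.
have h3 : 4 * (`|v| * e) <= eps.
  rewrite /e mulrA mulrCA -[leRHS]mulr1 ler_wpM2l ?(ltW eps0)//.
  by rewrite ler_pdivrMr// mul1r ler_wpM2l// lerDl.
rewrite (le_trans (ler_normD _ _))//; rewrite (distrC a b) in h1; rewrite (distrC a' b') in h2.
have := ler_normD ((expR (- a) - expR (- b)) * phi a') (expR (- b) * (phi a' - phi b')).
lra.
Qed.

End lipschitz_functional.

Lemma poisson_integral_cos (g : R -> R) v : measurable_fun setT g -> (N1 g < +oo)%E ->
  \int[P]_w cos (v * Y g w) =
  expR (- \int[mu]_(t in D) ((1 - cos (v * g t)) * lambda t)) *
  cos (\int[mu]_(t in D) (sin (v * g t) * lambda t)).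
Proof.
move=> mg Ng; apply: poisson_functional => //.
- exact: cos_lipschitz.
- exact: norm_cos_le1.
- by move=> k c k0; have [] := @step_fun_trig k c v k0.
Qed.

Lemma poisson_integral_sin (g : R -> R) v : measurable_fun setT g -> (N1 g < +oo)%E ->
  \int[P]_w sin (v * Y g w) =
  expR (- \int[mu]_(t in D) ((1 - cos (v * g t)) * lambda t)) *
  sin (\int[mu]_(t in D) (sin (v * g t) * lambda t)).
Proof.
move=> mg Ng; apply: poisson_functional => //.
- exact: sin_lipschitz.
- exact: norm_sin_le1.
- by move=> k c k0; have [] := @step_fun_trig k c v k0.
Qed.

End jump_integrals.

(** * The exponent of the characteristic function *)

Section exponent_bounds.
Context {R : realType}.
Variables (tau : R) (lambda g : R -> R).
Hypothesis tau0 : 0 < tau.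
Local Notation mu := (@lebesgue_measure R).
Local Notation D := (`]0, tau]%classic : set R).
Hypothesis lam0 : forall t, D t -> 0 <= lambda t.
Hypothesis ilam : mu.-integrable D (EFin \o lambda).
Hypothesis mg : measurable_fun setT g.
Hypothesis ig4 : mu.-integrable D (EFin \o (fun t => `|g t| ^+ 4 * lambda t)).

Let J (f : R -> R) := \int[mu]_(t in D) (f (g t) * lambda t).

Let mlam : measurable_fun D lambda.
Proof. exact: Rintegrable_measurable ilam. Qed.

(** The intensity and the fourth moment control every function of growth at
    most 4. *)
Lemma weighted_poly_integrable (f : R -> R) (C : R) : measurable_fun setT f ->
  (forall x, `|f x| <= C * (1 + `|x| ^+ 4)) ->
  mu.-integrable D (EFin \o (fun t => f (g t) * lambda t)).
Proof.
move=> mf fC.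
apply: (@le_Rintegrable _ (measurableTypeR R) _ mu _ _ _
   (fun t => C * (lambda t + `|g t| ^+ 4 * lambda t))).
- exact: measurable_oc.
- apply: measurable_funM => //.
  by apply: measurable_funTS; apply: measurableT_comp.
- exact: (RintegrableZ (measurable_oc tau) _ (RintegrableD (measurable_oc tau) ilam ig4)).
- move=> t Dt; rewrite normrM (ger0_norm (lam0 Dt)).
  rewrite -[X in X + _ * _]mul1r -mulrDl mulrA.
  by rewrite ler_wpM2r ?lam0.
Qed.

Lemma weighted_norm_le (f h : R -> R) (c : R) :
  mu.-integrable D (EFin \o (fun t => f (g t) * lambda t)) ->
  mu.-integrable D (EFin \o (fun t => h (g t) * lambda t)) ->
  (forall x, `|f x| <= c * h x) -> `|J f| <= c * J h.
Proof.
move=> fi hi fh; rewrite /J -(RintegralZl _ (measurable_oc tau) hi).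
apply: (norm_Rintegral_le (measurable_oc tau)) => //; first exact: (RintegrableZ (measurable_oc tau)).
by move=> t Dt; rewrite normrM (ger0_norm (lam0 Dt)) mulrA ler_wpM2r ?lam0.
Qed.

Lemma pow_le_1D4 (x : R) k : (k <= 4)%N -> `|x| ^+ k <= 1 + `|x| ^+ 4.
Proof.
move=> k4; have [x1|x1] := leP `|x| 1.
  by rewrite (@le_trans _ _ 1)// ?exprn_ile1// lerDl exprn_ge0.
by rewrite (@le_trans _ _ (`|x| ^+ 4))// ?lerDr// ler_eXn2l.
Qed.

Lemma weighted_pow_integrable k : (k <= 4)%N ->
  mu.-integrable D (EFin \o (fun t => g t ^+ k * lambda t)).
Proof.
move=> k4; apply: (@weighted_poly_integrable (fun x => x ^+ k) 1).
  exact: measurable_funX.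
by move=> x; rewrite normrX mul1r pow_le_1D4.
Qed.

Lemma weighted_npow_integrable k : (k <= 4)%N ->
  mu.-integrable D (EFin \o (fun t => `|g t| ^+ k * lambda t)).
Proof.
move=> k4; apply: (@weighted_poly_integrable (fun x => `|x| ^+ k) 1).
  by apply: measurable_funX; exact: normr_measurable.
by move=> x; rewrite normrX normr_id mul1r pow_le_1D4.
Qed.

Lemma weighted_norm_fin : (weighted_norm tau lambda g < +oo)%E.
Proof.
have /integrableP[_] := @weighted_npow_integrable 1 isT.
apply: le_lt_trans; rewrite /weighted_norm; apply: ge0_le_integral => //.
- by move=> t Dt; rewrite lee_fin mulr_ge0// lam0.
- exact: measurable_weighted.
- apply: measurableT_comp => //; exact: measurable_weighted.
- by move=> t Dt; rewrite lee_fin ler_norm.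
Qed.

Let mcosM v : measurable_fun setT (fun x : R => cos (v * x)).
Proof. by under eq_fun do rewrite mulrC; exact: measurable_cosM. Qed.

Let msinM v : measurable_fun setT (fun x : R => sin (v * x)).
Proof. by under eq_fun do rewrite mulrC; exact: measurable_sinM. Qed.

Lemma weighted_bounded_integrable (f : R -> R) C : 0 <= C -> measurable_fun setT f ->
  (forall x, `|f x| <= C) -> mu.-integrable D (EFin \o (fun t => f (g t) * lambda t)).
Proof.
move=> C0 mf fC; apply: (@weighted_poly_integrable f C) => // x.
by rewrite (le_trans (fC x))// ler_peMr// lerDl exprn_ge0.
Qed.

Let icos v : mu.-integrable D (EFin \o (fun t => (1 - cos (v * g t)) * lambda t)).
Proof.
apply: (@weighted_bounded_integrable (fun x => 1 - cos (v * x)) 2) => //.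
  by apply: measurable_funB.
by move=> x; rewrite (le_trans (ler_normB _ _))// normr1 lerD2l norm_cos_le1.
Qed.

Let isin v : mu.-integrable D (EFin \o (fun t => sin (v * g t) * lambda t)).
Proof.
apply: (@weighted_bounded_integrable (fun x => sin (v * x)) 1) => //.
by move=> x; exact: norm_sin_le1.
Qed.

Let ipow k c : (k <= 4)%N ->
  mu.-integrable D (EFin \o (fun t => (c * g t ^+ k) * lambda t)).
Proof.
move=> k4; have := RintegrableZ (measurable_oc tau) c (weighted_pow_integrable k4).
by congr (_.-integrable _ _); apply/funext => t; rewrite /= mulrA.
Qed.

Let J4 := \int[mu]_(t in D) (`|g t| ^+ 4 * lambda t).
Let J3 := \int[mu]_(t in D) (`|g t| ^+ 3 * lambda t).
Let m k := \int[mu]_(t in D) (g t ^+ k * lambda t).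

Lemma exponent_real_part v :
  `|\int[mu]_(t in D) ((1 - cos (v * g t)) * lambda t) - v ^+ 2 * m 2 / 2| <=
  `|v| ^+ 4 * J4.
Proof.
have -> : v ^+ 2 * m 2 / 2 = \int[mu]_(t in D) ((v ^+ 2 / 2 * g t ^+ 2) * lambda t).
  under [RHS]eq_Rintegral do rewrite -mulrA.
  by rewrite (RintegralZl _ (measurable_oc tau) (weighted_pow_integrable (isT : (2 <= 4)%N)))// mulrAC.
rewrite -(RintegralB (measurable_oc tau) (icos v) (ipow _ (isT : (2 <= 4)%N))).
under eq_Rintegral do rewrite -mulrBl.
apply: (@weighted_norm_le (fun x => 1 - cos (v * x) - v ^+ 2 / 2 * x ^+ 2)
   (fun x => `|x| ^+ 4)).
- have := RintegrableB (measurable_oc tau) (icos v) (ipow (v ^+ 2 / 2) (isT : (2 <= 4)%N)).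
  by congr (_.-integrable _ _); apply/funext => t; rewrite /= -mulrBl.
- exact: ig4.
- move=> x; rewrite -exprMn -normrM -normrN.
  by have := cos_taylor2_le4 (v * x); congr (`|_| <= _); rewrite exprMn; ring.
Qed.

Let imag v : \int[mu]_(t in D) (sin (v * g t) * lambda t) - v * m 1 =
  \int[mu]_(t in D) ((sin (v * g t) - v * g t) * lambda t).
Proof.
rewrite /m -(RintegralZl _ (measurable_oc tau) (weighted_pow_integrable (isT : (1 <= 4)%N))).
rewrite -(RintegralB (measurable_oc tau) (isin v)); last first.
  exact: (RintegrableZ (measurable_oc tau) v (weighted_pow_integrable (isT : (1 <= 4)%N))).
by apply: eq_Rintegral => t _; rewrite expr1 mulrA mulrBl.
Qed.

Let iimag v : mu.-integrable D (EFin \o (fun t => (sin (v * g t) - v * g t) * lambda t)).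
Proof.
have := RintegrableB (measurable_oc tau) (isin v) (ipow v (isT : (1 <= 4)%N)).
by congr (_.-integrable _ _); apply/funext => t; rewrite /= expr1 mulrBl.
Qed.

(** Subtracting the mean [v * m 1] removes the linear term; this centring is
    what makes the argument of the characteristic function of order 3. *)
Lemma exponent_imag_part3 v :
  `|\int[mu]_(t in D) (sin (v * g t) * lambda t) - v * m 1| <= `|v| ^+ 3 * J3.
Proof.
rewrite imag; apply: (@weighted_norm_le (fun x => sin (v * x) - v * x) (fun x => `|x| ^+ 3)).
- exact: iimag.
- exact: weighted_npow_integrable.
- by move=> x; rewrite -exprMn -normrM distrC; exact: sin_subid_le3.
Qed.

Lemma exponent_imag_part4 v :
  `|\int[mu]_(t in D) (sin (v * g t) * lambda t) - v * m 1 + v ^+ 3 * m 3 / 6| <=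
  `|v| ^+ 4 * J4.
Proof.
have -> : v ^+ 3 * m 3 / 6 = \int[mu]_(t in D) ((v ^+ 3 / 6 * g t ^+ 3) * lambda t).
  under [RHS]eq_Rintegral do rewrite -mulrA.
  by rewrite (RintegralZl _ (measurable_oc tau) (weighted_pow_integrable (isT : (3 <= 4)%N)))// mulrAC.
rewrite imag -(RintegralD (measurable_oc tau) (iimag v) (ipow _ (isT : (3 <= 4)%N))).
under eq_Rintegral do rewrite -mulrDl.
apply: (@weighted_norm_le (fun x => sin (v * x) - v * x + v ^+ 3 / 6 * x ^+ 3)
   (fun x => `|x| ^+ 4)).
- have := RintegrableD (measurable_oc tau) (iimag v) (ipow (v ^+ 3 / 6) (isT : (3 <= 4)%N)).
  by congr (_.-integrable _ _); apply/funext => t; rewrite /= -mulrDl.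
- exact: ig4.
- move=> x; rewrite -exprMn -normrM.
  by have := sin_taylor3_le4 (v * x); congr (`|_| <= _); rewrite exprMn; ring.
Qed.

Let S v := \int[mu]_(t in D) (sin (v * g t) ^+ 2 * lambda t).

Let iS v : mu.-integrable D (EFin \o (fun t => sin (v * g t) ^+ 2 * lambda t)).
Proof.
apply: (@weighted_bounded_integrable (fun x => sin (v * x) ^+ 2) 1) => //.
  exact: measurable_funX.
by move=> x; rewrite normrX exprn_ile1// norm_sin_le1.
Qed.

Let S_muln (k : nat) v : S (k%:R * v) <= k%:R ^+ 2 * S v.
Proof.
rewrite /S -(RintegralZl _ (measurable_oc tau) (iS v)); apply: le_Rintegral => //.
  exact: (RintegrableZ (measurable_oc tau) _ (iS v)).
move=> t Dt; rewrite mulrA ler_wpM2r ?lam0// -mulrA.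
rewrite -[sin (k%:R * _) ^+ 2]real_normK ?num_real// -[sin (v * g t) ^+ 2]real_normK ?num_real//.
by rewrite -exprMn ler_sqr ?nnegrE ?mulr_ge0// norm_sin_muln_le.
Qed.

Let cos_sin v : \int[mu]_(t in D) ((1 - cos (v * g t)) * lambda t) = 2 * S (v / 2).
Proof.
rewrite /S -(RintegralZl _ (measurable_oc tau) (iS _)); apply: eq_Rintegral => t _.
rewrite mulrA; congr (_ * _).
have -> : v * g t = (v / 2 * g t) *+ 2 by rewrite mulr2n -mulrDl -splitr.
by rewrite cos_mulr2n sin2cos2; ring.
Qed.

(** Replacing [v] by a multiple [k v] beyond the threshold costs a factor
    [k ^ 2], which turns a bound for large frequencies into one for all
    frequencies, quadratic near 0. *)
Lemma exponent_lower_bound (v0 delta : R) : 0 < v0 -> 0 < delta ->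
  (forall v, v0 < `|v| -> delta <= S v) ->
  exists2 c : R, 0 < c & forall v,
    c * Num.min (v ^+ 2) 1 <=
    \int[mu]_(t in D) ((1 - cos (v * g t)) * lambda t).
Proof.
move=> v00 delta0 hS.
exists (delta / (2 * (1 + v0) ^+ 2)).
  by rewrite divr_gt0// mulr_gt0// exprn_gt0// addr_gt0.
move=> v; rewrite cos_sin.
have [->|v_neq0] := eqVneq v 0.
  rewrite expr0n/= min_l// mulr0 mulr_ge0// /S mul0r.
  by apply: Rintegral_ge0 => t Dt; rewrite mulr_ge0 ?lam0// sqr_ge0.
have w0 : 0 < `|v / 2| by rewrite normr_gt0 mulf_neq0.
set w := v / 2 in w0 *.
(* [k * w] is beyond the threshold, and [k] exceeds [v0 / `|w|] by at most 1.
   *)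
pose k := (Num.trunc (v0 / `|w|)).+1.
have kgt : v0 < `|k%:R * w|.
  rewrite normrM ger0_norm// -ltr_pdivrMr//; exact: truncnS_gt.
have kle : k%:R <= v0 / `|w| + 1.
  rewrite /k -natr1 lerD2r; have /truncn_itv/andP[] // : 0 <= v0 / `|w|.
  by rewrite divr_ge0 ?ltW.
have h1 : delta <= (v0 / `|w| + 1) ^+ 2 * S w.
  apply: (le_trans (hS _ kgt)); apply: (le_trans (S_muln k w)).
  apply: ler_wpM2r.
    by apply: Rintegral_ge0 => t Dt; rewrite mulr_ge0 ?lam0// sqr_ge0.
  by rewrite ler_sqr ?nnegrE// addr_ge0// divr_ge0// ltW.
have v0p : 0 < 1 + v0 by rewrite addr_gt0.
have h2 : Num.min (v ^+ 2) 1 * (v0 / `|w| + 1) ^+ 2 <= 4 * (1 + v0) ^+ 2.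
  have -> : 4 * (1 + v0) ^+ 2 = (2 * (1 + v0)) ^+ 2 by ring.
  have vw : `|v| = 2 * `|w| by rewrite /w normrM (@ger0_norm _ 2^-1)// mulrCA divff// mulr1.
  have key : Num.min `|v| 1 * (v0 / `|w| + 1) <= 2 * (1 + v0).
    have a1 : Num.min `|v| 1 * (v0 / `|w|) <= 2 * v0.
      apply: (@le_trans _ _ (`|v| * (v0 / `|w|))).
        by rewrite ler_wpM2r ?ge_min ?lexx// divr_ge0// ltW.
      by rewrite vw -mulrA [X in _ * X]mulrC divfK ?gt_eqF.
    have a2 : Num.min `|v| 1 <= 1 by rewrite ge_min lexx orbT.
    by rewrite mulrDr mulr1 mulrDr mulr1 addrC lerD// (le_trans a2)// ler1n.
  have -> : Num.min (v ^+ 2) 1 = Num.min `|v| 1 ^+ 2.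
    have [v1|v1] := leP `|v| 1.
      by rewrite real_normK ?num_real// min_l// -real_normK ?num_real// exprn_ile1.
    by rewrite expr1n min_r// -real_normK ?num_real// exprn_ege1// ltW.
  rewrite -exprMn ler_sqr ?nnegrE//.
    by rewrite mulr_ge0 ?addr_ge0 ?divr_ge0 ?ltW// lt_min normr_gt0 v_neq0 ltr01.
  by rewrite mulr_ge0// ltW.
rewrite mulrAC ler_pdivrMr; last by rewrite mulr_gt0// exprn_gt0.
have mn0 : 0 <= Num.min (v ^+ 2) 1 by rewrite le_min sqr_ge0 ler01.
have Sw0 : 0 <= S w.
  by apply: Rintegral_ge0 => t Dt; rewrite mulr_ge0 ?lam0// sqr_ge0.
apply: (@le_trans _ _ (Num.min (v ^+ 2) 1 * ((v0 / `|w| + 1) ^+ 2 * S w))).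
  by rewrite mulrC ler_wpM2l.
rewrite mulrA; apply: (le_trans (ler_wpM2r Sw0 h2)).
by apply/eqP/eqP; rewrite le_eqVlt; apply/orP; left; apply/eqP; ring.
Qed.

End exponent_bounds.

(** * Sums of independent stochastic integrals *)

Section independent_sum.
Context {R : realType}.
Variables (tau : R) (lambda g : R -> R).
Hypothesis tau0 : 0 < tau.
Local Notation mu := (@lebesgue_measure R).
Local Notation D := (`]0, tau]%classic : set R).
Hypothesis mlam : measurable_fun `[0, tau] lambda.
Hypothesis lam0 : forall t, t \in `[0, tau] -> 0 <= lambda t.
Hypothesis mg : measurable_fun setT g.
Hypothesis Ng : (weighted_norm tau lambda g < +oo)%E.
Context d (Omega : measurableType d) (P : probability Omega R) (n : nat).
Variable X : 'I_n -> Omega -> cumulative R R.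
Hypothesis HX : forall j, is_poisson_process P tau lambda (X j).
Hypothesis indX : independent_processes P tau X.
Local Notation Y j w := (stochastic_integral tau g (X j) w).

Let mX j t : t \in `[0, tau] -> measurable_fun setT (fun w => X j w t).
Proof. exact: poisson_measurable (HX j) t. Qed.

Let mY j : measurable_fun setT (fun w => Y j w).
Proof. exact: (measurable_stochastic_integral tau0 (@mX j) mg). Qed.

Let G j := \bigcup_(t in `[0, tau]) g_sigma_algebra_preimage (fun w => X j w t).

Let G_measurable j A : process_sigma_algebra tau (X j) A -> measurable A.
Proof.
move: A; apply: smallest_sub; first exact: sigma_algebra_measurable.
by move=> A [t tt [B mB <-]]; exact: (@mX j t tt).
Qed.

(** [measurable_stochastic_integral], for the sigma-algebra generated by the
    [j]-th process. *)
Lemma stochastic_integral_adapted j :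
  adapted (fun j => process_sigma_algebra tau (X j)) j (fun w => Y j w).
Proof.
move=> B mB; rewrite -[_ @^-1` _]setTI.
apply: (@measurable_stochastic_integral _ (g_sigma_algebraType (G j)) R tau (X j) tau0) => //.
move=> t tt _ A mA; apply: sub_gen_smallest.
by exists t => //; exists A.
Qed.

Lemma sum_stochastic_integral_trig v :
  let a := n%:R * \int[mu]_(t in D) ((1 - cos (v * g t)) * lambda t) in
  let b := n%:R * \int[mu]_(t in D) (sin (v * g t) * lambda t) in
  \int[P]_w cos (v * \sum_j Y j w) = expR (- a) * cos b /\
  \int[P]_w sin (v * \sum_j Y j w) = expR (- a) * sin b.
Proof.
move=> a b; rewrite {}/a {}/b.
have sumE (x : R) : n%:R * x = \sum_(j < n) x by rewrite sumr_const card_ord mulr_natl.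
rewrite !sumE.
under eq_Rintegral do rewrite mulr_sumr.
under [X in _ /\ X = _]eq_Rintegral do rewrite mulr_sumr.
apply: (@independent_trig _ _ _ P n _ indX).
- exact: G_measurable.
- move=> j; exact: (@measurable0 _ (g_sigma_algebraType (G j))).
- move=> j; exact: (@measurableT _ (g_sigma_algebraType (G j))).
- move=> j; apply: (@adapted_comp _ _ _ n (fun j => process_sigma_algebra tau (X j)) j (fun w => Y j w) (fun x => v * x)).
    exact: measurable_funM.
  exact: stochastic_integral_adapted.
- by move=> j; exact: (poisson_integral_cos tau0 mlam lam0 (HX j)).
- by move=> j; exact: (poisson_integral_sin tau0 mlam lam0 (HX j)).
Qed.

Variables (m sigma : R).

Definition standardized_sum w := (\sum_j Y j w - n%:R * m) / sigma.

Lemma standardized_sum_measurable : measurable_fun setT standardized_sum.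
Proof.
apply: measurable_funM => //; apply: measurable_funB => //.
by apply: measurable_bigsum => j; exact: mY.
Qed.

Lemma standardized_sum_integrable : P.-integrable setT (EFin \o standardized_sum).
Proof.
have [h _] := @Rintegral_sum_ord _ _ _ P setT n (fun j w => Y j w) measurableT
  (fun j => stochastic_integral_integrable tau0 mlam lam0 (HX j) mg Ng).
have hc : P.-integrable setT (EFin \o (fun=> n%:R * m)).
  exact: finite_measure_integrable_cst.
have := RintegrableZ measurableT sigma^-1 (RintegrableB measurableT h hc).
by congr (_.-integrable _ _); apply/funext => w; rewrite /= mulrC.
Qed.

Lemma standardized_sum_trig u :
  let v := u / sigma in
  let a := n%:R * \int[mu]_(t in D) ((1 - cos (v * g t)) * lambda t) in
  let b := n%:R * (\int[mu]_(t in D) (sin (v * g t) * lambda t) - v * m) in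
  \int[P]_w cos (u * standardized_sum w) = expR (- a) * cos b /\
  \int[P]_w sin (u * standardized_sum w) = expR (- a) * sin b.
Proof.
move=> v a b.
have uE w : u * standardized_sum w = v * (\sum_j Y j w) - n%:R * v * m.
  by rewrite /standardized_sum /v; ring.
have [hc hs] := sum_stochastic_integral_trig v.
rewrite -/a in hc hs.
pose B := n%:R * \int[mu]_(t in D) (sin (v * g t) * lambda t).
have bE : b = B - n%:R * v * m by rewrite /b mulrBr mulrA.
have mS : measurable_fun setT (fun w => v * (\sum_j Y j w)).
  by apply: measurable_funM => //; apply: measurable_bigsum => j; exact: mY.
have ic : P.-integrable setT (EFin \o (fun w => cos (v * (\sum_j Y j w)))).
  apply: bounded1_Rintegrable; last by move=> w; exact: norm_cos_le1.
  by apply: measurableT_comp => //; apply: continuous_measurable_fun => x; exact: continuous_cos.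
have is_ : P.-integrable setT (EFin \o (fun w => sin (v * (\sum_j Y j w)))).
  apply: bounded1_Rintegrable; last by move=> w; exact: norm_sin_le1.
  by apply: measurableT_comp => //; exact: measurable_sinR.
have icz c := RintegrableZ measurableT c ic.
have isz c := RintegrableZ measurableT c is_.
split.
  under eq_Rintegral do rewrite uE cosB mulrC [X in _ + X]mulrC.
  rewrite (RintegralD measurableT (icz _) (isz _)) (RintegralZl _ measurableT ic).
  rewrite (RintegralZl _ measurableT is_) hc hs bE cosB -/B; ring.
under eq_Rintegral do rewrite uE sinB mulrC [X in _ - X]mulrC.
rewrite (RintegralB measurableT (isz _) (icz _)) (RintegralZl _ measurableT ic).
rewrite (RintegralZl _ measurableT is_) hc hs bE sinB -/B; ring.
Qed.

End independent_sum.

Section sum_expansion.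
Context {R : realType}.
Variables (tau : R) (lambda g : R -> R).
Hypothesis tau0 : 0 < tau.
Local Notation mu := (@lebesgue_measure R).
Local Notation D := (`]0, tau]%classic : set R).
Hypothesis mlam : measurable_fun `[0, tau] lambda.
Hypothesis lam0 : forall t, t \in `[0, tau] -> 0 <= lambda t.
Hypothesis ilam : mu.-integrable D (EFin \o lambda).
Hypothesis mg : measurable_fun setT g.
Hypothesis ig4 : mu.-integrable D (EFin \o (fun t => `|g t| ^+ 4 * lambda t)).
Let m k := \int[mu]_(t in D) (g t ^+ k * lambda t).
Hypothesis m2_gt0 : 0 < m 2.
Variables (v0 delta : R).
Hypothesis v0_gt0 : 0 < v0.
Hypothesis delta_gt0 : 0 < delta.
Hypothesis sin_lower : forall v, v0 < `|v| ->
  delta <= \int[mu]_(t in D) (sin (v * g t) ^+ 2 * lambda t).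

Let Dlam0 t : D t -> 0 <= lambda t.
Proof. by move=> Dt; apply: lam0; exact: subset_itv_oc_cc Dt. Qed.

(** At [v = u / sqrt (n * m 2)], the exponent [n] times that of a single
    integral satisfies the hypotheses of [edgeworth_smoothed] uniformly in
    [n]: the Taylor bounds give the behaviour for moderate [u], and
    [exponent_lower_bound] the decay for all [u]. *)
Lemma standardized_sum_edgeworth : exists2 C : R, 0 <= C &
  forall d (Omega : measurableType d) (P : probability Omega R) n
    (X : 'I_n -> Omega -> cumulative R R) (x : R), (0 < n)%N ->
  (forall j, is_poisson_process P tau lambda (X j)) ->
  independent_processes P tau X ->
  `|\int[P]_w gauss_cdf ((x -
      standardized_sum tau g X (m 1) (Num.sqrt (n%:R * m 2)) w) / Num.sqrt (n%:R ^- 4)) -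
    (gauss_cdf x + m 3 / (m 2 * Num.sqrt (m 2)) / Num.sqrt n%:R / 6 * (1 - x ^+ 2) *
     gauss_pdf x)| <= C / n%:R.
Proof.
have [c1 c1_gt0 hc1] := exponent_lower_bound Dlam0 ilam mg ig4 v0_gt0 delta_gt0 sin_lower.
pose J4 := \int[mu]_(t in D) (`|g t| ^+ 4 * lambda t).
pose J3 := \int[mu]_(t in D) (`|g t| ^+ 3 * lambda t).
have J40 : 0 <= J4 by apply: Rintegral_ge0 => t Dt; rewrite mulr_ge0 ?Dlam0// exprn_ge0.
have J30 : 0 <= J3 by apply: Rintegral_ge0 => t Dt; rewrite mulr_ge0 ?Dlam0// exprn_ge0.
pose s2 := Num.sqrt (m 2).
have s2_gt0 : 0 < s2 by rewrite sqrtr_gt0.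
have s2s2 : s2 ^+ 2 = m 2 by rewrite sqr_sqrtr// ltW.
(* The two ratios serve the bounds of order 4 and 3; the last summand only
   makes [K] positive. *)
pose K := J4 / m 2 ^+ 2 + J3 / (m 2 * s2) + 1.
have k4 : 0 <= J4 / m 2 ^+ 2 by rewrite divr_ge0// sqr_ge0.
have k3 : 0 <= J3 / (m 2 * s2) by rewrite divr_ge0// mulr_ge0// ltW.
have K0 : 0 < K by rewrite /K ltr_wpDl// addr_ge0.
pose c := Num.min (c1 / m 2) c1.
have c0 : 0 < c by rewrite /c lt_min divr_gt0.
have [C C0 HC] := edgeworth_smoothed c0 K0.
exists C => // d Omega P n X x n0 HX indX.
have Ng := weighted_norm_fin Dlam0 ilam mg ig4.
set sigma := Num.sqrt (n%:R * m 2).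
pose q := Num.sqrt (n%:R : R).
have n0R : 0 < n%:R :> R by rewrite ltr0n.
have q_gt0 : 0 < q by rewrite sqrtr_gt0.
have qq : q ^+ 2 = n%:R by rewrite sqr_sqrtr// ltW.
have sigE : sigma = q * s2 by rewrite /sigma sqrtrM// ltW.
have sig_gt0 : 0 < sigma by rewrite sigE mulr_gt0.
pose a u := n%:R * \int[mu]_(t in D) ((1 - cos (u / sigma * g t)) * lambda t).
pose b u := n%:R * (\int[mu]_(t in D) (sin (u / sigma * g t) * lambda t) - u / sigma * m 1).
apply: (HC _ Omega P _ a b) => //.
- exact: standardized_sum_measurable.
- exact: (standardized_sum_integrable tau0 mlam lam0 mg Ng).
- by move=> u; have [] := standardized_sum_trig tau0 mlam lam0 mg Ng HX indX (m 1) sigma u.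
- by move=> u; have [] := standardized_sum_trig tau0 mlam lam0 mg Ng HX indX (m 1) sigma u.
- move=> u; have := hc1 (u / sigma).
  rewrite -(ler_pM2l n0R) -/(a u) => h.
  have [v1|v1] := leP ((u / sigma) ^+ 2) 1.
    rewrite (@le_trans _ _ (expR (- (c * u ^+ 2))))// ?lerDl ?expR_ge0// ler_expR lerN2.
    apply: le_trans h; rewrite min_l// sigE.
    have -> : n%:R * (c1 * (u / (q * s2)) ^+ 2) = c1 / m 2 * u ^+ 2.
      by rewrite -qq -s2s2; field; rewrite !gt_eqF.
    by rewrite ler_wpM2r ?sqr_ge0// /c ge_min lexx.
  rewrite (@le_trans _ _ (expR (- (c * n%:R))))// ?lerDr ?expR_ge0// ler_expR lerN2.
  apply: le_trans h; rewrite min_r ?(ltW v1)// mulr1 mulrC ler_wpM2l ?(ltW n0R)//.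
  by rewrite /c ge_min lexx orbT.
- move=> u; have h := exponent_real_part Dlam0 ilam mg ig4 (u / sigma).
  rewrite -/J4 -/(m 2) in h.
  have -> : a u - u ^+ 2 / 2 =
      n%:R * (\int[mu]_(t in D) ((1 - cos (u / sigma * g t)) * lambda t) -
              (u / sigma) ^+ 2 * m 2 / 2).
    rewrite mulrBr -/(a u); congr (_ - _).
    by rewrite sigE -qq -s2s2; field; rewrite !gt_eqF.
  rewrite normrM (ger0_norm (ltW n0R)).
  apply: (le_trans (ler_wpM2l (ltW n0R) h)).
  have -> : n%:R * (`|u / sigma| ^+ 4 * J4) = (J4 / m 2 ^+ 2) * `|u| ^+ 4 / n%:R.
    by rewrite normf_div (gtr0_norm sig_gt0) sigE -qq -s2s2; field; rewrite !gt_eqF.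
  rewrite ler_wpM2r ?invr_ge0 ?(ltW n0R)// ler_wpM2r ?exprn_ge0//.
  by rewrite /K -addrA lerDl addr_ge0.
- move=> u; have h := exponent_imag_part3 Dlam0 ilam mg ig4 (u / sigma).
  rewrite -/J3 -/(m 1) in h.
  rewrite normrM (ger0_norm (ltW n0R)).
  apply: (le_trans (ler_wpM2l (ltW n0R) h)).
  have -> : n%:R * (`|u / sigma| ^+ 3 * J3) = (J3 / (m 2 * s2)) * `|u| ^+ 3 / q.
    by rewrite normf_div (gtr0_norm sig_gt0) sigE -qq -s2s2; field; rewrite !gt_eqF.
  rewrite ler_wpM2r ?invr_ge0 ?(ltW q_gt0)// ler_wpM2r ?exprn_ge0//.
  by rewrite /K -addrA addrCA lerDl addr_ge0.
- move=> u; have h := exponent_imag_part4 Dlam0 ilam mg ig4 (u / sigma).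
  rewrite -/J4 -/(m 1) -/(m 3) in h.
  have -> : b u + m 3 / (m 2 * s2) / q * u ^+ 3 / 6 =
      n%:R * (\int[mu]_(t in D) (sin (u / sigma * g t) * lambda t) - u / sigma * m 1 +
              (u / sigma) ^+ 3 * m 3 / 6).
    rewrite mulrDr -/(b u); congr (_ + _).
    by rewrite sigE -qq -s2s2; field; rewrite !gt_eqF.
  rewrite normrM (ger0_norm (ltW n0R)).
  apply: (le_trans (ler_wpM2l (ltW n0R) h)).
  have -> : n%:R * (`|u / sigma| ^+ 4 * J4) = (J4 / m 2 ^+ 2) * `|u| ^+ 4 / n%:R.
    by rewrite normf_div (gtr0_norm sig_gt0) sigE -qq -s2s2; field; rewrite !gt_eqF.
  rewrite ler_wpM2r ?invr_ge0 ?(ltW n0R)// ler_wpM2r ?exprn_ge0//.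
  by rewrite /K -addrA lerDl addr_ge0.
Qed.

End sum_expansion.

(** * The moment function, its inverse and the estimator *)

(** The definition of the derivative, in the form of an error bound. *)
Lemma is_derive_peano {R : realType} (f : R -> R) (x d : R) : is_derive x 1 f d ->
  forall e : R, 0 < e -> exists2 rho : R, 0 < rho &
    forall h, `|h| < rho -> `|f (x + h) - f x - d * h| <= e * `|h|.
Proof.
move=> [df dfE] e e0.
have : h^-1 * (f (h + x) - f x) @[h --> 0^'] --> d.
  rewrite -dfE; have := df; rewrite /derivable /derive => /cvg_ex[l hl].
  rewrite (cvg_lim _ hl)//; apply: cvg_trans hl.
  by apply: near_eq_cvg; near=> h; rewrite /GRing.scale/= mulr1.
move=> /cvgrPdist_le/(_ _ e0)/nbhs_ballP[r r0 hr].
exists r => // h hh; have [->|h0] := eqVneq h 0.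
  by rewrite addr0 subrr mulr0 subrr !normr0 mulr0.
have := hr h; rewrite /ball/= sub0r normrN => /(_ hh h0).
rewrite -(ler_pM2r (x := `|h|)) ?normr_gt0// -normrM.
have -> : f (x + h) - f x - d * h = - ((d - h^-1 * (f (h + x) - f x)) * h).
  by rewrite (addrC h x); field.
by rewrite normrN.
Unshelve. all: by end_near. Qed.

Section moment_function.
Context {R : realType}.
Variables (alpha beta : R) (m G : R -> R) (theta0 : R).
Local Notation I := (`]alpha, beta[).
Hypothesis theta0_in : theta0 \in I.
Hypothesis L1 : condL1 2 alpha beta m.
Hypothesis L2 : condL2 alpha beta m.
Hypothesis invG : is_inverse_on alpha beta m G.

Let derivable_m (theta : R) : theta \in I -> is_derive theta 1 m (m^`()%classic theta).
Proof.
move=> tI; case: L1 => /(_ 0%N theta isT tI) dm _.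
by rewrite derive1E; exact: derivableP.
Qed.

Let derivable_m1 (theta : R) : theta \in I ->
  is_derive theta 1 (m^`()%classic) (m^`(2)%classic theta).
Proof.
move=> tI; case: L1 => /(_ 1%N theta isT tI) dm _.
rewrite -[X in is_derive _ _ X _]/(m^`(1)%classic).
rewrite -[m^`(2)%classic theta]/((m^`(1)%classic)^`()%classic theta) derive1E.
exact: derivableP.
Qed.

Let continuous_m (theta : R) : theta \in I -> {for theta, continuous m}.
Proof. by move=> tI; exact: continuous_of_is_derive (derivable_m tI). Qed.

Let closed_ext_in theta : theta \in I -> closed_ext alpha beta m theta = m theta.
Proof.
rewrite in_itv/= => /andP[at_ tb]; rewrite /closed_ext.
by rewrite !leNgt at_ tb.
Qed.

Let I_cc theta : theta \in I -> theta \in `[alpha, beta].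
Proof. by rewrite !in_itv/= => /andP[/ltW -> /ltW ->]. Qed.

Let mK : {in I, cancel m G}.
Proof. by move=> theta tI; rewrite -(closed_ext_in tI) invG// I_cc. Qed.

Lemma moment_derive1_neq0 theta : theta \in I -> m^`()%classic theta != 0.
Proof.
move=> tI; case: L2 => _ inf0; rewrite -normr_gt0; apply: lt_le_trans inf0 _.
apply: ge_inf; last by exists theta.
by exists 0 => _ [x _ <-].
Qed.

Let near_I (theta : R) : theta \in I -> \forall x \near theta, x \in I.
Proof.
by rewrite in_itv/= => /andP[at_ tb]; near=> x; rewrite in_itv/=; apply/andP; split; near: x;
  [exact: lt_nbhsr | exact: lt_nbhsl].
Unshelve. all: by end_near. Qed.

Let near_mK (theta : R) : theta \in I -> {near theta, cancel m G}.
Proof. by move=> /near_I; apply: filterS => x; exact: mK. Qed.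

Let near_continuous_m (theta : R) : theta \in I -> {near theta, continuous m}.
Proof. by move=> /near_I; apply: filterS => x; exact: continuous_m. Qed.

Let derivable_G (theta : R) : theta \in I ->
  is_derive (m theta) 1 G (m^`()%classic theta)^-1.
Proof.
move=> tI; apply: is_derive_inverse.
- exact: near_mK.
- exact: near_continuous_m.
- exact: derivable_m.
- exact: moment_derive1_neq0.
Qed.

Lemma psi1E : psi m G theta0 1 = (m^`()%classic theta0)^-1.
Proof.
rewrite /psi divr1 -[G^`(1)%classic]/(G^`()%classic) derive1E.
by have /@derive_val := derivable_G theta0_in.
Qed.

(** Near [m theta0] one has [G' = 1 / (m' \o G)]; differentiate once more. *)
Lemma psi2E : psi m G theta0 2 =
  - m^`(2)%classic theta0 / (2 * m^`()%classic theta0 ^+ 3).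
Proof.
have d0 := moment_derive1_neq0 theta0_in.
have [cG GK] := near_can_continuousAcan_sym (near_mK theta0_in) (near_continuous_m theta0_in).
have G0 : G (m theta0) = theta0 by exact: mK.
have cG0 : {for m theta0, continuous G} by exact: nbhs_singleton cG.
have GE : \forall y \near m theta0, (m^`()%classic (G y))^-1 = G^`()%classic y.
  have GI : \forall y \near m theta0, G y \in I.
    have c1 : G y @[y --> m theta0] --> theta0 by rewrite -[X in _ --> X]G0; exact: cG0.
    exact: c1 _ (near_I theta0_in).
  near=> y.
  have Gy : G y \in I by near: y.
  have mGy : m (G y) = y by near: y.
  have := derivable_G Gy; rewrite mGy => /@derive_val <-.
  by rewrite derive1E.
have dm1G : is_derive (m theta0) 1 (fun y => m^`()%classic (G y))
    (m^`(2)%classic theta0 * (m^`()%classic theta0)^-1).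
  apply: is_derive1_comp; rewrite ?G0; first exact: derivable_m1.
  exact: derivable_G.
have d2 : is_derive (m theta0) 1 (G^`()%classic)
    (- m^`(2)%classic theta0 / m^`()%classic theta0 ^+ 3).
  apply: near_eq_is_derive GE _.
  have h : m^`()%classic (G (m theta0)) != 0 -> _ := fun h0 => @is_deriveV _ (fun y => m^`()%classic (G y)) (m theta0) _ 1 h0 dm1G.
  eapply is_derive_congr; first by apply: h; rewrite G0.
  by rewrite /GRing.scale/= G0; field.
rewrite /psi -[G^`(2)%classic _]/((G^`()%classic)^`()%classic (m theta0)).
rewrite derive1E (@derive_val _ _ _ _ _ _ _ d2).
by rewrite (_ : 2`!%N = 2%N)//; field.
Unshelve. all: by end_near. Qed.

Hypothesis psi1_gt0 : 0 < psi m G theta0 1.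

Lemma moment_derive1_gt0 : 0 < m^`()%classic theta0.
Proof. by move: psi1_gt0; rewrite psi1E invr_gt0. Qed.

(** A positive derivative of [G] at one point excludes that [m] is
    nonincreasing, and [m] is injective because it has the left inverse [G].
    *)
Lemma moment_increasing : {in I &, forall x y, x < y -> m x < m y}.
Proof.
have inj x y : x \in I -> y \in I -> m x = m y -> x = y.
  by move=> xI yI /(congr1 G); rewrite !mK.
case: L2 => -[mono|mono] _ x y xI yI xy.
  rewrite lt_neqAle mono ?(ltW xy)// andbT; apply/eqP => /(inj _ _ xI yI) e.
  by rewrite e ltxx in xy.
have /negP[] : ~~ (m^`()%classic theta0 <= 0) by rewrite -ltNge moment_derive1_gt0.
apply: (@decr_derive1_le0_itv R m false true alpha beta) => //.
  by move=> z /set_mem/= zI; case: L1 => /(_ 0%N z isT zI).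
move=> u v uI vI uv; rewrite lt_neqAle mono ?(ltW uv)// andbT.
by apply/eqP => /(inj _ _ _ _) e; rewrite e// ltxx in uv.
Qed.

Let nondecr : {in I &, {homo m : x y / x <= y}}.
Proof.
move=> x y xI yI; rewrite le_eqVlt => /orP[/eqP -> //|xy].
by rewrite ltW// moment_increasing.
Qed.

(** This ensures that the limits of [m] at the endpoints exist, so that
    [closed_ext] takes its intended values there. *)
Lemma moment_bounded : exists B : R, forall x, x \in I -> `|m x| <= B.
Proof.
case: L1 => _ /(_ 1%N isT)[_ [M hM]].
exists (`|m theta0| + M * (beta - alpha)) => x xI.
have M0 : 0 <= M by exact: le_trans (hM _ theta0_in).
have bd (u v : R) : u \in I -> v \in I -> u <= v -> `|m v - m u| <= M * (beta - alpha).
  move=> uI vI uv.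
  have sub z : z \in `[u, v] -> z \in I.
    move: uI vI; rewrite !in_itv/= => /andP[au _] /andP[_ vb] /andP[uz zv].
    by rewrite (lt_le_trans au uz) (le_lt_trans zv vb).
  have [c cI ->] : exists2 c, c \in `[u, v] & m v - m u = m^`()%classic c * (v - u).
    apply: MVT_segment => //.
      by move=> z zI; apply: derivable_m; apply: sub; exact: subset_itv_oo_cc zI.
    by apply: continuous_in_subspaceT => z /set_mem/= zI; apply: continuous_m; exact: sub.
  rewrite normrM (ger0_norm (_ : 0 <= v - u)) ?subr_ge0// ler_pM// ?subr_ge0//.
    exact: hM (sub _ cI).
  move: uI vI; rewrite !in_itv/= => /andP[au _] /andP[_ vb].
  by rewrite lerB// ltW.
have [h|/ltW h] := leP theta0 x.
  rewrite -[m x](subrK (m theta0)) addrC (le_trans (ler_normD _ _))// lerD2l.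
  exact: bd.
rewrite -[m x](subrK (m theta0)) addrC (le_trans (ler_normD _ _))// lerD2l distrC.
exact: bd.
Qed.

Let ab : alpha < beta.
Proof. by move: theta0_in; rewrite in_itv/= => /andP[]; exact: lt_trans. Qed.

Let closed_ext_alpha x : x \in I -> closed_ext alpha beta m alpha <= m x.
Proof.
move=> xI; rewrite /closed_ext lexx.
have [B hB] := moment_bounded.
have lb : has_lbound (m @` [set` `]alpha, beta[]).
  by exists (- B) => _ [z zI <-]; have := hB z zI; rewrite ler_norml => /andP[].
have c := @nondecreasing_at_right_cvgr R m alpha (BLeft beta) ltac:(by rewrite bnd_simp) nondecr lb.
rewrite (cvg_lim _ c)//; apply: ge_inf => //; by exists x.
Qed.

Let closed_ext_beta x : x \in I -> m x <= closed_ext alpha beta m beta.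
Proof.
move=> xI; rewrite /closed_ext ifN -?ltNge// lexx.
have [B hB] := moment_bounded.
have c : cvg (m z @[z --> beta^'-]).
  apply: nondecreasing_at_left_is_cvgr.
    near=> a => u v; rewrite !in_itv/= => /andP[au ub] /andP[av vb]; apply: nondecr.
    + by rewrite in_itv/= ub (lt_trans _ au)//; near: a; exact: nbhs_left_gt.
    + by rewrite in_itv/= vb (lt_trans _ av)//; near: a; exact: nbhs_left_gt.
  near=> a; exists B => _ [z + <-]; rewrite /= in_itv/= => /andP[az zb].
  apply: le_trans (ler_norm _) _; apply: hB; rewrite in_itv/= zb andbT.
  by apply: lt_trans az; near: a; exact: nbhs_left_gt.
apply: limr_ge => //; near=> z; apply: nondecr => //.
- rewrite in_itv/=; apply/andP; split; near: z; [exact: nbhs_left_gt|exact: nbhs_left_lt].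
- apply: ltW; near: z; apply: nbhs_left_gt.
  by move: xI; rewrite in_itv/= => /andP[].
Unshelve. all: by end_near. Qed.

Let closed_ext_lt th c : th \in `[alpha, beta] -> c \in I -> th < c ->
  closed_ext alpha beta m th < m c.
Proof.
move=> thI cI thc; have [e|ne] := eqVneq th alpha.
  have xI : (alpha + c) / 2 \in I.
    by move: cI; rewrite !in_itv/= => /andP[ac cb]; rewrite midf_lt//= (lt_trans (midf_lt ac).2).
  rewrite e; apply: (le_lt_trans (closed_ext_alpha xI)); apply: moment_increasing => //.
  by move: cI; rewrite in_itv/= => /andP[ac _]; rewrite (midf_lt ac).
have tI : th \in I.
  move: thI cI; rewrite !in_itv/= => /andP[at_ _] /andP[_ cb].
  by rewrite lt_neqAle eq_sym ne at_ (lt_trans thc cb).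
by rewrite closed_ext_in// moment_increasing.
Qed.

Let closed_ext_ge th c : th \in `[alpha, beta] -> c \in I -> c <= th ->
  m c <= closed_ext alpha beta m th.
Proof.
move=> thI cI cth; have [->|ne] := eqVneq th beta; first exact: closed_ext_beta.
have tI : th \in I.
  move: thI cI; rewrite !in_itv/= => /andP[_ tb] /andP[ac _].
  by apply/andP; split; [exact: lt_le_trans ac cth | rewrite lt_neqAle ne].
by rewrite closed_ext_in// nondecr.
Qed.

(** If the estimate lies on the wrong side of [c], then [c], or a point
    slightly below [c], fits the empirical moment strictly better. *)
Lemma mme_lt mbar th c : is_mme alpha beta m mbar th -> c \in I ->
  (th < c) = (mbar < m c).
Proof.
move=> [thI hmin] cI; apply/idP/idP => [thc|].
  rewrite ltNge; apply/negP => cm.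
  have h1 := closed_ext_lt thI cI thc.
  have := hmin c (I_cc cI); rewrite (closed_ext_in cI) leNgt => /negP; apply.
  rewrite -[ltLHS]sqrrN -[ltRHS]sqrrN !opprB ltr_sqr ?nnegrE ?subr_ge0//.
    by rewrite ltrD2l ltrN2.
  exact: ltW (lt_le_trans h1 cm).
move=> mc; rewrite ltNge; apply/negP => cth.
have h1 := closed_ext_ge thI cI cth.
have [x xI /andP[xc mx]] : exists2 x, x \in I & (x < c) && (mbar < m x).
  have N1 := near_I cI.
  have N2 : \forall x \near c, mbar < m x.
    by have /cvgr_gt := continuous_m cI; apply.
  have N : \forall x \near c^'-, x \in I /\ mbar < m x.
    by apply: cvg_at_left_filter; [exact: cvg_id|]; near=> x; split; near: x.
  near c^'- => x; exists x; first by have [] : x \in I /\ mbar < m x by near: x.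
  apply/andP; split; first by near: x; exact: nbhs_left_lt.
  by have [] : x \in I /\ mbar < m x by near: x.
have := hmin x (I_cc xI); rewrite (closed_ext_in xI) leNgt => /negP; apply.
have mxc : m x < m c by exact: moment_increasing.
rewrite ltr_sqr ?nnegrE ?subr_ge0 ?(ltW mx)//; last first.
  by rewrite (le_trans _ h1)// ltW.
by rewrite ltrD2r (lt_le_trans mxc).
Unshelve. all: by end_near. Qed.

(** Taylor with the Peano remainder: the derivative of the remainder is
    [o(h)], hence the remainder is [o(h ^ 2)] by the mean value theorem. *)
Lemma moment_taylor2 e : 0 < e -> exists2 rho : R, 0 < rho &
  forall h, `|h| <= rho -> theta0 + h \in I /\
    `|m (theta0 + h) - m theta0 - m^`()%classic theta0 * h -
      m^`(2)%classic theta0 / 2 * h ^+ 2| <= e * h ^+ 2.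
Proof.
move=> e0.
set m1 := m^`()%classic theta0; set m2 := m^`(2)%classic theta0.
have [rho1 rho1_gt0 hI] : exists2 rho : R, 0 < rho & forall h, `|h| < rho -> theta0 + h \in I.
  have /nbhs_ballP[r r0 hr] := near_I theta0_in.
  by exists r => // h hr'; apply: hr; rewrite /ball/= opprD addrA subrr sub0r normrN.
have [rho2 rho2_gt0 hd] : exists2 rho : R, 0 < rho & forall h, `|h| < rho ->
    `|m^`()%classic (theta0 + h) - m1 - m2 * h| <= e * `|h|.
  have [r r0 hr] := @is_derive_peano R _ _ _ (derivable_m1 theta0_in) e e0.
  by exists r.
exists (Num.min rho1 rho2 / 2); first by rewrite divr_gt0// lt_min rho1_gt0.
move=> h hr.
have hlt (z : R) : `|z| <= `|h| -> `|z| < rho1 /\ `|z| < rho2.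
  move=> zh; apply/andP; rewrite -lt_min; apply: le_lt_trans (le_trans zh hr) _.
  by rewrite ltr_pdivrMr// ltr_pMr ?ltr1n// lt_min rho1_gt0.
split; first by apply: hI; have [] := hlt h (lexx _).
pose F z := m (theta0 + z) - m theta0 - m1 * z - m2 / 2 * z ^+ 2.
have dF (z : R) : `|z| <= `|h| ->
    is_derive z 1 F (m^`()%classic (theta0 + z) - m1 - m2 * z).
  move=> zh; have zI : theta0 + z \in I by apply: hI; have [] := hlt z zh.
  have dshift : is_derive z 1 (fun x => m (theta0 + x)) (m^`()%classic (theta0 + z)).
    have d0 : is_derive z 1 (fun x : R => theta0 + x) 1 by derive_by; ring.
    have := @is_derive1_comp R m (fun x => theta0 + x) z _ _ (derivable_m zI) d0.
    by rewrite mulr1.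
  by rewrite /F; derive_by; field.
have sub (u v z : R) : `|u| <= `|h| -> `|v| <= `|h| -> z \in `[u, v] -> `|z| <= `|h|.
  rewrite in_itv/= !ler_norml => /andP[u1 u2] /andP[v1 v2] /andP[uz zv].
  by rewrite (le_trans u1 uz) (le_trans zv v2).
have bd (u v : R) : `|u| <= `|h| -> `|v| <= `|h| -> u <= v -> `|F v - F u| <= e * `|h| * (v - u).
  move=> uh vh uv.
  have [c cI ->] : exists2 c, c \in `[u, v] &
      F v - F u = (m^`()%classic (theta0 + c) - m1 - m2 * c) * (v - u).
    apply: (@MVT_segment R F (fun z => m^`()%classic (theta0 + z) - m1 - m2 * z)) => //.
      by move=> z zI; apply: dF; apply: (sub u v) => //; exact: subset_itv_oo_cc zI.
    apply: continuous_in_subspaceT => z /set_mem/= zI.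
    exact: continuous_of_is_derive (dF z (sub u v z uh vh zI)).
  rewrite normrM (ger0_norm (_ : 0 <= v - u)) ?subr_ge0// ler_wpM2r ?subr_ge0//.
  have ch := sub u v c uh vh cI.
  apply: (le_trans (hd c _)); first by have [] := hlt c ch.
  by rewrite ler_wpM2l// ltW.
have F0 : F 0 = 0 by rewrite /F addr0; ring.
have z0 : `|0 : R| <= `|h| by rewrite normr0.
rewrite -/(F h) -(real_normK (num_real h)) expr2 mulrA.
have [h0|/ltW h0] := leP 0 h.
  by have := bd 0 h z0 (lexx _) h0; rewrite F0 !subr0 (ger0_norm h0).
by have := bd h 0 (lexx _) z0 h0; rewrite F0 !sub0r normrN (ler0_norm h0).
Qed.

End moment_function.

(** * Expansion of the distribution of the estimator *)

(** The argument of the expansion may be moved by [o(ep)] without affecting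
    the conclusion, and its first-order displacement [- b * ep] enters only
    through the derivative of [gauss_cdf]. *)
Lemma edgeworth_perturbation {R : realType} (kap b y eta : R) : 0 < eta ->
  exists2 delta : R, 0 < delta & forall ep z, 0 < ep -> ep <= delta ->
    `|z - (y - b * ep)| <= delta * ep ->
    `|gauss_cdf z + kap * ep / 6 * (1 - z ^+ 2) * gauss_pdf z -
      (gauss_cdf y + (kap / 6 * (1 - y ^+ 2) - b) * gauss_pdf y * ep)| <= eta * ep.
Proof.
move=> eta0.
(* [K * ep] bounds the displacement of [z] from [y], since [delta <= 1]. *)
pose K := `|b| + 1.
have K0 : 0 < K by rewrite ltr_wpDl.
have e1_gt0 : 0 < eta / (3 * K) by rewrite divr_gt0// mulr_gt0.
have [rho1 rho1_gt0 h1] := is_derive_peano (is_derive_gauss_cdf y) e1_gt0.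
pose q (z : R) := (1 - z ^+ 2) * gauss_pdf z.
have k6 : 0 < `|kap / 6| + 1 by rewrite ltr_wpDl.
have e3_gt0 : 0 < eta / (3 * (`|kap / 6| + 1)) by rewrite divr_gt0// mulr_gt0.
have cq : {for y, continuous q}.
  apply: cvgM; last exact: continuous_gauss_pdf.
  by apply: cvgB; [exact: cvg_cst | exact: exprn_continuous].
have [rho2 rho2_gt0 h2] : exists2 r : R, 0 < r & forall z, `|z - y| < r ->
    `|q z - q y| <= eta / (3 * (`|kap / 6| + 1)).
  move/cvgrPdist_le : cq => /(_ _ e3_gt0)/nbhs_ballP[r r0 hr].
  by exists r => // z zy; rewrite distrC; apply: hr; rewrite /ball/= distrC.
have p0 := gauss_pdf_ge0 y.
have pp : 0 < gauss_pdf y + 1 by rewrite ltr_wpDl.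
pose r := Num.min rho1 rho2 / (2 * K).
have r0 : 0 < r by rewrite divr_gt0 ?mulr_gt0// lt_min rho1_gt0.
pose delta := Num.min (Num.min 1 r) (eta / (3 * (gauss_pdf y + 1))).
have delta_gt0 : 0 < delta.
  by rewrite !lt_min ltr01 r0 divr_gt0// mulr_gt0.
exists delta => // ep z ep0 epd hz.
have d1 : delta <= 1 by rewrite !ge_min lexx.
have d2 : delta <= r by rewrite !ge_min lexx orbT.
have d3 : delta <= eta / (3 * (gauss_pdf y + 1)) by rewrite ge_min lexx orbT.
have zy : `|z - y| <= K * ep.
  have -> : z - y = (z - (y - b * ep)) - b * ep by ring.
  rewrite (le_trans (ler_normB _ _))// normrM (gtr0_norm ep0) /K addrC mulrDl mul1r lerD2l.
  by apply: (le_trans hz); rewrite ler_piMl// ltW.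
have zyr : `|z - y| < Num.min rho1 rho2.
  apply: (le_lt_trans zy); apply: (@le_lt_trans _ _ (K * r)).
    by rewrite ler_wpM2l ?(ltW K0)// (le_trans epd).
  have -> : K * r = Num.min rho1 rho2 / 2 by rewrite /r; field; rewrite gt_eqF.
  by rewrite ltr_pdivrMr// ltr_pMr ?ltr1n// lt_min rho1_gt0.
move: zyr; rewrite lt_min => /andP[z1 z2].
have b1 := h1 _ z1; rewrite (addrC y (z - y)) subrK in b1.
have b2 := h2 _ z2.
have -> : gauss_cdf z + kap * ep / 6 * (1 - z ^+ 2) * gauss_pdf z -
      (gauss_cdf y + (kap / 6 * (1 - y ^+ 2) - b) * gauss_pdf y * ep) =
    (gauss_cdf z - gauss_cdf y - gauss_pdf y * (z - y)) +
    (gauss_pdf y * (z - (y - b * ep)) + ep * (kap / 6 * (q z - q y))).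
  by rewrite /q; field.
have t1 : `|gauss_cdf z - gauss_cdf y - gauss_pdf y * (z - y)| <= eta / 3 * ep.
  apply: (le_trans b1); apply: (@le_trans _ _ (eta / (3 * K) * (K * ep))).
    by rewrite ler_wpM2l// ltW.
  by rewrite le_eqVlt; apply/orP; left; apply/eqP; field; rewrite gt_eqF.
have t2 : `|gauss_pdf y * (z - (y - b * ep))| <= eta / 3 * ep.
  rewrite normrM (ger0_norm p0); apply: (@le_trans _ _ ((gauss_pdf y + 1) * (delta * ep))).
    by rewrite ler_pM// lerDl.
  rewrite mulrA ler_wpM2r ?(ltW ep0)//.
  apply: (le_trans (ler_wpM2l (ltW pp) d3)).
  by rewrite le_eqVlt; apply/orP; left; apply/eqP; field; rewrite gt_eqF.
have t3 : `|ep * (kap / 6 * (q z - q y))| <= eta / 3 * ep.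
  rewrite normrM (gtr0_norm ep0) mulrC ler_wpM2r ?(ltW ep0)// normrM.
  apply: (@le_trans _ _ ((`|kap / 6| + 1) * (eta / (3 * (`|kap / 6| + 1))))).
    by rewrite ler_pM// lerDl.
  by rewrite le_eqVlt; apply/orP; left; apply/eqP; field; rewrite gt_eqF.
rewrite (le_trans (ler_normD _ _))//.
have t4 := ler_normD (gauss_pdf y * (z - (y - b * ep))) (ep * (kap / 6 * (q z - q y))).
have -> : eta * ep = eta / 3 * ep + (eta / 3 * ep + eta / 3 * ep) by field.
by rewrite lerD// (le_trans t4)// lerD.
Qed.

(** The threshold [c] of the estimator corresponds to the threshold [y - b2 *
    y ^ 2 * ep + o(ep)] of the standardized sum: insert [psi1E] and [psi2E] in
    the second-order Taylor expansion of [m]. Here [ep] stands for [1 / sqrt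
    n]. *)
Lemma moment_threshold {R : realType} (alpha beta : R) (m G : R -> R) (theta0 a2 y : R) :
  theta0 \in `]alpha, beta[ -> condL1 2 alpha beta m -> condL2 alpha beta m ->
  is_inverse_on alpha beta m G -> 0 < psi m G theta0 1 -> 0 < a2 ->
  forall e : R, 0 < e -> exists2 delta : R, 0 < delta & forall ep c : R,
    0 < ep -> ep <= delta -> c = theta0 + psi m G theta0 1 * Num.sqrt a2 * y * ep ->
    (c \in `]alpha, beta[) /\
    `|(m c - m theta0) / (ep * Num.sqrt a2) -
      (y - psi m G theta0 2 * Num.sqrt a2 / psi m G theta0 1 * y ^+ 2 * ep)| <= e * ep.
Proof.
move=> t0 L1 L2 iG psi10 a20 e e0.
have m10 := moment_derive1_gt0 t0 L1 L2 iG psi10.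
rewrite (psi1E t0 L1 L2 iG) (psi2E t0 L1 L2 iG).
have := fun e e0 => @moment_taylor2 R alpha beta m theta0 t0 L1 e e0.
set m1 := m^`()%classic theta0 in m10 *; set m2 := m^`(2)%classic theta0.
move=> taylor.
have s0 : 0 < Num.sqrt a2 by rewrite sqrtr_gt0.
set s := Num.sqrt a2 in s0 *.
pose k := m1^-1 * s * y.
have kk : 0 < k ^+ 2 / s + 1 by rewrite ltr_wpDl// divr_ge0 ?sqr_ge0// ltW.
(* The remainder [e' * (k * ep) ^ 2] is divided by [ep * s] below; the summand
   1 guards against [k = 0]. *)
have e'0 : 0 < e / (k ^+ 2 / s + 1) by rewrite divr_gt0.
have [rho rho0 hrho] := taylor _ e'0.
have k1 : 0 < `|k| + 1 by rewrite ltr_wpDl.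
exists (rho / (`|k| + 1)); first by rewrite divr_gt0.
move=> ep c ep0 epd cE.
have hk : `|k * ep| <= rho.
  rewrite normrM (gtr0_norm ep0) (@le_trans _ _ ((`|k| + 1) * ep))//.
    by rewrite ler_wpM2r ?(ltW ep0)// lerDl.
  by rewrite mulrC -ler_pdivlMr.
have [cI hc] := hrho _ hk.
rewrite -/k in cE; rewrite -cE in cI hc; split => //.
have -> : (m c - m theta0) / (ep * s) - (y - - m2 / (2 * m1 ^+ 3) * s / m1^-1 * y ^+ 2 * ep) =
    (m c - m theta0 - m1 * (k * ep) - m2 / 2 * (k * ep) ^+ 2) / (ep * s).
  by rewrite cE /k; field; rewrite !gt_eqF.
rewrite normf_div (gtr0_norm (mulr_gt0 ep0 s0)) ler_pdivrMr ?mulr_gt0//.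
apply: (le_trans hc).
have -> : e / (k ^+ 2 / s + 1) * (k * ep) ^+ 2 =
    (e * ep * (ep * s)) * ((k ^+ 2 / s) / (k ^+ 2 / s + 1)).
  have ks : 0 < k ^+ 2 + s by rewrite ltr_wpDl ?sqr_ge0.
  by field; rewrite !gt_eqF.
by rewrite ler_piMr ?mulr_ge0 ?(ltW e0) ?(ltW ep0) ?(ltW s0)// ler_pdivrMr// mul1r lerDl.
Qed.

Lemma final_sandwich {R : realType} (h1 h2 t u eta ep p : R) :
  - (eta / 2 * ep) <= h1 - t -> h2 - t <= eta / 2 * ep -> u <= eta / 2 * ep ->
  h1 - u <= p -> p <= h2 + u -> - (eta * ep) <= p - t <= eta * ep.
Proof.
have -> : eta * ep = eta / 2 * ep + eta / 2 * ep by field.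
by move: (eta / 2 * ep) => r *; apply/andP; split; lra.
Qed.

Lemma smoothing_sandwich {R : realType} (h1 h2 E1 E2 u v t p : R) :
  - u <= E1 - h1 -> E2 - h2 <= u -> t <= v -> E1 - t <= p -> p <= E2 + t ->
  h1 - (u + v) <= p <= h2 + (u + v).
Proof. by move=> *; apply/andP; split; lra. Qed.

Section distribution_bounds.
Context {R : realType}.
Variables (tau : R) (lambda g : R -> R).
Hypothesis tau0 : 0 < tau.
Local Notation mu := (@lebesgue_measure R).
Local Notation D := (`]0, tau]%classic : set R).
Hypothesis mlam : measurable_fun `[0, tau] lambda.
Hypothesis lam0 : forall t, t \in `[0, tau] -> 0 <= lambda t.
Hypothesis ilam : mu.-integrable D (EFin \o lambda).
Hypothesis mg : measurable_fun setT g.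
Hypothesis ig4 : mu.-integrable D (EFin \o (fun t => `|g t| ^+ 4 * lambda t)).
Let m k := \int[mu]_(t in D) (g t ^+ k * lambda t).
Hypothesis m2_gt0 : 0 < m 2.
Variables (v0 delta : R).
Hypothesis v0_gt0 : 0 < v0.
Hypothesis delta_gt0 : 0 < delta.
Hypothesis sin_lower : forall v, v0 < `|v| ->
  delta <= \int[mu]_(t in D) (sin (v * g t) ^+ 2 * lambda t).

Let Dlam0 t : D t -> 0 <= lambda t.
Proof. by move=> Dt; apply: lam0; exact: subset_itv_oc_cc Dt. Qed.

Let H n (x : R) := gauss_cdf x +
  m 3 / (m 2 * Num.sqrt (m 2)) / Num.sqrt n%:R / 6 * (1 - x ^+ 2) * gauss_pdf x.

(** Removes the smoothing with [s = n ^ -4] and [A = n]: the shift is [sqrt s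
    * A = 1 / n], and the tail [gauss_cdf (- n)] is [O(1 / n)]. *)
Lemma standardized_sum_cdf_bounds : exists2 C : R, 0 <= C &
  forall d (Omega : measurableType d) (P : probability Omega R) n
    (X : 'I_n -> Omega -> cumulative R R) (x : R), (0 < n)%N ->
  (forall j, is_poisson_process P tau lambda (X j)) ->
  independent_processes P tau X ->
  forall p : R, p = fine (P [set w |
    standardized_sum tau g X (m 1) (Num.sqrt (n%:R * m 2)) w < x]) ->
  H n (x - n%:R^-1) - C / n%:R <= p <= H n (x + n%:R^-1) + C / n%:R.
Proof.
have [C C0 HC] := standardized_sum_edgeworth tau0 mlam lam0 ilam mg ig4 m2_gt0
  v0_gt0 delta_gt0 sin_lower.
have [C1 C10 HC1] := @gauss_cdf_tail R.
exists (C + C1); first by rewrite addr_ge0// ltW.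
move=> d Omega P n X x n0 HX indX p pE.
have n0R : 0 < n%:R :> R by rewrite ltr0n.
have mS := standardized_sum_measurable tau0 mg HX (m 1) (Num.sqrt (n%:R * m 2)).
have s0 : 0 < n%:R ^- 4 :> R by rewrite invr_gt0 exprn_gt0.
have sE : Num.sqrt (n%:R ^- 4 : R) * n%:R = n%:R^-1.
  have -> : n%:R ^- 4 = (n%:R ^- 2) ^+ 2 :> R by field; rewrite gt_eqF.
  rewrite sqrtr_sqr ger0_norm; last by rewrite invr_ge0 exprn_ge0// ltW.
  by field; rewrite gt_eqF.
have tail := HC1 _ n0R.
have lo := smoothing_lower P mS x n%:R s0.
have up := smoothing_upper P mS x n%:R s0.
rewrite sE -pE in lo up.
have := HC d Omega P n X (x - n%:R^-1) n0 HX indX.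
have := HC d Omega P n X (x + n%:R^-1) n0 HX indX.
rewrite -!/(H n _) !ler_norml => /andP[_ u2] /andP[l1 _].
by rewrite mulrDl; exact: smoothing_sandwich l1 u2 tail lo up.
Qed.

End distribution_bounds.

(** The positivity of [n] is recorded too, because [1 / sqrt 0] is 0. *)
Lemma sqrt_inv_eventually {R : realType} (d : R) : 0 < d ->
  exists N, forall n, (N <= n)%N -> (0 < n)%N /\ (Num.sqrt n%:R)^-1 <= d.
Proof.
move=> d0; exists (Num.trunc (d^-1 ^+ 2)).+1 => n Nn.
have n0 : (0 < n)%N by exact: leq_trans Nn.
split => //; rewrite -[d]invrK lef_pV2 ?posrE ?invr_gt0 ?sqrtr_gt0 ?ltr0n//.
rewrite -[d^-1]ger0_norm ?invr_ge0 ?(ltW d0)// -sqrtr_sqr ler_sqrt ?ler0n//.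
by apply: ltW; apply: lt_le_trans (truncnS_gt _) _; rewrite ler_nat.
Qed.

Section reduction.
Context {R : realType}.
Variables (tau : R) (lambda g : R -> R).
Hypothesis tau0 : 0 < tau.
Local Notation mu := (@lebesgue_measure R).
Local Notation D := (`]0, tau]%classic : set R).
Hypothesis mlam : measurable_fun `[0, tau] lambda.
Hypothesis lam0 : forall t, t \in `[0, tau] -> 0 <= lambda t.
Hypothesis ilam : mu.-integrable `[0, tau] (EFin \o lambda).
Hypothesis mg : measurable_fun `[0, tau] g.
Hypothesis g4_fin : (\int[mu]_(t in `[0%R, tau]) (`|g t| `^ 4 * lambda t)%:E < +oo)%E.

(** [g] is only assumed measurable on [0, tau]; its extension by 0 is
    measurable on the line and has the same integrals. *)
Definition zero_extension : R -> R := g \_ `[0, tau].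
Local Notation gr := zero_extension.

Lemma zero_extensionE t : D t -> gr t = g t.
Proof. by move=> Dt; rewrite /gr patchE mem_set//; exact: subset_itv_oc_cc Dt. Qed.

Lemma measurable_zero_extension : measurable_fun setT gr.
Proof. by apply/(measurable_restrictT _ _).1 => //; exact: measurable_itv. Qed.

Lemma stochastic_integral_zero_extension d (Omega : measurableType d)
    (X : Omega -> cumulative R R) w :
  stochastic_integral tau g X w = stochastic_integral tau gr X w.
Proof. by apply: eq_Rintegral => t /set_mem Dt; rewrite zero_extensionE. Qed.

Lemma half_open_lambda_integrable : mu.-integrable D (EFin \o lambda).
Proof.
apply: (integrableS _ _ _ ilam); [exact: measurable_itv | exact: measurable_itv |].
exact: subset_itv_oc_cc.
Qed.

Let Dlam0 t : D t -> 0 <= lambda t.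
Proof. by move=> Dt; apply: lam0; exact: subset_itv_oc_cc Dt. Qed.

Lemma zero_extension_integrable4 :
  mu.-integrable D (EFin \o (fun t => `|gr t| ^+ 4 * lambda t)).
Proof.
have mgl : measurable_fun `[0, tau] (fun t => `|g t| ^+ 4 * lambda t).
  by apply: measurable_funM => //; apply: measurable_funX; exact: measurableT_comp.
have i : mu.-integrable `[0, tau] (EFin \o (fun t => `|g t| ^+ 4 * lambda t)).
  apply/integrableP; split; first exact/measurable_EFinP.
  apply: le_lt_trans g4_fin; rewrite le_eqVlt; apply/orP; left; apply/eqP.
  apply: eq_integral => t /set_mem tI; rewrite gee0_abs; last first.
    by rewrite lee_fin mulr_ge0 ?exprn_ge0// lam0.
  by rewrite /= powR_mulrn.
have iD : mu.-integrable D (EFin \o (fun t => `|g t| ^+ 4 * lambda t)).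
  by apply: (integrableS _ _ _ i); [exact: measurable_itv | exact: measurable_itv | exact: subset_itv_oc_cc].
apply: eq_integrable iD; first exact: measurable_oc.
by move=> t /set_mem Dt; rewrite /= zero_extensionE.
Qed.

Lemma Rintegral_zero_extension (f : R -> R) :
  mu.-integrable D (EFin \o (fun t => f (gr t) * lambda t)) ->
  \int[mu]_(t in `[0, tau]) (f (g t) * lambda t) =
  \int[mu]_(t in D) (f (gr t) * lambda t).
Proof.
move=> i; rewrite -Rintegral_itv_obnd_cbnd.
  by apply: eq_Rintegral => t /set_mem Dt; rewrite zero_extensionE.
apply: eq_integrable i; first exact: measurable_oc.
by move=> t /set_mem Dt; rewrite /= zero_extensionE.
Qed.

Lemma Rintegral_zero_extension_pow k : (k <= 4)%N ->
  \int[mu]_(t in `[0, tau]) (g t ^+ k * lambda t) =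
  \int[mu]_(t in D) (gr t ^+ k * lambda t).
Proof.
move=> k4; apply: (@Rintegral_zero_extension (fun x => x ^+ k)).
apply: weighted_pow_integrable => //.
- exact: half_open_lambda_integrable.
- exact: measurable_zero_extension.
- exact: zero_extension_integrable4.
Qed.

Lemma Rintegral_zero_extension_sin v :
  \int[mu]_(t in `[0, tau]) (sin (v * g t) ^+ 2 * lambda t) =
  \int[mu]_(t in D) (sin (v * gr t) ^+ 2 * lambda t).
Proof.
apply: (@Rintegral_zero_extension (fun x => sin (v * x) ^+ 2)).
apply: (@weighted_bounded_integrable _ _ _ _ Dlam0 half_open_lambda_integrable
  measurable_zero_extension zero_extension_integrable4 (fun x => sin (v * x) ^+ 2) 1) => //.
  by apply: measurable_funX; under eq_fun do rewrite mulrC; exact: measurable_sinM.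
by move=> x; rewrite normrX exprn_ile1// norm_sin_le1.
Qed.

End reduction.

Theorem proposition1 (R : realType) (alpha beta tau : R)
    (lambda : R -> R -> R) (g : R -> R) (G : R -> R) (theta0 : R)
    (d : nat -> measure_display) (Omega : forall n, measurableType (d n))
    (P : forall n, probability (Omega n) R)
    (X : forall n, 'I_n -> Omega n -> cumulative R R)
    (theta_check : forall n, Omega n -> R) :
  let m := moment tau g lambda in
  let psi1 := psi m G theta0 1 in
  let psi2 := psi m G theta0 2 in
  let a2 := g_moment tau lambda g theta0 2 in
  let a3 := g_moment tau lambda g theta0 3 in
  let b2 := psi2 * Num.sqrt a2 / psi1 in
  let eps : nat -> R^o := fun n => (Num.sqrt n%:R)^-1 in
  0 < tau ->
  intensity_family alpha beta tau lambda ->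
  measurable_fun `[0, tau] g ->
  theta0 \in `]alpha, beta[ ->
  (forall n (j : 'I_n), is_poisson_process (P n) tau (lambda theta0) (X n j)) ->
  (forall n, independent_processes (P n) tau (X n)) ->
  condL1 2 alpha beta m ->
  condL2 alpha beta m ->
  condL3 alpha beta tau lambda g ->
  is_inverse_on alpha beta m G ->
  (forall n w, is_mme alpha beta m (empirical_moment tau g (X n) w) (theta_check n w)) ->
  0 < a2 ->
  0 < psi1 ->
  (exists2 b : R, 0 < b &
    0 < inf [set \int[lebesgue_measure]_(t in `[0, tau])
                   (sin (v * g t) ^+ 2 * lambda theta0 t)
            | v in [set v : R | 1 < a2 * b * `|v|]]) ->
  forall y : R,
    (fun n => fine (P n [set w |
       Num.sqrt n%:R * (theta_check n w - theta0) / (psi1 * Num.sqrt a2) < y]) : R^o) =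
    (fun n => gauss_cdf y
       + (a3 - (a3 + 6 * a2 `^ (3 / 2) * b2) * y ^+ 2) / (6 * a2 `^ (3 / 2))
         * gauss_pdf y * eps n)
    +o_\oo eps.
Proof.
move=> m psi1 psi2 a2 a3 b2 eps tau0 HI mg t0 HX indX L1 L2 L3 iG Hmme a20 psi10 [b b0].
have [mlam lam0] := HI theta0 t0.
set delta := inf _ => delta0 y.
have ilam0 : lebesgue_measure.-integrable `[0, tau] (EFin \o lambda theta0).
  exact: poisson_lambda_integrable (HX 1%N ord0).
have g4 : (\int[lebesgue_measure]_(t in `[0%R, tau]) (`|g t| `^ 4 * lambda theta0 t)%:E < +oo)%E.
  by apply: le_lt_trans (L3 4 _) => //; apply: ereal_sup_ubound; exists theta0.
have ilam := half_open_lambda_integrable ilam0.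
pose gr := zero_extension tau g.
have mgr : measurable_fun setT gr by exact: measurable_zero_extension.
have igr4 := zero_extension_integrable4 mlam lam0 mg g4.
have mom k k4 := @Rintegral_zero_extension_pow _ _ _ _ mlam lam0 ilam0 mg g4 k k4.
have a2E : a2 = \int[lebesgue_measure]_(t in `]0, tau]) (gr t ^+ 2 * lambda theta0 t).
  exact: mom.
have a3E : a3 = \int[lebesgue_measure]_(t in `]0, tau]) (gr t ^+ 3 * lambda theta0 t).
  exact: mom.
have m0E : m theta0 = \int[lebesgue_measure]_(t in `]0, tau]) (gr t ^+ 1 * lambda theta0 t).
  by rewrite -mom.
(* The hypothesis on [sin ^ 2] reads [v0 < `|v|]. *)
pose v0 := (a2 * b)^-1.
have ab0 : 0 < a2 * b by rewrite mulr_gt0.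
have v00 : 0 < v0 by rewrite invr_gt0.
have sin_lower v : v0 < `|v| ->
    delta <= \int[lebesgue_measure]_(t in `]0, tau]) (sin (v * gr t) ^+ 2 * lambda theta0 t).
  rewrite /v0 -[(a2 * b)^-1]mul1r ltr_pdivrMr// mulrC => hv.
  rewrite -(Rintegral_zero_extension_sin mlam lam0 ilam0 mg g4).
  apply: ge_inf; last by exists v.
  exists 0 => _ [u _ <-]; apply: Rintegral_ge0 => t tI.
  by rewrite mulr_ge0 ?sqr_ge0// lam0.
have m2_gt0 := a20; rewrite a2E in m2_gt0.
have [C C0 HC] := standardized_sum_cdf_bounds tau0 mlam lam0 ilam mgr igr4 m2_gt0 v00 delta0 sin_lower.
rewrite -a2E -a3E -m0E in HC.
set kap := a3 / (a2 * Num.sqrt a2) in HC.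
have s20 : 0 < Num.sqrt a2 by rewrite sqrtr_gt0.
apply/eqaddoP => eta eta0.
have eta2 : 0 < eta / 2 by rewrite divr_gt0.
have [dA dA0 HA] := edgeworth_perturbation kap (b2 * y ^+ 2) y eta2.
have dA2 : 0 < dA / 2 by rewrite divr_gt0.
have [dB dB0 HB] := moment_threshold y t0 L1 L2 iG psi10 a20 dA2.
have C1 : 0 < C + 1 by rewrite ltr_wpDl.
(* [dA / 2] serves both the displacement [1 / n = ep ^ 2] and the error of
   [moment_threshold]; the last term makes [C / n] at most [eta / 2 * ep]. *)
pose e0 := Num.min (Num.min dA dB) (Num.min (dA / 2) (eta / (2 * (C + 1)))).
have e00 : 0 < e0 by rewrite !lt_min dA0 dB0 dA2 divr_gt0// mulr_gt0.
have [N HN] := sqrt_inv_eventually e00.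
exists N => // n /= Nn.
have [n0 epn] := HN n Nn.
move: epn; rewrite !le_min => /andP[/andP[epA epB] /andP[epA2 epC]].
set ep := (Num.sqrt n%:R)^-1 in epA epB epA2 epC.
have n0R : 0 < n%:R :> R by rewrite ltr0n.
have q0 : 0 < Num.sqrt n%:R :> R by rewrite sqrtr_gt0.
have ep0 : 0 < ep by rewrite invr_gt0.
have nE : n%:R^-1 = ep * ep :> R.
  by rewrite -[n%:R]sqr_sqrtr ?(ltW n0R)// expr2 invfM.
have [] := HB ep _ ep0 epB erefl.
set c := theta0 + _ => cI hx.
set x := (m c - m theta0) / (ep * Num.sqrt a2) in hx.
have event : [set w | Num.sqrt n%:R * (theta_check n w - theta0) / (psi1 * Num.sqrt a2) < y] =
    [set w | standardized_sum tau gr (X n) (m theta0) (Num.sqrt (n%:R * a2)) w < x].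
  have sqE : Num.sqrt (n%:R * a2) = Num.sqrt n%:R * Num.sqrt a2 by rewrite sqrtrM// ltW.
  have qq : n%:R = Num.sqrt n%:R * Num.sqrt n%:R :> R by rewrite -expr2 sqr_sqrtr// ltW.
  have eventE w : (Num.sqrt n%:R * (theta_check n w - theta0) / (psi1 * Num.sqrt a2) < y) =
      (standardized_sum tau gr (X n) (m theta0) (Num.sqrt (n%:R * a2)) w < x).
    have -> : (Num.sqrt n%:R * (theta_check n w - theta0) / (psi1 * Num.sqrt a2) < y) =
        (theta_check n w < c).
      have ps0 : 0 < psi1 * Num.sqrt a2 by rewrite mulr_gt0.
      rewrite (ltr_pdivrMr _ _ ps0) [X in X < _]mulrC -(ltr_pdivlMr _ _ q0) ltrBlDl; congr (_ < _).
      by rewrite /c -/psi1 /ep; ring.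
    rewrite (mme_lt t0 L1 L2 iG psi10 (Hmme n w) cI).
    have -> : standardized_sum tau gr (X n) (m theta0) (Num.sqrt (n%:R * a2)) w =
        (empirical_moment tau g (X n) w - m theta0) / (ep * Num.sqrt a2).
      rewrite /standardized_sum /empirical_moment sqE.
      under [in RHS]eq_bigr do rewrite stochastic_integral_zero_extension.
      rewrite -/gr /ep; move: qq q0 (\sum_j _) => {sqE}.
      by move: (Num.sqrt n%:R) => q -> qpos S; field; rewrite !gt_eqF.
    by rewrite /x ltr_pM2r ?invr_gt0 ?mulr_gt0// ltrD2r.
  by apply/seteqP; split => w /=; rewrite eventE.
have bnd := fun z => HC (d n) (Omega n) (P n) n (X n) z n0 (HX n) (indX n).
have /andP[lo up] := bnd x _ erefl.
set p := fine _ in lo up.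
have est (z : R) : `|z - x| <= ep * ep ->
    `|gauss_cdf z + kap * ep / 6 * (1 - z ^+ 2) * gauss_pdf z -
      (gauss_cdf y + (kap / 6 * (1 - y ^+ 2) - b2 * y ^+ 2) * gauss_pdf y * ep)| <= eta / 2 * ep.
  move=> zx; apply: HA => //.
  have -> : z - (y - b2 * y ^+ 2 * ep) = (z - x) + (x - (y - b2 * y ^+ 2 * ep)) by ring.
  rewrite (le_trans (ler_normD _ _))// [leRHS](_ : _ = dA / 2 * ep + dA / 2 * ep); last by field.
  apply: lerD => //; apply: (le_trans zx).
  by rewrite ler_wpM2r// ltW.
have e1 : `|(x - n%:R^-1) - x| <= ep * ep.
  by rewrite addrAC subrr sub0r normrN ger0_norm ?invr_ge0 ?ler0n// nE.
have e2 : `|(x + n%:R^-1) - x| <= ep * ep.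
  by rewrite addrAC subrr add0r ger0_norm ?invr_ge0 ?ler0n// nE.
have h1 := est _ e1; have h2 := est _ e2.
rewrite ler_norml in h1; rewrite ler_norml in h2.
move: h1 h2 => /andP[l1 _] /andP[_ u2].
have Cn : C / n%:R <= eta / 2 * ep.
  rewrite nE mulrA ler_wpM2r ?(ltW ep0)//.
  apply: (le_trans (ler_wpM2l C0 epC)); apply: (@le_trans _ _ ((C + 1) * (eta / (2 * (C + 1))))).
    by rewrite ler_wpM2r ?lerDl// divr_ge0 ?ltW// mulr_gt0.
  by rewrite le_eqVlt; apply/orP; left; apply/eqP; field; rewrite gt_eqF.
have target : (a3 - (a3 + 6 * a2 `^ (3 / 2) * b2) * y ^+ 2) / (6 * a2 `^ (3 / 2)) =
    kap / 6 * (1 - y ^+ 2) - b2 * y ^+ 2.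
  have -> : a2 `^ (3 / 2) = a2 * Num.sqrt a2.
    by rewrite [3 / 2](_ : _ = 1 + 2^-1) ?powRD ?powRr1 ?powR12_sqrt ?gt_eqF ?ltW//; field.
  by rewrite /kap; field; rewrite !gt_eqF.
change (`|fine (P n [set w |
      Num.sqrt n%:R * (theta_check n w - theta0) / (psi1 * Num.sqrt a2) < y]) -
    (gauss_cdf y + (a3 - (a3 + 6 * a2 `^ (3 / 2) * b2) * y ^+ 2) / (6 * a2 `^ (3 / 2))
       * gauss_pdf y * ep)| <= eta * `|ep|).
rewrite event -/p target (gtr0_norm ep0) ler_norml.
have lo' : gauss_cdf (x - n%:R^-1) + kap * ep / 6 * (1 - (x - n%:R^-1) ^+ 2) *
    gauss_pdf (x - n%:R^-1) - C / n%:R <= p by exact: lo.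
have up' : p <= gauss_cdf (x + n%:R^-1) + kap * ep / 6 * (1 - (x + n%:R^-1) ^+ 2) *
    gauss_pdf (x + n%:R^-1) + C / n%:R by exact: up.
exact: final_sandwich l1 u2 Cn lo' up'.
Qed.
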